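(* If $(K,v,\sigma,s)$ is an existentially closed $s$-valued difference field, and we set $\operatorname{ac}(x)=\operatorname{res}(x/s(v(x)))$, then $(K,v,\sigma,\operatorname{ac})$ is existentially closed as an $\mathrm{ac}$-valued difference field. Therefore, $(K,v,\sigma)$ is existentially closed as a valued difference field.
   Context: A valued difference field $(K,v,\sigma)$ is a valued field with surjective valuation $v\colon K\to\Gamma\cup\{\infty\}$ (the trivial valuation is allowed), valuation ring $\mathcal O$, residue field $k$, residue map $\operatorname{res}$, together with a (surjective) field automorphism $\sigma$ of $K$ with $\sigma(\mathcal O)=\mathcal O$; $\sigma$ induces automorphisms of $\Gamma$ and $k$, also denoted $\sigma$. An $s$-valued difference field is a valued difference field with a cross-section $s$, i.e. a group homomorphism $s\colon\Gamma\to K^\times$ with $v(s(\gamma))=\gamma$, satisfying $s\circ\sigma=\sigma\circ s$. An $\mathrm{ac}$-valued difference field is a valued difference field with an angular component, i.e. a map $\operatorname{ac}\colon K\to k$ with $\operatorname{ac}(0)=0$, multiplicative $K^\times\to k^\times$ and equal to $\operatorname{res}$ on $\mathcal O^\times$, satisfying $\operatorname{ac}\circ\sigma=\sigma\circ\operatorname{ac}$. No assumption is made on characteristics. All are regarded as three-sorted structures (sorts $\mathrm{VF}$, $\Gamma$ including $\infty$, $k$) with field operations including $(-)^{-1}$ (with $0^{-1}=0$) on $\mathrm{VF}$ and $k$; $+,0,-,<,\infty$ on $\Gamma$; $v$ and $\operatorname{res}$ (equal to $0$ outside $\mathcal O$); $\sigma,\sigma^{-1}$ on each sort; and in addition a symbol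 for $s\colon\Gamma\to\mathrm{VF}$ (resp. $\operatorname{ac}\colon\mathrm{VF}\to k$) in the $s$-valued (resp. $\mathrm{ac}$-valued) case. Embeddings preserve all this structure. An object $M$ of one of these categories is existentially closed in it if, for every embedding $f\colon M\to N$ in the category, every tuple $a$ from $M$, and every parameter-free quantifier-free formula $\phi(x,y)$ in the corresponding language, $N\models\exists x\,\phi(x,f(a))$ implies $M\models\exists x\,\phi(x,a)$. *)

(* Defs.v *)
From HB Require Import structures.
From mathcomp Require Import all_boot all_order all_algebra.

Set Implicit Arguments.
Unset Strict Implicit.
Unset Printing Implicit Defensive.

Import Order.TTheory GRing.Theory Num.Theory.
Local Open Scope ring_scope.

Record signature (S : Type) := Signature {
  fsym : seq S -> S -> Type;
  rsym : seq S -> Type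
}.

Fixpoint hprod (S : Type) (A : S -> Type) (w : seq S) : Type :=
  if w is t :: w' then (A t * hprod A w')%type else unit.

Fixpoint hmap (S : Type) (A B : S -> Type) (h : forall t, A t -> B t)
    (w : seq S) : hprod A w -> hprod B w :=
  match w with
  | [::] => fun _ => tt
  | t :: w' => fun p => (h t p.1, hmap h p.2)
  end.

Record structure (S : Type) (L : signature S) := Structure {
  car : S -> Type;
  ifun : forall w t, fsym L w t -> hprod car w -> car t;
  irel : forall w, rsym L w -> hprod car w -> Prop
}.

Arguments ifun {S L} M {w t} f _ : rename.
Arguments irel {S L} M {w} r _ : rename.

Section Syntax.
Variables (S : Type) (L : signature S).

Inductive term (X : S -> Type) : S -> Type :=
| Var t : X t -> term X t
| App w t : fsym L w t -> terms X w -> term X t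
with terms (X : S -> Type) : seq S -> Type :=
| Tnil : terms X [::]
| Tcons t w : term X t -> terms X w -> terms X (t :: w).

Inductive qfformula (X : S -> Type) : Type :=
| QFalse
| QEq t of term X t & term X t
| QRel w of rsym L w & terms X w
| QNot of qfformula X
| QAnd of qfformula X & qfformula X
| QOr of qfformula X & qfformula X.

Section Semantics.
Variables (M : structure L) (X : S -> Type) (e : forall t, X t -> car M t).

Fixpoint teval t (u : term X t) : car M t :=
  match u in term _ t0 return car M t0 with
  | Var t x => e x
  | App w t f us => ifun M f (tseval us)
  end
with tseval w (us : terms X w) : hprod (car M) w :=
  match us in terms _ w0 return hprod (car M) w0 with
  | Tnil => tt
  | Tcons t w u us => (teval u, tseval us)
  end.

Fixpoint holds (phi : qfformula X) : Prop :=
  match phi with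
  | QFalse => False
  | QEq t u u' => teval u = teval u'
  | QRel w r us => irel M r (tseval us)
  | QNot p => ~ holds p
  | QAnd p q => holds p /\ holds q
  | QOr p q => holds p \/ holds q
  end.

End Semantics.

Record embedding (M N : structure L) := Embedding {
  emap :> forall t, car M t -> car N t;
  emap_inj : forall t, injective (emap (t := t));
  emap_fun : forall w t (f : fsym L w t) (p : hprod (car M) w),
    emap (ifun M f p) = ifun N f (hmap emap p);
  emap_rel : forall w (r : rsym L w) (p : hprod (car M) w),
    irel M r p <-> irel N r (hmap emap p)
}.

(* A many-sorted tuple has [m t] entries of sort [t]. *)
Definition tuplevar (m : S -> nat) (t : S) : Type := 'I_(m t).
Definition mtuple (M : structure L) (m : S -> nat) :=
  forall t, tuplevar m t -> car M t.

(* The variables of phi(x, y): [inl i] is x_i and [inr j] is y_j. *)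
Definition xyvar (m n : S -> nat) (t : S) : Type :=
  (tuplevar m t + tuplevar n t)%type.

Definition xyval (M : structure L) (m n : S -> nat)
    (x : mtuple M m) (y : mtuple M n) (t : S) (z : xyvar m n t) : car M t :=
  match z with inl i => x t i | inr j => y t j end.

(* Existential closedness of [M] in the category whose objects are those of
   [C], regarded as [L]-structures through [str], and whose morphisms are the
   embeddings of [L]-structures. *)
Definition existentially_closed (C : Type) (str : C -> structure L) (M : C) :=
  forall (N : C) (f : embedding (str M) (str N)) (m n : S -> nat)
    (phi : qfformula (xyvar m n)) (a : mtuple (str M) n),
    (exists x : mtuple (str N) m,
        holds (xyval x (fun t j => f t (a t j))) phi) ->
    exists x : mtuple (str M) m, holds (xyval x a) phi.

End Syntax.

HB.mixin Record isOrderedAbelian G of Num.POrderedZmodule G := {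
  oag_le_total : total (<=%R : rel G);
  oag_leD2l : forall x y z : G, (y <= z) -> (x + y <= x + z)
}.

#[short(type="oagType")]
HB.structure Definition OrderedAbelian :=
  { G of Num.POrderedZmodule G & isOrderedAbelian G }.

(* [option G] is the group G with [None] as the point at infinity, which
   absorbs addition, is its own opposite and lies above G. *)
Section AtInfinity.
Variable G : oagType.
Implicit Types a b : option G.

Definition oadd a b : option G :=
  if a is Some x then (if b is Some y then Some (x + y) else None) else None.

Definition oopp a : option G := omap -%R a.

Definition ole a b : bool :=
  if b is Some y then (if a is Some x then x <= y else false) else true.

Definition olt a b : bool :=
  if a is Some x then (if b is Some y then x < y else true) else false.

Definition omin a b : option G := if ole a b then a else b.

End AtInfinity.

(* The residue field is any field [vf_k] given with a surjective ring
   morphism from the valuation ring whose kernel is the maximal ideal. *)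
Record valuedField := ValuedField {
  vf_K :> fieldType;
  vf_G : oagType;
  vf_k : fieldType;
  vf_v : vf_K -> option vf_G;
  vf_res : vf_K -> vf_k;
  vf_in_O : pred vf_K := fun x => ole (Some 0) (vf_v x);
  vf_vinf : forall x, vf_v x = None <-> x = 0;
  vf_vM : forall x y, vf_v (x * y) = oadd (vf_v x) (vf_v y);
  vf_vD : forall x y, ole (omin (vf_v x) (vf_v y)) (vf_v (x + y));
  vf_v_surj : forall g : option vf_G, exists x, vf_v x = g;
  vf_res_out : forall x, ~~ vf_in_O x -> vf_res x = 0;
  vf_res1 : vf_res 1 = 1;
  vf_resD : forall x y, vf_in_O x -> vf_in_O y ->
    vf_res (x + y) = vf_res x + vf_res y;
  vf_resM : forall x y, vf_in_O x -> vf_in_O y ->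
    vf_res (x * y) = vf_res x * vf_res y;
  vf_res_surj : forall c : vf_k, exists2 x, vf_in_O x & vf_res x = c;
  vf_res_ker : forall x, vf_in_O x -> vf_res x = 0 <-> olt (Some 0) (vf_v x)
}.

(* [vdf_sG] and [vdf_sk] are the maps induced by sigma; the inverses are part
   of the data because the language names them, but all four maps are
   determined by sigma. *)
Record valuedDiffField := ValuedDiffField {
  vdf_vf :> valuedField;
  vdf_s : {rmorphism vdf_vf -> vdf_vf};
  vdf_sV : vdf_vf -> vdf_vf;
  vdf_sG : vf_G vdf_vf -> vf_G vdf_vf;
  vdf_sGV : vf_G vdf_vf -> vf_G vdf_vf;
  vdf_sk : vf_k vdf_vf -> vf_k vdf_vf;
  vdf_skV : vf_k vdf_vf -> vf_k vdf_vf;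
  vdf_sK : cancel vdf_s vdf_sV;
  vdf_sVK : cancel vdf_sV vdf_s;
  vdf_s_O : forall x, vf_in_O (vdf_s x) = vf_in_O x;
  vdf_v_s : forall x, vf_v (vdf_s x) = omap vdf_sG (vf_v x);
  vdf_res_s : forall x, vf_res (vdf_s x) = vdf_sk (vf_res x);
  vdf_sGK : cancel vdf_sG vdf_sGV;
  vdf_sGVK : cancel vdf_sGV vdf_sG;
  vdf_skK : cancel vdf_sk vdf_skV;
  vdf_skVK : cancel vdf_skV vdf_sk
}.

Record sValuedDiffField := SValuedDiffField {
  svdf_vdf :> valuedDiffField;
  svdf_cs : vf_G svdf_vdf -> svdf_vdf;
  svdf_csD : forall g h, svdf_cs (g + h) = svdf_cs g * svdf_cs h;
  svdf_v_cs : forall g, vf_v (svdf_cs g) = Some g;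
  svdf_cs_s : forall g, svdf_cs (vdf_sG g) = vdf_s svdf_vdf (svdf_cs g)
}.

Record acValuedDiffField := AcValuedDiffField {
  acvdf_vdf :> valuedDiffField;
  acvdf_ac : acvdf_vdf -> vf_k acvdf_vdf;
  acvdf_ac0 : acvdf_ac 0 = 0;
  acvdf_ac_neq0 : forall x, x != 0 -> acvdf_ac x != 0;
  acvdf_acM : forall x y, x != 0 -> y != 0 ->
    acvdf_ac (x * y) = acvdf_ac x * acvdf_ac y;
  acvdf_ac_res : forall x, vf_v x = Some 0 -> acvdf_ac x = vf_res x;
  acvdf_ac_s : forall x, acvdf_ac (vdf_s acvdf_vdf x) = vdf_sk (acvdf_ac x)
}.

Inductive vsort := VF | VG | RF.

Inductive vdf_fsym : seq vsort -> vsort -> Type :=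
| VFzero : vdf_fsym [::] VF
| VFone : vdf_fsym [::] VF
| VFadd : vdf_fsym [:: VF; VF] VF
| VFopp : vdf_fsym [:: VF] VF
| VFmul : vdf_fsym [:: VF; VF] VF
| VFinv : vdf_fsym [:: VF] VF
| RFzero : vdf_fsym [::] RF
| RFone : vdf_fsym [::] RF
| RFadd : vdf_fsym [:: RF; RF] RF
| RFopp : vdf_fsym [:: RF] RF
| RFmul : vdf_fsym [:: RF; RF] RF
| RFinv : vdf_fsym [:: RF] RF
| VGzero : vdf_fsym [::] VG
| VGinfty : vdf_fsym [::] VG
| VGadd : vdf_fsym [:: VG; VG] VG
| VGopp : vdf_fsym [:: VG] VG
| Val : vdf_fsym [:: VF] VG
| Res : vdf_fsym [:: VF] RF
| Sigma t : vdf_fsym [:: t] t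
| SigmaV t : vdf_fsym [:: t] t.

Inductive vdf_rsym : seq vsort -> Type :=
| VGlt : vdf_rsym [:: VG; VG].

Inductive svdf_fsym : seq vsort -> vsort -> Type :=
| SBase w t : vdf_fsym w t -> svdf_fsym w t
| CrossSection : svdf_fsym [:: VG] VF.

Inductive acvdf_fsym : seq vsort -> vsort -> Type :=
| AcBase w t : vdf_fsym w t -> acvdf_fsym w t
| AngularComponent : acvdf_fsym [:: VF] RF.

Definition L_vdf : signature vsort := Signature vdf_fsym vdf_rsym.
Definition L_svdf : signature vsort := Signature svdf_fsym vdf_rsym.
Definition L_acvdf : signature vsort := Signature acvdf_fsym vdf_rsym.

Definition vdf_car (M : valuedDiffField) (t : vsort) : Type :=
  match t with VF => M | VG => option (vf_G M) | RF => vf_k M end.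

Definition vdf_sigma (M : valuedDiffField) t : vdf_car M t -> vdf_car M t :=
  match t with VF => vdf_s M | VG => omap (@vdf_sG M) | RF => @vdf_sk M end.

Definition vdf_sigmaV (M : valuedDiffField) t : vdf_car M t -> vdf_car M t :=
  match t with VF => @vdf_sV M | VG => omap (@vdf_sGV M) | RF => @vdf_skV M end.

Definition vdf_ifun (M : valuedDiffField) w t (f : vdf_fsym w t) :
    hprod (vdf_car M) w -> vdf_car M t :=
  match f in vdf_fsym w0 t0 return hprod (vdf_car M) w0 -> vdf_car M t0 with
  | VFzero => fun _ => 0 : M
  | VFone => fun _ => 1 : M
  | VFadd => fun p => (p.1 : M) + p.2.1
  | VFopp => fun p => - (p.1 : M)
  | VFmul => fun p => (p.1 : M) * p.2.1
  | VFinv => fun p => (p.1 : M)^-1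
  | RFzero => fun _ => 0 : vf_k M
  | RFone => fun _ => 1 : vf_k M
  | RFadd => fun p => (p.1 : vf_k M) + p.2.1
  | RFopp => fun p => - (p.1 : vf_k M)
  | RFmul => fun p => (p.1 : vf_k M) * p.2.1
  | RFinv => fun p => (p.1 : vf_k M)^-1
  | VGzero => fun _ => Some 0
  | VGinfty => fun _ => None
  | VGadd => fun p => oadd p.1 p.2.1
  | VGopp => fun p => oopp p.1
  | Val => fun p => vf_v p.1
  | Res => fun p => vf_res p.1
  | Sigma t => fun p => vdf_sigma p.1
  | SigmaV t => fun p => vdf_sigmaV p.1
  end.

Definition vdf_irel (M : valuedDiffField) w (r : vdf_rsym w) :
    hprod (vdf_car M) w -> Prop :=
  match r in vdf_rsym w0 return hprod (vdf_car M) w0 -> Prop with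
  | VGlt => fun p => olt p.1 p.2.1
  end.

(* The cross-section and the angular component are extended to the points
   infinity and 0 by s(infinity) = 0 and ac(0) = 0. *)
Definition svdf_cs_total (M : sValuedDiffField) (g : option (vf_G M)) : M :=
  oapp (@svdf_cs M) 0 g.

Definition svdf_ifun (M : sValuedDiffField) w t (f : svdf_fsym w t) :
    hprod (vdf_car M) w -> vdf_car M t :=
  match f in svdf_fsym w0 t0 return hprod (vdf_car M) w0 -> vdf_car M t0 with
  | SBase w t f => vdf_ifun f
  | CrossSection => fun p => svdf_cs_total p.1
  end.

Definition acvdf_ifun (M : acValuedDiffField) w t (f : acvdf_fsym w t) :
    hprod (vdf_car M) w -> vdf_car M t :=
  match f in acvdf_fsym w0 t0 return hprod (vdf_car M) w0 -> vdf_car M t0 with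
  | AcBase w t f => vdf_ifun f
  | AngularComponent => fun p => acvdf_ac p.1
  end.

Definition vdf_str (M : valuedDiffField) : structure L_vdf :=
  @Structure _ L_vdf (vdf_car M) (@vdf_ifun M) (@vdf_irel M).

Definition svdf_str (M : sValuedDiffField) : structure L_svdf :=
  @Structure _ L_svdf (vdf_car M) (@svdf_ifun M) (@vdf_irel M).

Definition acvdf_str (M : acValuedDiffField) : structure L_acvdf :=
  @Structure _ L_acvdf (vdf_car M) (@acvdf_ifun M) (@vdf_irel M).

Section ValuedFieldTheory.
Variable V : valuedField.
Implicit Types x y : V.

Lemma vf_neq0P x : x != 0 -> exists g, vf_v x = Some g.
Proof.
move=> x0; case E: (vf_v x) => [g|]; first by exists g.
by move/vf_vinf: E x0 => ->; rewrite eqxx.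
Qed.

Lemma vf_v0 : vf_v (0 : V) = None.
Proof. by apply/vf_vinf. Qed.

Lemma vf_v1 : vf_v (1 : V) = Some 0.
Proof.
have [g vg] := vf_neq0P (oner_neq0 V).
have := vf_vM (1 : V) 1; rewrite mulr1 vg => -[] /esym/eqP.
by rewrite -subr_eq0 addrK => /eqP ->.
Qed.

Lemma vf_vV x g : vf_v x = Some g -> vf_v x^-1 = Some (- g).
Proof.
move=> vx; have x0 : x != 0.
  by apply/eqP => x0; move: vx; rewrite x0 vf_v0.
have [h vh] : exists h, vf_v x^-1 = Some h by apply: vf_neq0P; rewrite invr_eq0.
have := vf_vM x x^-1; rewrite divff // vf_v1 vx vh => -[] /esym/eqP.
by rewrite addrC addr_eq0 => /eqP ->.
Qed.

Lemma vf_O_unit x : vf_v x = Some 0 -> vf_in_O x.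
Proof. by move=> vx; rewrite /vf_in_O vx /= lexx. Qed.

Lemma vf_res_unit x : vf_v x = Some 0 -> vf_res x != 0.
Proof.
move=> vx; apply/eqP => /(vf_res_ker (vf_O_unit vx)).
by rewrite vx /= ltxx.
Qed.

(* [induced_sG] and [induced_sk]: the induced maps that [valuedDiffField] asks
   for always exist and are unique, so they are no extra condition on sigma. *)
Lemma induced_sG (s : {rmorphism V -> V}) :
  (forall x, vf_in_O (s x) = vf_in_O x) ->
  exists sG : vf_G V -> vf_G V,
    (forall x, vf_v (s x) = omap sG (vf_v x)) /\
    forall sG', (forall x, vf_v (s x) = omap sG' (vf_v x)) -> sG' =1 sG.
Proof.
move=> sO.
have surj (g : vf_G V) : exists x, vf_v x == Some g.
  by have [x vx] := vf_v_surj (Some g); exists x; apply/eqP.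
pose l g := xchoose (surj g).
have lE g : vf_v (l g) = Some g by exact: eqP (xchooseP (surj g)).
have v0 x : (vf_v x == None) = (x == 0).
  by apply/eqP/eqP => /vf_vinf.
have key x y g : vf_v x = Some g -> vf_v y = Some g -> vf_v (s x) = vf_v (s y).
  move=> vx vy.
  have nz z : vf_v z = Some g -> z != 0 by move=> vz; rewrite -v0 vz.
  have h z z' : vf_v z = Some g -> vf_v z' = Some g ->
      ole (vf_v (s z')) (vf_v (s z)).
    move=> vz vz'; have : vf_in_O (z / z').
      by apply: vf_O_unit; rewrite vf_vM vz (vf_vV vz') /= subrr.
    rewrite -sO fmorph_div /vf_in_O vf_vM.
    have [a va] : exists a, vf_v (s z) = Some a.
      by apply: vf_neq0P; rewrite fmorph_eq0 nz.
    have [b vb] : exists b, vf_v (s z') = Some b.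
      by apply: vf_neq0P; rewrite fmorph_eq0 nz.
    rewrite (vf_vV vb) va vb /= => /(oag_leD2l b).
    by rewrite addr0 addrCA subrr addr0.
  have := h x y vx vy; have := h y x vy vx.
  case: (vf_v (s x)) (vf_v (s y)) => [a|] [b|] //= ab ba.
  by congr Some; apply/eqP; rewrite eq_le ab ba.
exists (fun g => odflt 0 (vf_v (s (l g)))); split=> [x | sG' sG'E g]; last first.
  by rewrite sG'E lE.
case E: (vf_v x) => [g|] /=; last first.
  by move/vf_vinf: E => ->; rewrite rmorph0 vf_v0.
rewrite (key x (l g) g E (lE g)).
have [a ->] // : exists a, vf_v (s (l g)) = Some a.
by apply: vf_neq0P; rewrite fmorph_eq0 -v0 lE.
Qed.

Lemma vf_res_eq0 x : vf_in_O x ->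
  (vf_res x == 0) = (x == 0) || ~~ vf_in_O x^-1.
Proof.
move=> Ox; have -> : (vf_res x == 0) = olt (Some 0) (vf_v x).
  by apply/eqP/idP => /(vf_res_ker Ox).
have [-> | x0] := eqVneq x 0; first by rewrite vf_v0.
have [g vx] := vf_neq0P x0; move: Ox.
rewrite /vf_in_O (vf_vV vx) vx /= => g0.
rewrite lt_neqAle g0 andbT; congr (~~ _).
apply/eqP/idP => [<- | /(oag_leD2l g)]; first by rewrite oppr0.
by rewrite addr0 subrr => g0'; apply/eqP; rewrite eq_le g0 g0'.
Qed.

Lemma vf_OB x y : vf_in_O x -> vf_in_O y -> vf_in_O (x - y).
Proof.
have OD u w : vf_in_O u -> vf_in_O w -> vf_in_O (u + w).
  move=> Ou Ow; have := vf_vD u w; rewrite /vf_in_O.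
  have : ole (Some 0) (omin (vf_v u) (vf_v w)) by rewrite /omin; case: ifP.
  by case: (omin _ _) (vf_v (u + w)) => [a|] [b|] //=; apply: le_trans.
have ON1 : vf_in_O (-1 : V).
  have [g vN1] : exists g, vf_v (-1 : V) = Some g.
    by apply: vf_neq0P; rewrite oppr_eq0 oner_eq0.
  have := vf_vM (-1 : V) (-1); rewrite mulrNN mulr1 vf_v1 vN1 /= => -[gg].
  rewrite /vf_in_O vN1 /=; have /orP[//|/[dup] g0 /(oag_leD2l g)] := oag_le_total 0 g.
  by rewrite addr0 -gg.
move=> Ox Oy; apply: OD => //; rewrite -mulN1r /vf_in_O vf_vM.
move: ON1 Oy; rewrite /vf_in_O.
case: (vf_v (-1)) (vf_v y) => [a|] [b|] //= a0 /(oag_leD2l a).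
by rewrite addr0; apply: le_trans.
Qed.

Lemma induced_sk (s : {rmorphism V -> V}) :
  (forall x, vf_in_O (s x) = vf_in_O x) ->
  exists sk : vf_k V -> vf_k V,
    (forall x, vf_res (s x) = sk (vf_res x)) /\
    forall sk', (forall x, vf_res (s x) = sk' (vf_res x)) -> sk' =1 sk.
Proof.
move=> sO.
have surj (c : vf_k V) : exists x, vf_in_O x && (vf_res x == c).
  by have [x Ox <-] := vf_res_surj c; exists x; rewrite Ox eqxx.
pose l c := xchoose (surj c).
have lP c : vf_in_O (l c) /\ vf_res (l c) = c.
  by have /andP[? /eqP] := xchooseP (surj c).
have key x y : vf_in_O x -> vf_in_O y -> vf_res x = vf_res y ->
    vf_res (s x) = vf_res (s y).
  move=> Ox Oy xy; have Oxy := vf_OB Ox Oy.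
  have : vf_res (x - y) == 0.
    by apply/eqP/(addIr (vf_res y)); rewrite -vf_resD // subrK add0r.
  rewrite (vf_res_eq0 Oxy) -(fmorph_eq0 s) -sO fmorphV -vf_res_eq0 ?sO //.
  rewrite rmorphB => /eqP E; apply/eqP; rewrite -(subrK (s y) (s x)).
  by rewrite vf_resD ?sO // -?rmorphB ?sO // rmorphB E add0r.
exists (fun c => vf_res (s (l c))); split=> [x | sk' sk'E c]; last first.
  by rewrite sk'E (lP c).2.
have [Ox | nOx] := boolP (vf_in_O x).
  by apply: key => //; [exact: (lP _).1 | rewrite (lP _).2].
have nOsx : ~~ vf_in_O (s x) by rewrite sO.
rewrite (vf_res_out nOx) (vf_res_out nOsx).
have O0 : vf_in_O (0 : V) by rewrite /vf_in_O vf_v0.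
rewrite (key (l 0) 0 (lP 0).1 O0) ?rmorph0.
  by apply/esym/eqP; rewrite vf_res_eq0 ?eqxx.
by rewrite (lP 0).2; apply/esym/eqP; rewrite vf_res_eq0 ?eqxx.
Qed.

End ValuedFieldTheory.

Section InducedMaps.
Variable M : valuedDiffField.

Lemma vdf_sGD : {morph @vdf_sG M : g h / g + h}.
Proof.
move=> g h; have [x vx] := vf_v_surj (Some g); have [y vy] := vf_v_surj (Some h).
have := vdf_v_s (x * y); rewrite rmorphM !vf_vM !vdf_v_s vx vy /=.
by case.
Qed.

Lemma vdf_sG_le : {mono @vdf_sG M : g h / g <= h}.
Proof.
have sG0 : vdf_sG 0 = 0 :> vf_G M.
  by apply: (addrI (vdf_sG 0)); rewrite -vdf_sGD !addr0.
have ge0 (g : vf_G M) : (0 <= vdf_sG g) = (0 <= g).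
  have [x vx] := vf_v_surj (Some g).
  by have := vdf_s_O x; rewrite /vf_in_O vdf_v_s vx.
have leB (a b : vf_G M) : (0 <= b - a) = (a <= b).
  apply/idP/idP => [/(oag_leD2l a) | /(oag_leD2l (- a))].
    by rewrite addr0 addrC subrK.
  by rewrite addNr addrC.
have sGN (g : vf_G M) : vdf_sG (- g) = - vdf_sG g.
  by apply: (addrI (vdf_sG g)); rewrite -vdf_sGD !subrr sG0.
by move=> g h; rewrite -leB -sGN -vdf_sGD ge0 leB.
Qed.

Lemma vdf_sk1 : vdf_sk (1 : vf_k M) = 1.
Proof. by rewrite -[in LHS](vf_res1 M) -vdf_res_s rmorph1 vf_res1. Qed.

Lemma vdf_skD : {morph @vdf_sk M : c d / c + d}.
Proof.
move=> c d; have [x Ox <-] := vf_res_surj c; have [y Oy <-] := vf_res_surj d.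
by rewrite -vf_resD // -!vdf_res_s rmorphD vf_resD // vdf_s_O.
Qed.

Lemma vdf_skM : {morph @vdf_sk M : c d / c * d}.
Proof.
move=> c d; have [x Ox <-] := vf_res_surj c; have [y Oy <-] := vf_res_surj d.
by rewrite -vf_resM // -!vdf_res_s rmorphM vf_resM // vdf_s_O.
Qed.

Lemma vdf_sk0 : vdf_sk (0 : vf_k M) = 0.
Proof. by apply: (addrI (vdf_sk 0)); rewrite -vdf_skD !addr0. Qed.

End InducedMaps.

Section AcOfCrossSection.
Variable M : sValuedDiffField.
Implicit Types x y : M.

Definition ac_of_cs x : vf_k M := vf_res (x / svdf_cs_total (vf_v x)).

Lemma v_div_cs x : x != 0 -> vf_v (x / svdf_cs_total (vf_v x)) = Some 0.
Proof.
case/vf_neq0P => g vx.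
by rewrite vf_vM vx /= (vf_vV (svdf_v_cs g)) /= subrr.
Qed.

Lemma ac_of_cs0 : ac_of_cs 0 = 0.
Proof.
rewrite /ac_of_cs mul0r; have O0 : vf_in_O (0 : M) by rewrite /vf_in_O vf_v0.
by apply/(vf_res_ker O0); rewrite vf_v0.
Qed.

Lemma ac_of_cs_neq0 x : x != 0 -> ac_of_cs x != 0.
Proof. by move=> x0; apply: vf_res_unit; apply: v_div_cs. Qed.

Lemma ac_of_csM x y : x != 0 -> y != 0 ->
  ac_of_cs (x * y) = ac_of_cs x * ac_of_cs y.
Proof.
move=> x0 y0; rewrite /ac_of_cs -vf_resM ?vf_O_unit ?v_div_cs //.
have [[g vx] [h vy]] := (vf_neq0P x0, vf_neq0P y0).
by rewrite vf_vM vx vy /= svdf_csD invfM mulrACA.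
Qed.

Lemma svdf_cs0 : svdf_cs 0 = 1 :> M.
Proof.
have nz : svdf_cs 0 != 0 :> M.
  by apply/eqP => E; have := svdf_v_cs (0 : vf_G M); rewrite E vf_v0.
by apply: (mulfI nz); rewrite -svdf_csD addr0 mulr1.
Qed.

Lemma ac_of_cs_res x : vf_v x = Some 0 -> ac_of_cs x = vf_res x.
Proof. by rewrite /ac_of_cs => -> /=; rewrite svdf_cs0 divr1. Qed.

Lemma ac_of_cs_s x : ac_of_cs (vdf_s M x) = vdf_sk (ac_of_cs x).
Proof.
rewrite /ac_of_cs vdf_v_s -vdf_res_s fmorph_div; congr (vf_res (_ / _)).
by case: (vf_v x) => [g|] /=; rewrite ?svdf_cs_s ?rmorph0.
Qed.

Definition acvdf_of_svdf : acValuedDiffField :=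
  @AcValuedDiffField M ac_of_cs ac_of_cs0 ac_of_cs_neq0 ac_of_csM
    ac_of_cs_res ac_of_cs_s.

End AcOfCrossSection.

(* Main.v *)
From HB Require Import structures.
From mathcomp Require Import all_boot all_order all_algebra.
From mathcomp Require Import finmap boolp classical_sets.
From mathcomp Require Import ring_quotient fraction generic_quotient.
From mathcomp.multinomials Require Import monalg.
From mathcomp.real_closed Require Import realalg.
From mathcomp Require Import zify ring lra.
Require Import Defs.

Set Implicit Arguments.
Unset Strict Implicit.
Unset Printing Implicit Defensive.

Import Order.TTheory GRing.Theory Num.Theory.
Local Open Scope ring_scope.

(** * Group rings *)

Section Additive.
Variables (U V : zmodType) (F : U -> V).
Hypothesis FD : {morph F : x y / x + y}.

Lemma morphD0 : F 0 = 0.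
Proof. by apply: (addrI (F 0)); rewrite -FD !addr0. Qed.

Lemma morphDN x : F (- x) = - F x.
Proof. by apply: (addrI (F x)); rewrite -FD !subrr morphD0. Qed.

Lemma morphDB x y : F (x - y) = F x - F y.
Proof. by rewrite FD morphDN. Qed.

Lemma morphD_sum I (r : seq I) (P : pred I) E :
  F (\sum_(i <- r | P i) E i) = \sum_(i <- r | P i) F (E i).
Proof. exact: (big_morph F FD morphD0). Qed.

Lemma morphDMn n x : F (x *+ n) = F x *+ n.
Proof. by elim: n => [|n IH]; rewrite ?morphD0 // !mulrS FD IH. Qed.

Lemma morphD_inj : (forall x, F x = 0 -> x = 0) -> injective F.
Proof.
by move=> F0 x y /eqP; rewrite -subr_eq0 -morphDB => /eqP/F0/eqP;
  rewrite subr_eq0 => /eqP.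
Qed.
End Additive.

Definition gring (R : comNzRingType) (G : zmodType) : Type := {malg R[G]}.

HB.instance Definition _ (R : comNzRingType) (G : zmodType) :=
  GRing.Zmodule.on (gring R G).

Section GroupRing.
Variables (R : comNzRingType) (G : zmodType).
Local Notation A := (gring R G).
Implicit Types (f g : A) (q r : G) (a b : R).

Definition gcf q f : R := mcoeff q (f : {malg R[G]}).
Definition gU q a : A := locked (<< a *g q >> : {malg R[G]}).
Definition gsupp f : {fset G} := msupp (f : {malg R[G]}).

Lemma gringP f g : (forall q, gcf q f = gcf q g) -> f = g.
Proof. by move=> h; apply/malgP. Qed.

Lemma gcfD q : {morph gcf q : f g / f + g}.
Proof. by move=> f g; rewrite /gcf -mcoeffD. Qed.

Lemma gcf0 q : gcf q 0 = 0. Proof. exact: morphD0 (gcfD q). Qed.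
Lemma gcfN q f : gcf q (- f) = - gcf q f. Proof. exact: morphDN (gcfD q) f. Qed.
Lemma gcfB q f g : gcf q (f - g) = gcf q f - gcf q g.
Proof. exact: morphDB (gcfD q) f g. Qed.

Lemma gcfU q r a : gcf r (gU q a) = a *+ (q == r).
Proof. by rewrite /gU -lock; apply: mcoeffU. Qed.

Lemma gcfUU q a : gcf q (gU q a) = a.
Proof. by rewrite gcfU eqxx. Qed.

Lemma gsuppE f q : (q \in gsupp f) = (gcf q f != 0).
Proof. by rewrite /gsupp -mcoeff_neq0. Qed.

Lemma gUD q : {morph gU q : a b / a + b}.
Proof. by move=> a b; apply: gringP => r; rewrite gcfD !gcfU mulrnDl. Qed.

Lemma gU0 q : gU q 0 = 0. Proof. exact: morphD0 (gUD q). Qed.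
Lemma gUN q a : gU q (- a) = - gU q a. Proof. exact: morphDN (gUD q) a. Qed.

Lemma gringE f : f = \sum_(q <- gsupp f) gU q (gcf q f).
Proof. by rewrite {1}[f]monalgE; apply: eq_bigr => q _; rewrite /gU -lock. Qed.

Lemma gring_ind (P : A -> Prop) :
  P 0 -> (forall q a f, P f -> P (gU q a + f)) -> forall f, P f.
Proof.
move=> P0 PD f; rewrite (gringE f).
elim: (enum_fset _) => [|q s IH]; first by rewrite big_nil.
by rewrite big_cons; apply: PD.
Qed.

Lemma gring_ext (W : zmodType) (F F' : A -> W) :
  {morph F : f g / f + g} -> {morph F' : f g / f + g} ->
  (forall q a, F (gU q a) = F' (gU q a)) -> F =1 F'.
Proof.
move=> FD FD' FU; apply: gring_ind => [|q a f IH].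
  by rewrite (morphD0 FD) (morphD0 FD').
by rewrite FD FD' FU IH.
Qed.

(** Extension by additivity of a map given on monomials. *)
Definition glift (W : zmodType) (phi : G -> R -> W) f : W :=
  \sum_(q <- gsupp f) phi q (gcf q f).

Section Glift.
Variables (W : zmodType) (phi : G -> R -> W).
Hypothesis phiD : forall q, {morph phi q : a b / a + b}.

Lemma glift_sub (d : {fset G}) f : {subset gsupp f <= d} ->
  glift phi f = \sum_(q <- d) phi q (gcf q f).
Proof.
move=> sub; apply: big_fset_incl; first by apply/fsubsetP.
by move=> q _; rewrite gsuppE negbK => /eqP ->; rewrite (morphD0 (@phiD q)).
Qed.

Lemma gliftD : {morph glift phi : f g / f + g}.
Proof.
move=> f g; pose d := (gsupp f `|` gsupp g)%fset.
rewrite (@glift_sub d f) ?(@glift_sub d g) ?(@glift_sub d (f + g)).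
- by rewrite -big_split; apply: eq_bigr => q _; rewrite gcfD phiD.
- move=> q; rewrite in_fsetU !gsuppE gcfD.
  by have [->|//] := eqVneq (gcf q f) 0; rewrite add0r.
- by move=> q qg; rewrite in_fsetU qg orbT.
- by move=> q qf; rewrite in_fsetU qf.
Qed.

Lemma gliftU q a : glift phi (gU q a) = phi q a.
Proof.
rewrite (@glift_sub [fset q]%fset).
  by rewrite big_seq_fset1 gcfUU.
move=> r; rewrite gsuppE gcfU in_fset1 eq_sym.
by have [//|_] := eqVneq r q; rewrite mulr0n eqxx.
Qed.
End Glift.

Definition gmul : A -> A -> A :=
  locked (fun f g => glift (fun q a => glift (fun r b => gU (q + r) (a * b)) g) f).

Let gmulE f g : gmul f g = glift (fun q a => glift (fun r b => gU (q + r) (a * b)) g) f.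
Proof. by rewrite /gmul -lock. Qed.

Let mulD_r q a : forall r, {morph (fun b => gU (q + r) (a * b)) : x y / x + y}.
Proof. by move=> r x y; rewrite mulrDr gUD. Qed.

Let mulD_l g : forall q, {morph (fun a => glift (fun r b => gU (q + r) (a * b)) g) : x y / x + y}.
Proof.
move=> q x y; rewrite /glift -big_split; apply: eq_bigr => r _.
by rewrite mulrDl gUD.
Qed.

Lemma gmulDl g : {morph gmul^~ g : x y / x + y}.
Proof. by move=> x y; rewrite !gmulE; apply: gliftD (mulD_l g) x y. Qed.

Lemma gmulDr f : {morph gmul f : x y / x + y}.
Proof.
move=> x y; rewrite !gmulE /glift -big_split; apply: eq_bigr => q _.
exact: gliftD (mulD_r _ _) x y.
Qed.

Lemma gmulUU q r a b : gmul (gU q a) (gU r b) = gU (q + r) (a * b).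
Proof. by rewrite gmulE gliftU ?gliftU. Qed.

Lemma gmulC : commutative gmul.
Proof.
move=> f g; apply: (gring_ext (F := gmul^~ g) (F' := gmul g)) f => [||q a].
- exact: gmulDl.
- exact: gmulDr.
apply: (gring_ext (F := gmul (gU q a)) (F' := gmul^~ (gU q a))) g => [||r b].
- exact: gmulDr.
- exact: gmulDl.
by rewrite !gmulUU addrC mulrC.
Qed.

Lemma gmulA : associative gmul.
Proof.
move=> f g h.
apply: (gring_ext (F := fun x => gmul x (gmul g h))
  (F' := fun x => gmul (gmul x g) h)) f => [x y|x y|q a]; rewrite ?gmulDl //.
apply: (gring_ext (F := fun x => gmul (gU q a) (gmul x h))
  (F' := fun x => gmul (gmul (gU q a) x) h)) g => [x y|x y|r b];
  rewrite ?(gmulDl, gmulDr) //.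
apply: (gring_ext (F := fun x => gmul (gU q a) (gmul (gU r b) x))
  (F' := fun x => gmul (gmul (gU q a) (gU r b)) x)) h => [x y|x y|s c];
  rewrite ?(gmulDl, gmulDr) //.
by rewrite !gmulUU addrA mulrA.
Qed.

Lemma gmul1 : left_id (gU 0 1) gmul.
Proof.
move=> f; apply: (gring_ext (F := gmul (gU 0 1)) (F' := id)) f => // [|q a].
  exact: gmulDr.
by rewrite gmulUU add0r mul1r.
Qed.

Lemma gone_neq0 : gU 0 1 != 0.
Proof.
by apply/eqP => /(congr1 (gcf 0)) /eqP; rewrite gcfUU gcf0 oner_eq0.
Qed.

HB.instance Definition _ := GRing.Zmodule_isComNzRing.Build A
  gmulA gmulC gmul1 (fun x y z => gmulDl z x y) gone_neq0.

Lemma gUM q r a b : gU q a * gU r b = gU (q + r) (a * b).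
Proof. exact: gmulUU. Qed.

Lemma g1E : 1 = gU 0 1 :> A. Proof. by []. Qed.

Lemma gU_X q a n : gU q a ^+ n = gU (q *+ n) (a ^+ n).
Proof.
by elim: n => [|n IH]; rewrite ?mulr0n ?expr0 // mulrS !exprS IH gUM.
Qed.

Lemma gcfUM q r a f : gcf r (gU q a * f) = a * gcf (r - q) f.
Proof.
apply: (gring_ext (F := fun f => gcf r (gU q a * f))
  (F' := fun f => a * gcf (r - q) f)) f => [x y|x y|s b].
- by rewrite mulrDr gcfD.
- by rewrite gcfD mulrDr.
- rewrite gUM !gcfU mulrnAr; congr (_ *+ nat_of_bool _).
  by rewrite eq_sym [RHS]eq_sym subr_eq addrC.
Qed.

Lemma gcfMl r f g : gcf r (f * g) = \sum_(q <- gsupp f) gcf q f * gcf (r - q) g.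
Proof.
rewrite {1}(gringE f) mulr_suml (morphD_sum (gcfD r)).
by apply: eq_bigr => q _; rewrite gcfUM.
Qed.

Lemma gsuppM f g r : r \in gsupp (f * g) ->
  exists2 q, q \in gsupp f & r - q \in gsupp g.
Proof.
rewrite gsuppE gcfMl; apply: contra_neqP => /forall2NP h.
rewrite big_seq big1 // => q qf; case: (h q) => // /negP.
by rewrite gsuppE negbK => /eqP ->; rewrite mulr0.
Qed.

End GroupRing.

Section GroupRingMap.
Variables (R S : comNzRingType) (G H : zmodType).
Variables (t : {rmorphism R -> S}) (h : G -> H).
Hypothesis hD : {morph h : x y / x + y}.

Definition gmap : gring R G -> gring S H :=
  glift (fun q a => gU (h q) (t a)).

Let gmapD_aux q : {morph (fun a => gU (h q) (t a)) : a b / a + b}.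
Proof. by move=> a b; rewrite rmorphD gUD. Qed.

Lemma gmapD : {morph gmap : f g / f + g}.
Proof. exact: gliftD gmapD_aux. Qed.

Lemma gmapU q a : gmap (gU q a) = gU (h q) (t a).
Proof. exact: (gliftU gmapD_aux). Qed.

Lemma gmap1 : gmap 1 = 1.
Proof. by rewrite g1E gmapU (morphD0 hD) rmorph1. Qed.

Lemma gmapM : {morph gmap : f g / f * g}.
Proof.
move=> f g.
apply: (gring_ext (F := fun x => gmap (x * g))
  (F' := fun x => gmap x * gmap g)) f => [x y|x y|q a];
  rewrite ?(mulrDl, gmapD) //.
apply: (gring_ext (F := fun x => gmap (gU q a * x))
  (F' := fun x => gmap (gU q a) * gmap x)) g => [x y|x y|r b];
  rewrite ?(mulrDr, gmapD) //.
by rewrite gUM !gmapU gUM hD rmorphM.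
Qed.
End GroupRingMap.

Lemma rmorphismP (B C : pzRingType) (F : B -> C) :
  {morph F : x y / x + y} -> {morph F : x y / x * y} -> F 1 = 1 ->
  exists s : {rmorphism B -> C}, s =1 F.
Proof.
move=> FD FM F1.
have FB : zmod_morphism F by move=> x y; rewrite (morphDB FD).
have FMM : monoid_morphism F by split.
pose a := GRing.isZmodMorphism.Build B C F FB.
pose m := GRing.isMonoidMorphism.Build B C F FMM.
pose s : {rmorphism B -> C} := HB.pack F a m.
by exists s.
Qed.

(** * Fields from prime ideals *)

Section PrimeQuotient.
Variables (B : comNzRingType) (I : B -> Prop).
Hypothesis I0 : I 0.
Hypothesis ID : forall x y, I x -> I y -> I (x + y).
Hypothesis IM : forall a x, I x -> I (a * x).
Hypothesis I1 : ~ I 1.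
Hypothesis Iprime : forall x y, I (x * y) -> I x \/ I y.

Definition ideal_pred : pred B := fun x => `[< I x >].

Fact ideal_pred_closed : idealr_closed ideal_pred.
Proof.
split; [exact/asboolP | exact/asboolP |].
by move=> a x y /asboolP Ix /asboolP Iy; apply/asboolP/ID => //; apply: IM.
Qed.
HB.instance Definition _ := isIdealr.Build B ideal_pred ideal_pred_closed.

Fact ideal_pred_prime : prime_idealr_closed ideal_pred.
Proof.
by move=> x y /asboolP/Iprime[]/asboolP h; apply/orP; [left|right].
Qed.
HB.instance Definition _ := isPrimeIdealrClosed.Build B ideal_pred ideal_pred_prime.

Let prime_pred : prime_idealr B := ideal_pred.

Definition pquot : Type := {ideal_quot prime_pred}.
HB.instance Definition _ := GRing.ComNzRing.on pquot.

Definition pquot_unit : pred pquot := fun x => `[< exists y, y * x = 1 >].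
Definition pquot_inv (x : pquot) : pquot :=
  if pselect (exists y, y * x = 1) is left h then projT1 (cid h) else x.

Fact pquot_mulV : {in pquot_unit, left_inverse 1 pquot_inv *%R}.
Proof.
move=> x /asboolP h; rewrite /pquot_inv; case: pselect => // h'.
by case: cid.
Qed.

Fact pquot_unitP x y : y * x = 1 -> pquot_unit x.
Proof. by move=> h; apply/asboolP; exists y. Qed.

Fact pquot_invN : {in [predC pquot_unit], pquot_inv =1 id}.
Proof.
by move=> x /asboolPn h; rewrite /pquot_inv; case: pselect.
Qed.

HB.instance Definition _ := GRing.ComNzRing_hasMulInverse.Build pquot
  pquot_mulV pquot_unitP pquot_invN.

Fact pquot_integral (x y : pquot) : x * y = 0 -> (x == 0) || (y == 0).
Proof. exact: (@Quotient.rquot_IdomainAxiom _ prime_pred). Qed.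

HB.instance Definition _ := GRing.ComUnitRing_isIntegral.Build pquot pquot_integral.

Lemma field_of_prime : exists (K : fieldType) (j : {rmorphism B -> K}),
  (forall x, j x = 0 <-> I x) /\
  (forall z, exists x y, j y != 0 /\ z = j x / j y).
Proof.
pose pi_ : {rmorphism B -> {ideal_quot prime_pred}} := \pi_({ideal_quot prime_pred})%qT.
pose J (x : B) : {fraction pquot} := FracField.tofrac (pi_ x : pquot).
have [| | |j jE] := @rmorphismP B {fraction pquot} J.
- by move=> x y; rewrite /J rmorphD -tofracD.
- by move=> x y; rewrite /J rmorphM -tofracM.
- by rewrite /J rmorph1 -tofrac1.
have j0 x : j x = 0 <-> I x.
  rewrite jE /J; split=> [/eqP|Ix].
    rewrite tofrac_eq0 => /eqP h; have : pi_ x == pi_ 0 by rewrite rmorph0 h.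
    by rewrite /pi_ /= -Quotient.idealrBE subr0 => /asboolP.
  have -> : pi_ x = pi_ 0.
    by apply/eqP; rewrite /pi_ /= -Quotient.idealrBE subr0; apply/asboolP.
  by rewrite rmorph0; apply/eqP; rewrite tofrac_eq0.
exists {fraction pquot}, j; split => // z.
have [n [d [d0 ->]]] : exists n d : pquot, d != 0 /\
    z = FracField.tofrac n / FracField.tofrac d.
  elim/quotW: z => x; exists (frac x).1, (frac x).2; split; first exact: denom_ratioP.
  have td0 : FracField.tofrac (frac x).2 != 0 by rewrite tofrac_eq0 denom_ratioP.
  apply: (canRL (mulfK td0)); rewrite -[LHS]/(FracField.mul _ _).
  unlock FracField.tofrac; rewrite -[LHS]FracField.pi_mul; apply/eqmodP.
  by rewrite /= FracField.equivfE /FracField.mulf /= !numden_Ratio ?mulf_neq0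
    ?oner_neq0 ?denom_ratioP // !mulr1 mulrC.
exists (repr n), (repr d); rewrite !jE /J /pi_ /= !reprK.
by rewrite tofrac_eq0.
Qed.
End PrimeQuotient.

Lemma fraction_map (B : comNzRingType) (K F : fieldType) (j : {rmorphism B -> K})
    (phi : {rmorphism B -> F}) :
  (forall z, exists x y, j y != 0 /\ z = j x / j y) ->
  (forall x, phi x = 0 -> j x = 0) -> (forall x, j x = 0 -> phi x = 0) ->
  exists Phi : {rmorphism K -> F}, forall x, Phi (j x) = phi x.
Proof.
move=> gen k1 k2.
pose num z := projT1 (cid (gen z)).
pose den z := projT1 (cid (projT2 (cid (gen z)))).
have nd z : j (den z) != 0 /\ z = j (num z) / j (den z).
  by rewrite /num /den; case: cid => x hx /=; case: cid.
pose P z := phi (num z) / phi (den z).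
have nz y : j y != 0 -> phi y != 0 by apply: contra_neq; apply: k1.
have E x y z : j y != 0 -> z * j y = j x -> P z * phi y = phi x.
  move=> y0; have [d0 {1}->] := nd z => h.
  have /eqP : j (num z * y) = j (x * den z).
    by rewrite !rmorphM -h mulrAC divfK.
  rewrite -subr_eq0 -rmorphB => /eqP/k2/eqP.
  rewrite rmorphB !rmorphM subr_eq0 => /eqP h'.
  by rewrite /P mulrAC h' mulfK ?nz.
have Pj x : P (j x) = phi x.
  by rewrite -[LHS]mulr1 -(rmorph1 phi) (@E x) ?rmorph1 ?oner_neq0 ?mulr1.
have jnd z : z * j (den z) = j (num z).
  by have [d0 {1}->] := nd z; rewrite divfK.
have Pnd z : P z * phi (den z) = phi (num z).
  by apply: E; [exact: (nd z).1 | exact: jnd].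
have [| | |Phi PhiE] := @rmorphismP K F P; last by exists Phi => x; rewrite PhiE.
- move=> z1 z2; have d12 : j (den z1 * den z2) != 0.
    by rewrite rmorphM mulf_neq0 // ?(nd z1).1 ?(nd z2).1.
  apply: (mulIf (nz _ d12)).
  rewrite (@E (num z1 * den z2 + num z2 * den z1)) //.
    by rewrite mulrDl !rmorphD !rmorphM -!Pnd; ring.
  by rewrite mulrDl !rmorphD !rmorphM -!jnd; ring.
- move=> z1 z2; have d12 : j (den z1 * den z2) != 0.
    by rewrite rmorphM mulf_neq0 // ?(nd z1).1 ?(nd z2).1.
  apply: (mulIf (nz _ d12)); rewrite (@E (num z1 * num z2)) //.
    by rewrite !rmorphM -!Pnd; ring.
  by rewrite !rmorphM -!jnd; ring.
- by rewrite -(rmorph1 j) Pj rmorph1.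
Qed.

(** * Ordered abelian groups *)

Section Subgroup.
Variables (G : zmodType) (P : G -> Prop).
Hypothesis PB : forall x y, P x -> P y -> P (x - y).
Hypothesis P0 : P 0.

Definition subgrp_pred : {pred G} := fun x => `[< P x >].
Fact subgrp_closed : zmod_closed subgrp_pred.
Proof.
split; first exact/asboolP.
by move=> x y /asboolP Px /asboolP Py; apply/asboolP/PB.
Qed.
HB.instance Definition _ := GRing.isZmodClosed.Build G subgrp_pred subgrp_closed.

Let sg : zmodClosed G := subgrp_pred.

Record subgrp := Subgrp { subgrp_val : G; _ : subgrp_val \in sg }.
HB.instance Definition _ := [isSub for subgrp_val].
HB.instance Definition _ := [Choice of subgrp by <:].
HB.instance Definition _ := [SubChoice_isSubZmodule of subgrp by <:].

Lemma subgroup_exists : exists (S : zmodType) (i : S -> G),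
  [/\ {morph i : x y / x + y}, injective i & forall g, P g <-> exists s, i s = g].
Proof.
exists subgrp, subgrp_val; split => //; first exact: val_inj.
move=> g; split=> [/asboolP Pg|[[s hs] <-]]; first by exists (Subgrp Pg).
exact/asboolP.
Qed.

Lemma quotient_group_exists : exists (C : zmodType) (pi : G -> C),
  [/\ {morph pi : x y / x + y}, forall c, exists q, pi q = c &
      forall q, pi q = 0 <-> P q].
Proof.
exists (Quotient.quot sg), \pi_(Quotient.quot sg)%qT; split.
- by move=> x y /=; rewrite raddfD.
- by move=> c; exists (repr c); rewrite reprK.
- move=> q; rewrite -[0](raddf0 \pi_(Quotient.quot sg)%qT) /=.
  split=> [/eqP|Pq]; last apply/eqP; rewrite -Quotient.idealrBE subr0.
    by move/asboolP.
  exact/asboolP.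
Qed.
End Subgroup.

(** An abelian group with a translation-invariant total order, repackaged. *)
Section OagOfRel.
Variables (G : zmodType) (le : rel G).
Hypotheses (le_refl : reflexive le) (le_anti : antisymmetric le)
  (le_trans : transitive le) (le_total : total le)
  (leD : forall x y z, le y z -> le (x + y) (x + z)).

Definition oag_of_rel_type of reflexive le : Type := G.
Let T := oag_of_rel_type le_refl.
HB.instance Definition _ := GRing.Zmodule.on T.
HB.instance Definition _ :=
  Order.Le_isPOrder.Build ring_display T le_refl le_anti le_trans.
HB.instance Definition _ := isOrderedAbelian.Build T le_total leD.

Lemma oag_of_rel : exists (D : oagType) (i : G -> D) (i' : D -> G),
  [/\ cancel i i', cancel i' i, {morph i : x y / x + y} &
      forall x y, (i x <= i y) = le x y].
Proof. by exists T, id, id; split. Qed.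
End OagOfRel.

Section OagTheory.
Variable G : oagType.
Implicit Types x y z : G.

Lemma oag_leD2 x : {mono +%R x : y z / y <= z}.
Proof.
move=> y z; apply/idP/idP => [|/(oag_leD2l x)//].
by move/(oag_leD2l (- x)); rewrite !addKr.
Qed.

Lemma oag_leD2r x y z : (y + x <= z + x) = (y <= z).
Proof. by rewrite ![_ + x]addrC oag_leD2. Qed.

Lemma oag_ltNge x y : (x < y) = ~~ (y <= x).
Proof. by apply: comparable_ltNge; apply: oag_le_total. Qed.

Lemma oag_leNgt x y : (x <= y) = ~~ (y < x).
Proof. by rewrite oag_ltNge negbK. Qed.

Lemma oag_ltD2 x y z : (x + y < x + z) = (y < z).
Proof. by rewrite !oag_ltNge oag_leD2. Qed.

Lemma oag_ltD2r x y z : (y + x < z + x) = (y < z).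
Proof. by rewrite !oag_ltNge oag_leD2r. Qed.

Lemma oag_leD x y z t : x <= y -> z <= t -> x + z <= y + t.
Proof. by move=> xy zt; rewrite (@le_trans _ _ (y + z)) ?oag_leD2 ?oag_leD2r. Qed.

Lemma oag_ltleD x y z t : x < y -> z <= t -> x + z < y + t.
Proof. by move=> xy zt; rewrite (@lt_le_trans _ _ (y + z)) ?oag_leD2 ?oag_ltD2r. Qed.

Lemma oag_leltD x y z t : x <= y -> z < t -> x + z < y + t.
Proof. by move=> xy zt; rewrite (@le_lt_trans _ _ (y + z)) ?oag_ltD2 ?oag_leD2r. Qed.

Lemma oag_subr_ge0 x y : (0 <= y - x) = (x <= y).
Proof. by rewrite -[RHS](oag_leD2r (- x)) subrr. Qed.

Lemma oag_subr_gt0 x y : (0 < y - x) = (x < y).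
Proof. by rewrite -[RHS](oag_ltD2r (- x)) subrr. Qed.

Lemma oag_leN2 x y : (- x <= - y) = (y <= x).
Proof. by rewrite -(oag_leD2 x) subrr -[RHS]oag_subr_ge0. Qed.

Lemma oag_mulrn_gt0 x n : 0 < x -> 0 < x *+ n.+1.
Proof.
move=> x0; elim: n => [|n IH] //; rewrite mulrS -[0]addr0.
by apply: oag_ltleD => //; apply: ltW.
Qed.

Lemma oag_mulrn_eq0 x n : x *+ n.+1 = 0 -> x = 0.
Proof.
move=> xn; apply: contrapT => /eqP x0.
have [|] := boolP (0 < x); first by move/(oag_mulrn_gt0 n); rewrite xn ltxx.
rewrite -oag_leNgt le_eqVlt (negbTE x0) /= => xlt0.
have : 0 < - x by rewrite -sub0r oag_subr_gt0.
by move/(oag_mulrn_gt0 n); rewrite mulNrn xn oppr0 ltxx.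
Qed.

Lemma oag_mulrn_le x y n : (x *+ n.+1 <= y *+ n.+1) = (x <= y).
Proof.
apply/idP/idP => [|xy]; last first.
  by elim: n => [|n IH] //; rewrite !(mulrS _ n.+1) oag_leD.
apply: contraTT; rewrite -!oag_ltNge -oag_subr_gt0 => /(oag_mulrn_gt0 n).
by rewrite mulrnBl oag_subr_gt0.
Qed.
End OagTheory.

Lemma sub_oag_exists (G : oagType) (P : G -> Prop) :
  (forall x y, P x -> P y -> P (x - y)) -> P 0 ->
  exists (S : oagType) (i : S -> G),
    [/\ {morph i : x y / x + y}, {mono i : x y / x <= y} &
        forall g, P g <-> exists s, i s = g].
Proof.
move=> PB P0; have [S [i [iD ii iP]]] := subgroup_exists PB P0.
have [||||x y z h|D [e [e' [eK e'K eD ele]]]] :=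
  @oag_of_rel S (fun x y => i x <= i y).
- by move=> x; apply: lexx.
- by move=> x y h; apply/ii/le_anti.
- by move=> x y z h1 h2; apply: le_trans h1 h2.
- by move=> x y; apply: oag_le_total.
- by rewrite !iD oag_leD2.
exists D, (i \o e'); split.
- by move=> x y /=; rewrite -[x]e'K -[y]e'K -eD !eK iD.
- by move=> x y /=; rewrite -[x in RHS]e'K -[y in RHS]e'K ele.
- move=> g; split=> [/iP[s <-]|[s <-]]; first by exists (e s); rewrite /= eK.
  by apply/iP; exists (e' s).
Qed.

(** The lexicographic product, the first factor dominating. *)
Lemma lex_oag_exists (G D : oagType) :
  exists (L : oagType) (pr : G -> D -> L) (p1 : L -> G) (p2 : L -> D),
  [/\ forall g d, p1 (pr g d) = g, forall g d, p2 (pr g d) = d,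
      forall l, pr (p1 l) (p2 l) = l,
      forall g d g' d', pr g d + pr g' d' = pr (g + g') (d + d') &
      forall g d g' d',
        (pr g d <= pr g' d') = (g < g') || ((g == g') && (d <= d'))].
Proof.
pose le (x y : G * D) := (x.1 < y.1) || ((x.1 == y.1) && (x.2 <= y.2)).
have [||||x y z|L [e [e' [eK e'K eD ele]]]] := @oag_of_rel (G * D)%type le.
- by move=> x; rewrite /le eqxx lexx orbT.
- move=> [x1 x2] [y1 y2]; rewrite /le /=.
  have [->|xy] := eqVneq x1 y1; first by rewrite ltxx /= => /le_anti ->.
  rewrite !orbF => /andP[h1 h2].
  by have := lt_trans h1 h2; rewrite ltxx.
- move=> [y1 y2] [x1 x2] [z1 z2]; rewrite /le /=.
  move=> /orP[h1|/andP[/eqP -> h1]] /orP[h2|/andP[/eqP <- h2]].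
  + by rewrite (lt_trans h1 h2).
  + by rewrite h1.
  + by rewrite h2.
  + by rewrite eqxx (le_trans h1 h2) orbT.
- move=> [x1 x2] [y1 y2]; rewrite /le /=.
  have [->|xy] := eqVneq x1 y1; first by rewrite ltxx /= oag_le_total.
  by rewrite !orbF !lt_neqAle xy eq_sym xy /= oag_le_total.
- by rewrite /le /= oag_ltD2 oag_leD2 (inj_eq (addrI _)).
exists L, (fun g d => e (g, d)), (fun l => (e' l).1), (fun l => (e' l).2); split.
- by move=> g d; rewrite eK.
- by move=> g d; rewrite eK.
- by move=> l; rewrite -surjective_pairing e'K.
- by move=> g d g' d'; rewrite -eD.
- by move=> g d g' d'; rewrite ele.
Qed.

(** * Semivaluations *)

Section OptionOrder.
Variable G : oagType.
Implicit Types a b c : option G.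

Lemma ole_refl a : ole a a. Proof. by case: a => //= x; apply: lexx. Qed.

Lemma ole_trans b a c : ole a b -> ole b c -> ole a c.
Proof. by case: a b c => [x|] [y|] [z|] //=; apply: le_trans. Qed.

Lemma ole_total a b : ole a b || ole b a.
Proof. by case: a b => [x|] [y|] //=; apply: oag_le_total. Qed.

Lemma oltNge a b : olt a b = ~~ ole b a.
Proof. by case: a b => [x|] [y|] //=; apply: oag_ltNge. Qed.

Lemma oleNgt a b : ole a b = ~~ olt b a.
Proof. by rewrite oltNge negbK. Qed.

Lemma ole_anti a b : ole a b -> ole b a -> a = b.
Proof.
by case: a b => [x|] [y|] //= xy yx; congr Some; apply: le_anti; rewrite xy.
Qed.

Lemma oltW a b : olt a b -> ole a b.
Proof. by case: a b => [x|] [y|] //=; apply: ltW. Qed.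

Lemma ole_lt_trans b a c : ole a b -> olt b c -> olt a c.
Proof. by case: a b c => [x|] [y|] [z|] //=; apply: le_lt_trans. Qed.

Lemma olt_le_trans b a c : olt a b -> ole b c -> olt a c.
Proof. by case: a b c => [x|] [y|] [z|] //=; apply: lt_le_trans. Qed.

Lemma olt_irr a : olt a a = false.
Proof. by rewrite oltNge ole_refl. Qed.

Lemma ole_min c a b : ole c (omin a b) = ole c a && ole c b.
Proof.
rewrite /omin; case: ifP => h; apply/idP/andP => [ca|[]//].
  by split=> //; apply: ole_trans h.
split=> //; apply: ole_trans ca _.
by have := ole_total a b; rewrite h.
Qed.

Lemma omin_cases a b : omin a b = a \/ omin a b = b.
Proof. by rewrite /omin; case: ifP; [left|right]. Qed.

Lemma oaddC a b : oadd a b = oadd b a.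
Proof. by case: a b => [x|] [y|] //=; rewrite addrC. Qed.

Lemma oadd0 a : oadd (Some 0) a = a.
Proof. by case: a => [x|] //=; rewrite add0r. Qed.

Lemma oaddA a b c : oadd a (oadd b c) = oadd (oadd a b) c.
Proof. by case: a b c => [x|] [y|] [z|] //=; rewrite addrA. Qed.

Lemma ole_oadd a b c d : ole a b -> ole c d -> ole (oadd a c) (oadd b d).
Proof. by case: a b c d => [x|] [y|] [z|] [t|] //=; apply: oag_leD. Qed.

Lemma oadd_Some a b g : oadd a b = Some g ->
  exists x y, [/\ a = Some x, b = Some y & x + y = g].
Proof. by case: a b => [x|] [y|] //= [<-]; exists x, y. Qed.

Lemma ole_add2 x a b : ole (oadd (Some x) a) (oadd (Some x) b) = ole a b.
Proof. by case: a b => [y|] [z|] //=; apply: oag_leD2. Qed.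

Lemma oaddKN x a : oadd (Some x) (oadd (Some (- x)) a) = a.
Proof. by case: a => [y|] //=; rewrite addrA subrr add0r. Qed.

Lemma olt_add2 x a b : olt (oadd (Some x) a) (oadd (Some x) b) = olt a b.
Proof. by rewrite !oltNge ole_add2. Qed.
End OptionOrder.

(** A valuation that may take the value infinity away from 0. *)
Record semival (B : comNzRingType) (G : oagType) (w : B -> option G) : Prop := {
  sv0 : w 0 = None;
  sv1 : w 1 = Some 0;
  svM : forall x y, w (x * y) = oadd (w x) (w y);
  svD : forall x y, ole (omin (w x) (w y)) (w (x + y))
}.

Section SemivalTheory.
Variables (B : comNzRingType) (G : oagType) (w : B -> option G).
Hypothesis sv : semival w.
Implicit Types (x y : B) (c : option G).

Lemma svN1 : w (-1) = Some 0.
Proof.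
have := svM sv (-1) (-1); rewrite mulrNN mulr1 (sv1 sv).
move/esym/oadd_Some => [g [h [-> [<-] /= gg]]]; congr Some.
by apply: (@oag_mulrn_eq0 _ g 1); rewrite mulr2n.
Qed.

Lemma svN x : w (- x) = w x.
Proof. by rewrite -mulN1r (svM sv) svN1 oadd0. Qed.

Lemma sv_geD c x y : ole c (w x) -> ole c (w y) -> ole c (w (x + y)).
Proof.
by move=> cx cy; apply: ole_trans (svD sv x y); rewrite ole_min cx cy.
Qed.

Lemma sv_gtD c x y : olt c (w x) -> olt c (w y) -> olt c (w (x + y)).
Proof.
move=> cx cy; apply: olt_le_trans (svD sv x y).
by case: (omin_cases (w x) (w y)) => ->.
Qed.

Lemma sv_geB c x y : ole c (w x) -> ole c (w y) -> ole c (w (x - y)).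
Proof. by move=> cx cy; apply: sv_geD; rewrite ?svN. Qed.

Lemma sv_gtB c x y : olt c (w x) -> olt c (w y) -> olt c (w (x - y)).
Proof. by move=> cx cy; apply: sv_gtD; rewrite ?svN. Qed.

Lemma svBC x y : w (x - y) = w (y - x).
Proof. by rewrite -opprB svN. Qed.

Lemma sv_eqD x y : olt (w x) (w y) -> w (x + y) = w x.
Proof.
move=> xy; apply: ole_anti; last by apply: sv_geD; rewrite ?ole_refl ?oltW.
rewrite oleNgt; apply/negP => h.
by have := sv_gtB h xy; rewrite addrK olt_irr.
Qed.

Lemma sv_eq x y : olt (w x) (w (x - y)) -> w y = w x.
Proof.
by move=> h; rewrite -[y](subKr x) sv_eqD // svN.
Qed.

Lemma sv_eqr x y : olt (w y) (w (x - y)) -> w x = w y.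
Proof. by rewrite svBC => /sv_eq ->. Qed.

Lemma sv_None x y : w (x - y) = None -> w x = w y.
Proof.
move=> h; case E: (w x) => [g|].
  by apply/esym; rewrite -E; apply: sv_eq; rewrite E h.
have : ole None (w y) by rewrite -[y](subKr x); apply: sv_geB; rewrite ?E ?h.
by case: (w y).
Qed.

Lemma sv_sum_ge c I (r : seq I) (P : pred I) (E : I -> B) :
  ole c None -> (forall i, P i -> ole c (w (E i))) -> ole c (w (\sum_(i <- r | P i) E i)).
Proof.
move=> _ h; elim/big_rec: _ => [|i x Pi]; first by rewrite (sv0 sv).
by apply: sv_geD; apply: h.
Qed.

Lemma sv_sum_gt c I (r : seq I) (P : pred I) (E : I -> B) :
  olt c None -> (forall i, P i -> olt c (w (E i))) -> olt c (w (\sum_(i <- r | P i) E i)).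
Proof.
move=> c0 h; elim/big_rec: _ => [|i x Pi]; first by rewrite (sv0 sv).
by apply: sv_gtD; apply: h.
Qed.

Lemma svX x n g : w x = Some g -> w (x ^+ n) = Some (g *+ n).
Proof.
move=> xg; elim: n => [|n IH]; first by rewrite expr0 (sv1 sv) mulr0n.
by rewrite exprS (svM sv) xg IH /= mulrS.
Qed.
End SemivalTheory.

Lemma vf_semival (V : valuedField) : semival (@vf_v V).
Proof. by split; [exact: vf_v0 | exact: vf_v1 | exact: vf_vM | exact: vf_vD]. Qed.

(** * The residue field of a valuation *)

Section ResidueField.
Variables (K : fieldType) (G : oagType) (v : K -> option G).
Hypotheses (sv : semival v) (v_inf : forall x, v x = None -> x = 0).

Definition vring_pred : {pred K} := fun x => ole (Some 0) (v x).

Fact vring_closed : subring_closed vring_pred.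
Proof.
split=> [|x y|x y]; rewrite !unfold_in /vring_pred.
- by rewrite (sv1 sv) /= lexx.
- exact: sv_geB.
move=> x0 y0; rewrite (svM sv).
by rewrite -[Some 0](oadd0 (Some 0)) ole_oadd.
Qed.
HB.instance Definition _ := GRing.isSubringClosed.Build K vring_pred vring_closed.

Let vr : subringClosed K := vring_pred.

Record vring := VRing { vring_val : K; _ : vring_val \in vr }.
HB.instance Definition _ := [isSub for vring_val].
HB.instance Definition _ := [Choice of vring by <:].
HB.instance Definition _ := [SubChoice_isSubComNzRing of vring by <:].

Lemma vV x g : v x = Some g -> v x^-1 = Some (- g).
Proof.
move=> vx; have x0 : x != 0 by apply/eqP => x0; rewrite x0 (sv0 sv) in vx.
have := svM sv x x^-1; rewrite divff // (sv1 sv) vx.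
move/esym/oadd_Some => [_ [h [[<-] -> /eqP]]].
by rewrite addrC addr_eq0 => /eqP ->.
Qed.

Lemma residue_field_exists : exists (k : fieldType) (res : K -> k),
  (forall x, ~~ ole (Some 0) (v x) -> res x = 0) /\ res 1 = 1 /\
  [/\ forall x y, ole (Some 0) (v x) -> ole (Some 0) (v y) ->
        res (x + y) = res x + res y,
      forall x y, ole (Some 0) (v x) -> ole (Some 0) (v y) ->
        res (x * y) = res x * res y,
      forall c, exists2 x, ole (Some 0) (v x) & res x = c &
      forall x, ole (Some 0) (v x) -> res x = 0 <-> olt (Some 0) (v x)].
Proof.
pose V : {rmorphism vring -> K} := val.
have V0 : vring_val 0 = 0 by exact: (rmorph0 V).
have VD x y : vring_val (x + y) = vring_val x + vring_val y by exact: (rmorphD V).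
have VM x y : vring_val (x * y) = vring_val x * vring_val y by exact: (rmorphM V).
have V1 : vring_val 1 = 1 by exact: (rmorph1 V).
pose I (x : vring) := olt (Some 0) (v (vring_val x)) : Prop.
have [|||||k [j [j0 jgen]]] := @field_of_prime vring I.
- by rewrite /I V0 (sv0 sv).
- by move=> x y; rewrite /I VD; apply: sv_gtD.
- move=> [a ha] x; rewrite /I VM (svM sv) /= => hx.
  move: ha; rewrite unfold_in /=; case: (v a) (v _) hx => [g|] [h|] //= h0 g0.
  by rewrite -[0]addr0 oag_leltD.
- by rewrite /I V1 (sv1 sv) /= ltxx.
- move=> [a ha] [b hb]; rewrite /I VM (svM sv).
  rewrite -[vring_val (VRing ha)]/a -[vring_val (VRing hb)]/b.
  have [|a0] := boolP (olt (Some 0) (v a)); first by left.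
  have [|b0] := boolP (olt (Some 0) (v b)); first by right.
  rewrite oltNge (_ : oadd _ _ = Some 0) ?ole_refl //.
  move: ha hb a0 b0; rewrite !unfold_in /vring_pred !oltNge !negbK.
  by move=> /ole_anti ha /ole_anti hb /ha <- /hb <-; rewrite oadd0.
have Ov x : ole (Some 0) (v x) = (x \in vr) by rewrite unfold_in.
pose res x := if insub x is Some y then j (y : vring) else 0.
have resE x (h : x \in vr) : res x = j (VRing h).
  by rewrite /res insubT.
exists k, res; split; last split; last split.
- by move=> x; rewrite Ov /res => h; rewrite insubN.
- by rewrite (resE _ (rpred1 vr)) -[RHS](rmorph1 j); congr (j _); apply: val_inj.
- move=> x y; rewrite !Ov => hx hy.
  rewrite (resE _ hx) (resE _ hy) (resE _ (rpredD hx hy)) -rmorphD.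
  by congr (j _); apply: val_inj.
- move=> x y; rewrite !Ov => hx hy.
  rewrite (resE _ hx) (resE _ hy) (resE _ (rpredM hx hy)) -rmorphM.
  by congr (j _); apply: val_inj.
- move=> c; have [[a ha] [[b hb] [jb ->]]] := jgen c.
  have vb : v b = Some 0.
    apply: contrapT => vb; case/eqP: jb; apply/j0.
    rewrite /I /=; move: hb; rewrite unfold_in.
    case: (v b) vb => [g|] //= g0; rewrite le_eqVlt => /orP[/eqP e|//].
    by case: g0; rewrite e.
  have b0 : b != 0 by apply/eqP => b0; rewrite b0 (sv0 sv) in vb.
  have hV : b^-1 \in vr by rewrite unfold_in (vV vb) oppr0 /= lexx.
  exists (a / b); first by rewrite Ov rpredM.
  apply: (canRL (mulfK jb)); rewrite (resE _ (rpredM ha hV)) -rmorphM.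
  by congr (j _); apply: val_inj => /=; rewrite divfK.
- by move=> x; rewrite Ov => hx; rewrite (resE _ hx); apply: j0.
Qed.
End ResidueField.

Lemma fraction_valuation (B : comNzRingType) (G : oagType) (w : B -> option G) :
  semival w ->
  exists (K : fieldType) (j : {rmorphism B -> K}) (v : K -> option G),
  [/\ semival v, forall x, v x = None -> x = 0, forall x, v (j x) = w x &
      forall z, exists x y, j y != 0 /\ z = j x / j y].
Proof.
move=> sv.
have [| | | | |K [j [j0 gen]]] := @field_of_prime B (fun x => w x = None).
- exact: sv0 sv.
- move=> x y x0 y0; have := svD sv x y; rewrite x0 y0 /omin /=.
  by case: (w _).
- by move=> a x x0; rewrite (svM sv) x0; case: (w a).
- by rewrite (sv1 sv).
- by move=> x y; rewrite (svM sv); case: (w x) (w y) => [a|] [b|] //= _; [right|left|left].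
pose num z := projT1 (cid (gen z)).
pose den z := projT1 (cid (projT2 (cid (gen z)))).
have nd z : j (den z) != 0 /\ z = j (num z) / j (den z).
  by rewrite /num /den; case: cid => x hx /=; case: cid.
have jnd z : z * j (den z) = j (num z).
  by have [d0 {1}->] := nd z; rewrite divfK.
have nz y : j y != 0 -> exists g, w y = Some g.
  by move=> y0; case E: (w y) => [g|]; [exists g | case/eqP: y0; apply/j0].
pose v z := oadd (w (num z)) (oopp (w (den z))).
have vE x y z : j y != 0 -> z * j y = j x -> v z = oadd (w x) (oopp (w y)).
  move=> y0 h; have [g yg] := nz _ y0.
  have [d0 _] := nd z; have [g' dg] := nz _ d0.
  have e : j (num z * y - x * den z) = 0.
    by rewrite rmorphB !rmorphM -jnd -h; ring.
  have : w (num z * y) = w (x * den z) by apply: (sv_None sv); apply/j0.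
  rewrite !(svM sv) /v yg dg /=.
  case: (w (num z)) (w x) => [a|] [b|] //= [e']; congr Some.
  have -> : a = b + g' - g by rewrite -e' addrK.
  by rewrite addrAC addrK.
have vj x : v (j x) = w x.
  rewrite (@vE x 1) ?rmorph1 ?mulr1 ?oner_neq0 // (sv1 sv) /=.
  by case: (w x) => [a|] //=; rewrite oppr0 addr0.
have v_inf z : v z = None -> z = 0.
  have [d0 {2}->] := nd z; have [g dg] := nz _ d0.
  rewrite /v dg /=; case E: (w (num z)) => [//|] _.
  by move/j0: E => ->; rewrite mul0r.
exists K, j, v; split=> //; split.
- by rewrite -(rmorph0 j) vj (sv0 sv).
- by rewrite -(rmorph1 j) vj (sv1 sv).
- move=> z1 z2; have [d1 _] := nd z1; have [d2 _] := nd z2.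
  have [g1 e1] := nz _ d1; have [g2 e2] := nz _ d2.
  rewrite (@vE (num z1 * num z2) (den z1 * den z2)).
  + rewrite !(svM sv) /v e1 e2 /=.
    by case: (w _) (w _) => [a|] [b|] //=; congr Some; rewrite opprD addrACA.
  + by rewrite rmorphM mulf_neq0.
  + by rewrite !rmorphM -!jnd; ring.
- move=> z1 z2; have [d1 _] := nd z1; have [d2 _] := nd z2.
  have [g1 e1] := nz _ d1; have [g2 e2] := nz _ d2.
  rewrite (@vE (num z1 * den z2 + num z2 * den z1) (den z1 * den z2) (z1 + z2)); last first.
  + by rewrite rmorphD !rmorphM -!jnd; ring.
  + by rewrite rmorphM mulf_neq0.
  set c := omin _ _.
  have /andP[c1 c2] : ole c (v z1) && ole c (v z2) by rewrite -ole_min ole_refl.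
  rewrite -(ole_add2 (g1 + g2)).
  have -> : oadd (Some (g1 + g2)) (oadd (w (num z1 * den z2 + num z2 * den z1))
      (oopp (w (den z1 * den z2)))) = w (num z1 * den z2 + num z2 * den z1).
    rewrite (svM sv) e1 e2 /=; case: (w _) => [a|] //=.
    by rewrite addrCA subrr addr0.
  apply: (sv_geD sv); rewrite (svM sv) ?e1 ?e2.
    apply: ole_trans (ole_oadd (ole_refl (Some (g1 + g2))) c1) _.
    rewrite /v e1; case: (w _) => [a|] //=.
    by rewrite [g1 + g2]addrC addrACA subrr addr0 addrC lexx.
  apply: ole_trans (ole_oadd (ole_refl (Some (g1 + g2))) c2) _.
  rewrite /v e2; case: (w _) => [a|] //=.
  by rewrite addrACA subrr addr0 addrC lexx.
Qed.

Lemma valued_field_exists (B : comNzRingType) (G : oagType) (w : B -> option G) :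
  semival w ->
  exists (V : valuedField) (j : {rmorphism B -> V}) (i : vf_G V -> G),
  [/\ {morph i : x y / x + y}, {mono i : x y / x <= y},
      forall x, w x = omap i (vf_v (j x)) &
      forall z, exists x y, j y != 0 /\ z = j x / j y].
Proof.
case/fraction_valuation => K [j [v [sv v_inf vj gen]]].
pose P g := exists z, v z = Some g.
have [| |S [i [iD ile iP]]] := @sub_oag_exists G P.
- move=> x y [a va] [b vb]; exists (a / b).
  by rewrite (svM sv) va (vV sv vb).
- by exists 1; rewrite (sv1 sv).
have i_inj : injective i by move=> x y e; apply: le_anti; rewrite -!ile e lexx.
have /boolp.choice[v' v'E] : forall x, exists a : option S, omap i a = v x.
  move=> x; case E: (v x) => [g|]; last by exists None.
  have /iP[s <-] : P g by exists x.
  by exists (Some s).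
have oi : injective (omap i).
  by move=> [a|] [b|] //= [/i_inj ->].
have iole a b : ole (omap i a) (omap i b) = ole a b.
  by case: a b => [a|] [b|] //=; rewrite ile.
have iadd a b : oadd (omap i a) (omap i b) = omap i (oadd a b).
  by case: a b => [a|] [b|] //=; rewrite iD.
have i0 : i 0 = 0 by apply: morphD0 iD.
have sv' : semival v'.
  split.
  - by apply: oi; rewrite v'E (sv0 sv).
  - by apply: oi; rewrite v'E (sv1 sv) /= i0.
  - by move=> x y; apply: oi; rewrite v'E (svM sv) -!v'E iadd.
  - move=> x y; rewrite -iole v'E; apply: ole_trans (svD sv x y).
    by rewrite ole_min -!v'E !iole -ole_min ole_refl.
have v'_inf x : v' x = None -> x = 0.
  by move=> h; apply: v_inf; rewrite -v'E h.
have [k [res [r1 [r2 [r3 r4 r5 r6]]]]] := residue_field_exists sv'.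
have vinf x : v' x = None <-> x = 0.
  by split=> [|->]; [exact: v'_inf | exact: sv0 sv'].
have vsurj g : exists x, v' x = g.
  case: g => [s|]; last by exists 0; apply: sv0 sv'.
  have /iP[z vz] : exists s', i s' = i s by exists s.
  by exists z; apply: oi; rewrite v'E vz.
pose V := @ValuedField K S k v' res vinf (svM sv') (svD sv') vsurj r1 r2 r3 r4 r5 r6.
exists V, j, i; split => // x.
by rewrite -vj v'E.
Qed.

(** Residue classes and values inherit sigma from the valuation ring. *)
Section ValuedDifferenceField.
Variables (V : valuedField) (s s' : {rmorphism V -> V}).
Hypotheses (sK : cancel s s') (s'K : cancel s' s).
Hypothesis sO : forall x, vf_in_O (s x) = vf_in_O x.

Lemma induced_maps : exists (sG sG' : vf_G V -> vf_G V) (sk sk' : vf_k V -> vf_k V),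
  [/\ forall x, vf_v (s x) = omap sG (vf_v x), cancel sG sG' & cancel sG' sG] /\
  [/\ forall x, vf_res (s x) = sk (vf_res x), cancel sk sk' & cancel sk' sk].
Proof.
have s'O x : vf_in_O (s' x) = vf_in_O x by rewrite -sO s'K.
have [sG [sGE _]] := induced_sG sO; have [sG' [sG'E _]] := induced_sG s'O.
have [sk [skE _]] := induced_sk sO; have [sk' [sk'E _]] := induced_sk s'O.
have GK : cancel sG sG'.
  move=> g; have [x vx] := vf_v_surj (Some g).
  by have := sG'E (s x); rewrite sK sGE vx /= => -[].
have G'K : cancel sG' sG.
  move=> g; have [x vx] := vf_v_surj (Some g).
  by have := sGE (s' x); rewrite s'K sG'E vx /= => -[].
have kK : cancel sk sk'.
  move=> c; have [x _ <-] := vf_res_surj c.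
  by rewrite -skE -sk'E sK.
have k'K : cancel sk' sk.
  move=> c; have [x _ <-] := vf_res_surj c.
  by rewrite -sk'E -skE s'K.
by exists sG, sG', sk, sk'.
Qed.
End ValuedDifferenceField.

Lemma valued_diff_field_exists (B : comNzRingType) (G : oagType)
    (w : B -> option G) (s s' : {rmorphism B -> B}) (sG : G -> G) :
  semival w -> cancel s s' -> cancel s' s -> {mono sG : x y / x <= y} ->
  sG 0 = 0 -> (forall x, w (s x) = omap sG (w x)) ->
  exists (N : valuedDiffField) (j : {rmorphism B -> N}) (i : vf_G N -> G),
  [/\ {morph i : x y / x + y}, {mono i : x y / x <= y},
      forall x, w x = omap i (vf_v (j x)) &
      forall x, j (s x) = vdf_s N (j x)].
Proof.
move=> sv sK s'K sGle sG0 ws.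
have [V [j [i [iD ile vj gen]]]] := valued_field_exists sv.
have i0 : i 0 = 0 by apply: morphD0 iD.
have j0 x : j x = 0 <-> w x = None.
  split=> [jx|]; first by rewrite vj jx vf_v0.
  by rewrite vj; case E: (vf_v _) => [//|] _; apply/vf_vinf.
have ws0 x : w (s x) = None <-> w x = None by rewrite ws; case: (w x).
have ws'0 x : w (s' x) = None <-> w x = None by have := ws0 (s' x); rewrite s'K => -[]; split.
pose js : {rmorphism B -> V} := j \o s.
pose js' : {rmorphism B -> V} := j \o s'.
have [||S SE] := @fraction_map B V V j js gen.
- by move=> x /= /j0/ws0/j0.
- by move=> x /j0/ws0/j0.
have [||S' S'E] := @fraction_map B V V j js' gen.
- by move=> x /= /j0/ws'0/j0.
- by move=> x /j0/ws'0/j0.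
have SK : cancel S S'.
  by move=> z; have [x [y [_ ->]]] := gen z; rewrite !fmorph_div !SE !S'E /= !sK.
have S'K : cancel S' S.
  by move=> z; have [x [y [_ ->]]] := gen z; rewrite !fmorph_div !S'E !SE /= !s'K.
have SO z : vf_in_O (S z) = vf_in_O z.
  have [x [y [y0 ->]]] := gen z; rewrite fmorph_div !SE /= /vf_in_O.
  have [g vy] := vf_neq0P y0; have sy0 : j (s y) != 0.
    by apply: contra_neq y0 => /j0/ws0/j0.
  have [h vsy] := vf_neq0P sy0.
  have /= hg := ws y; rewrite !vj vy vsy /= in hg; case: hg => hg.
  rewrite !vf_vM (vf_vV vy) (vf_vV vsy).
  have := ws x; rewrite !vj.
  case: (vf_v (j x)) (vf_v (j (s x))) => [a|] [b|] //= [ab].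
  by rewrite !oag_subr_ge0 -[LHS]ile -[RHS]ile hg ab sGle.
have [g [g' [k [k' [[gE gK g'K] [kE kK k'K]]]]]] := induced_maps SK S'K SO.
exists (@ValuedDiffField V S S' g g' k k' SK S'K SO gE kE gK g'K kK k'K), j, i.
by split=> // x; rewrite -SE.
Qed.

(** * Homomorphisms of valued difference fields *)

Record vdf_hom (N N' : valuedDiffField) (f : {rmorphism N -> N'})
    (g : vf_G N -> vf_G N') : Prop := {
  vhD : {morph g : x y / x + y};
  vh_le : {mono g : x y / x <= y};
  vh_v : forall x, vf_v (f x) = omap g (vf_v x);
  vh_s : forall x, f (vdf_s N x) = vdf_s N' (f x)
}.

Lemma mono_oag_inj (G H : oagType) (g : G -> H) :
  {mono g : x y / x <= y} -> injective g.
Proof. by move=> gle x y e; apply: le_anti; rewrite -!gle e lexx. Qed.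

Section HomTheory.
Variables (N N' : valuedDiffField) (f : {rmorphism N -> N'})
  (g : vf_G N -> vf_G N').
Hypothesis h : vdf_hom f g.

Lemma vh0 : g 0 = 0. Proof. exact: morphD0 (vhD h). Qed.

Lemma vh_lt : {mono g : x y / x < y}.
Proof. by move=> x y; rewrite !oag_ltNge (vh_le h). Qed.

Lemma vh_ole a b : ole (omap g a) (omap g b) = ole a b.
Proof. by case: a b => [x|] [y|] //=; rewrite (vh_le h). Qed.

Lemma vh_olt a b : olt (omap g a) (omap g b) = olt a b.
Proof. by rewrite !oltNge vh_ole. Qed.

Lemma vh_ole0 a : ole (Some 0) (omap g a) = ole (Some 0) a.
Proof. by rewrite -[RHS]vh_ole /= vh0. Qed.

Lemma vh_olt0 a : olt (Some 0) (omap g a) = olt (Some 0) a.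
Proof. by rewrite -[RHS]vh_olt /= vh0. Qed.

Lemma vh_O x : vf_in_O (f x) = vf_in_O x.
Proof. by rewrite /vf_in_O (vh_v h) vh_ole0. Qed.

Lemma vh_sV x : f (vdf_sV x) = vdf_sV (f x).
Proof. by rewrite -[in RHS](vdf_sVK x) (vh_s h) vdf_sK. Qed.

Lemma vh_sG x : g (vdf_sG x) = vdf_sG (g x).
Proof.
have [y vy] := vf_v_surj (Some x); have := vh_s h y.
by move/(congr1 (@vf_v _)); rewrite (vh_v h) !vdf_v_s (vh_v h) vy /= => -[].
Qed.

Lemma vh_sGV x : g (vdf_sGV x) = vdf_sGV (g x).
Proof. by rewrite -[in RHS](vdf_sGVK x) vh_sG vdf_sGK. Qed.

Lemma res_sub (V : valuedField) (x y : V) : vf_in_O x -> vf_in_O y ->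
  vf_res x = vf_res y <-> olt (Some 0) (vf_v (x - y)).
Proof.
move=> Ox Oy; have Oxy := vf_OB Ox Oy.
have e : vf_res x = vf_res (x - y) + vf_res y by rewrite -vf_resD ?subrK.
rewrite -(vf_res_ker Oxy) e; split=> [h0|->]; last by rewrite add0r.
by apply: (addIr (vf_res y)); rewrite h0 add0r.
Qed.

Lemma vh_res : exists r : {rmorphism vf_k N -> vf_k N'},
  forall x, r (vf_res x) = vf_res (f x).
Proof.
have surj (c : vf_k N) : exists x, vf_in_O x /\ vf_res x = c.
  by have [x Ox <-] := vf_res_surj c; exists x.
case/boolp.choice: surj => l lP.
pose r c := vf_res (f (l c)).
have rE x : r (vf_res x) = vf_res (f x).
  have [Ox|nOx] := boolP (vf_in_O x); last first.
    rewrite (vf_res_out nOx) vf_res_out ?vh_O //.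
    have O0 : vf_in_O (0 : N) by rewrite /vf_in_O vf_v0.
    have := lP 0; set y := l 0 => -[Oy] /(vf_res_ker Oy) hy.
    by apply/vf_res_ker; rewrite ?vh_O // (vh_v h) vh_olt0.
  have [Oy /res_sub hy] := lP (vf_res x).
  by apply/res_sub; rewrite ?vh_O // -rmorphB (vh_v h) vh_olt0 hy.
have r1 : r 1 = 1 by rewrite -(vf_res1 N) rE rmorph1 vf_res1.
have [||//|R RE] := @rmorphismP _ _ r; last by exists R => x; rewrite RE.
- move=> c d; have [x Ox <-] := vf_res_surj c; have [y Oy <-] := vf_res_surj d.
  by rewrite -vf_resD // !rE rmorphD vf_resD ?vh_O.
- move=> c d; have [x Ox <-] := vf_res_surj c; have [y Oy <-] := vf_res_surj d.
  by rewrite -vf_resM // !rE rmorphM vf_resM ?vh_O.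
Qed.

Lemma vh_embedding : exists F : embedding (vdf_str N) (vdf_str N'),
  [/\ forall x : N, F VF x = f x, forall a : option (vf_G N), F VG a = omap g a &
      forall x : N, F RF (vf_res x) = vf_res (f x)].
Proof.
have [r rE] := vh_res.
pose F t : vdf_car N t -> vdf_car N' t :=
  match t return vdf_car N t -> vdf_car N' t with
  | VF => f | VG => omap g | RF => r end.
have F_inj t : injective (@F t).
  case: t => /=; [exact: fmorph_inj | | exact: fmorph_inj].
  by move=> [x|] [y|] //= [/(mono_oag_inj (vh_le h)) ->].
have rs c : r (vdf_sk c) = vdf_sk (r c).
  by have [x _ <-] := vf_res_surj c; rewrite -vdf_res_s !rE (vh_s h) vdf_res_s.
have rsV c : r (vdf_skV c) = vdf_skV (r c).
  by rewrite -[in RHS](vdf_skVK c) rs vdf_skK.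
have F_fun w t (p : vdf_fsym w t) (u : hprod (vdf_car N) w) :
    @F t (vdf_ifun p u) = vdf_ifun p (hmap F u).
  case: w t / p u => /=; rewrite ?rmorph0 ?rmorph1 ?vh0 //=.
  - by move=> [x [y []]] /=; rewrite rmorphD.
  - by move=> [x []] /=; rewrite rmorphN.
  - by move=> [x [y []]] /=; rewrite rmorphM.
  - by move=> [x []] /=; rewrite fmorphV.
  - by move=> [x [y []]] /=; rewrite rmorphD.
  - by move=> [x []] /=; rewrite rmorphN.
  - by move=> [x [y []]] /=; rewrite rmorphM.
  - by move=> [x []] /=; rewrite fmorphV.
  - by move=> [[x|] [[y|] []]] //=; rewrite (vhD h).
  - by move=> [[x|] []] //=; rewrite (morphDN (vhD h)).
  - by move=> [x []] /=; rewrite (vh_v h).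
  - case=> -[x []] /=; rewrite ?(vh_s h) ?rs //.
    by case: x => [x|] //=; rewrite vh_sG.
  - case=> -[x []] /=; rewrite ?vh_sV ?rsV //.
    by case: x => [x|] //=; rewrite vh_sGV.
have F_rel w (p : vdf_rsym w) (u : hprod (vdf_car N) w) :
    vdf_irel p u <-> vdf_irel p (hmap F u).
  by case: w / p u => -[a [b []]] /=; rewrite vh_olt.
by exists (@Embedding _ L_vdf (vdf_str N) (vdf_str N') F F_inj F_fun F_rel).
Qed.
End HomTheory.

Lemma vdf_hom_comp (N N' N'' : valuedDiffField) (f : {rmorphism N -> N'})
    (f' : {rmorphism N' -> N''}) g g' :
  vdf_hom f g -> vdf_hom f' g' -> vdf_hom (f' \o f) (g' \o g).
Proof.
move=> h h'; split=> [x y|x y|x|x] /=.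
- by rewrite (vhD h) (vhD h').
- by rewrite (vh_le h') (vh_le h).
- by rewrite (vh_v h') (vh_v h); case: (vf_v x).
- by rewrite (vh_s h) (vh_s h').
Qed.

Lemma vdf_hom_id (N : valuedDiffField) : vdf_hom (idfun : {rmorphism N -> N}) id.
Proof. by split=> // x /=; case: (vf_v x). Qed.

Lemma embedding_hom (N N' : valuedDiffField) (F : embedding (vdf_str N) (vdf_str N')) :
  exists (f : {rmorphism N -> N'}) (g : vf_G N -> vf_G N'),
  [/\ vdf_hom f g, forall x : N, F VF x = f x,
      forall a : option (vf_G N), F VG a = omap g a &
      forall x : N, F RF (vf_res x) = vf_res (f x)].
Proof.
have fD (x y : N) : F VF (x + y : N) = (F VF x : N') + F VF y.
  exact: (emap_fun F VFadd (x, (y, tt))).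
have fM (x y : N) : F VF (x * y : N) = (F VF x : N') * F VF y.
  exact: (emap_fun F VFmul (x, (y, tt))).
have f1 : F VF (1 : N) = (1 : N') by exact: (emap_fun F VFone tt).
have [f fE] := @rmorphismP N N' (F VF) fD fM f1.
have fv (x : N) : vf_v (F VF x : N') = F VG (vf_v x).
  by have := emap_fun F Val (x, tt) => /= <-.
have fr (x : N) : vf_res (F VF x : N') = F RF (vf_res x).
  by have := emap_fun F Res (x, tt) => /= <-.
have fs (x : N) : vdf_s N' (F VF x : N') = F VF (vdf_s N x).
  by have := emap_fun F (Sigma VF) (x, tt) => /= <-.
have F0 : F VG None = None :> option (vf_G N') by exact: (emap_fun F VGinfty tt).
have FS a : exists b, F VG (Some a) = Some b :> option (vf_G N').
  case E: (F VG (Some a) : option (vf_G N')) => [b|]; first by exists b.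
  by have := @emap_inj _ _ _ _ F VG (Some a) None; rewrite E F0 => /(_ erefl).
case/boolp.choice: FS => g gE.
have FG (a : option (vf_G N)) : F VG a = omap g a by case: a => [a|] /=.
exists f, g; split=> [|x|//|x]; rewrite ?fE ?fr //.
split=> [x y|x y|x|x]; rewrite ?fE.
- by have := emap_fun F VGadd (Some x, (Some y, tt)); rewrite /= !gE => -[].
- have := emap_rel F VGlt (Some y, (Some x, tt)); rewrite /= !gE /= !oag_leNgt => e.
  by congr (~~ _); apply/idP/idP => /e.
- by rewrite fv FG.
- by rewrite fs.
Qed.

Lemma ac_reduct (N N' : acValuedDiffField)
    (F : embedding (acvdf_str N) (acvdf_str N')) :
  exists F' : embedding (vdf_str N) (vdf_str N'), forall t x, F' t x = F t x.
Proof.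
have hf w t (p : vdf_fsym w t) u := emap_fun F (AcBase p) u.
by exists (@Embedding _ L_vdf (vdf_str N) (vdf_str N') F (@emap_inj _ _ _ _ F) hf
  (@emap_rel _ _ _ _ F)).
Qed.

(** * Totally ordering torsion-free quotients *)

Section Levi.
Variables (G : zmodType) (H : G -> Prop).
Hypotheses (H0 : H 0) (HD : forall x y, H x -> H y -> H (x + y))
  (HN : forall x, H x -> H (- x)).
Hypothesis tf : forall x n, H (x *+ n.+1) -> H x.

Let cone (P : set G) := [/\ forall x y, P x -> P y -> P (x + y),
  forall x, H x -> P x & forall x, P x -> P (- x) -> H x].

Lemma total_cone_exists : exists P : G -> Prop,
  [/\ forall x y, P x -> P y -> P (x + y), forall x, P x \/ P (- x) &
      forall x, P x /\ P (- x) <-> H x].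
Proof.
have cH : cone H by split.
(* the cones other than the empty chain's union; unions are taken with [H] *)
pose Z := fun P : set G => cone (P `|` H)%classic.
have Zup (F : set (set G)) : (F `<=` Z)%classic -> total_on F subset ->
    Z (\bigcup_(X in F) X)%classic.
  move=> FZ tot.
  have sub1 x : (\bigcup_(X in F) X `|` H)%classic x ->
      H x \/ exists2 X, F X & (X `|` H)%classic x.
    by move=> [[X FX Xx]|Hx]; [right; exists X => //; left | left].
  have up X x : F X -> (X `|` H)%classic x -> (\bigcup_(X in F) X `|` H)%classic x.
    by move=> FX [Xx|Hx]; [left; exists X | right].
  have join X Y x y : F X -> F Y -> (X `|` H)%classic x -> (Y `|` H)%classic y ->
      exists2 W, F W & (W `|` H)%classic x /\ (W `|` H)%classic y.
    move=> FX FY Xx Yy; case: (tot _ _ FX FY) => s.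
      by exists Y => //; split=> //; case: Xx => [/s|]; [left|right].
    by exists X => //; split=> //; case: Yy => [/s|]; [left|right].
  split.
  - move=> x y /sub1 hx /sub1 hy.
    case: hx => [Hx|[X FX Xx]]; case: hy => [Hy|[Y FY Yy]].
    + by right; apply: HD.
    + by apply: (up Y) => //; have [a _ _] := FZ _ FY; apply: a => //; right.
    + by apply: (up X) => //; have [a _ _] := FZ _ FX; apply: a => //; right.
    + have [W FW [Wx Wy]] := join _ _ _ _ FX FY Xx Yy.
      by apply: (up W) => //; have [a _ _] := FZ _ FW; apply: a.
  - by move=> x Hx; right.
  - move=> x /sub1 hx /sub1 hy.
    case: hx => [//|[X FX Xx]]; case: hy => [Hy|[Y FY Yy]].
      by rewrite -[x]opprK; apply: HN.
    have [W FW [Wx Wy]] := join _ _ _ _ FX FY Xx Yy.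
    by have [_ _ a] := FZ _ FW; apply: a.
have [A [ZA Amax]] := Zorn_bigcup Zup.
pose P := (A `|` H)%classic; have [PD PH PN] : cone P by [].
exists P; split=> // [x|x]; last first.
  by split=> [[]//|Hx]; [exact: PN | split; apply: PH => //; apply: HN].
apply: contrapT => /not_orP[nPx nPNx].
have P_nat y n : P y -> P (y *+ n).
  by move=> Py; elim: n => [|n IH]; [apply: PH | rewrite mulrS; apply: PD].
(* one of x and -x can be added to the maximal cone *)
have ext y : ~ P y -> exists m, P (- (y *+ m.+1)).
  move=> nPy; apply: contrapT => /forallNP no.
  pose Q := [set z | exists p n, P p /\ z = p + y *+ n]%classic.
  have PQ z : P z -> Q z by exists z, 0%N; rewrite mulr0n addr0.
  apply: (Amax Q).
    split; first by move=> z Az; apply: PQ; left.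
    by move=> /(_ y) QA; apply: nPy; left; apply: QA; exists 0, 1%N; rewrite add0r; split=> //; apply: PH.
  rewrite /Z; have -> : (Q `|` H)%classic = Q.
    by apply/funext => z; apply/propext; split=> [[//|Hz]|]; [apply/PQ/PH | left].
  split.
  - move=> z z' [p [n [Pp ->]]] [p' [n' [Pp' ->]]].
    by exists (p + p'), (n + n')%N; rewrite mulrnDr addrACA; split=> //; apply: PD.
  - by move=> z Hz; apply/PQ/PH.
  - move=> z [p [n [Pp zE]]] [p' [n' [Pp' zE']]].
    have e : (p + p') + y *+ (n + n') = 0.
      by rewrite mulrnDr addrACA -zE -zE' subrr.
    case E: (n + n')%N e => [|m].
      move: E zE zE' => /eqP; rewrite addn_eq0 => /andP[/eqP -> /eqP ->].
      rewrite !mulr0n !addr0 => -> Np _; apply: PN => //.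
      by rewrite Np.
    move/eqP; rewrite addr_eq0 => /eqP e; case: (no m).
    by rewrite -e; apply: PD.
have [m Pm] := ext _ nPx; have [m' Pm'] := ext _ nPNx.
apply: nPx; apply: PH; apply: (@tf x (m.+1 * m'.+1).-1); apply: PN.
  rewrite prednK // mulnC mulrnA.
  by have := P_nat _ m.+1 Pm'; rewrite !mulNrn opprK -!mulrnA mulnC.
by rewrite prednK // mulrnA; have := P_nat _ m'.+1 Pm; rewrite mulNrn.
Qed.
End Levi.

(** * Monomial valuations on twisted group rings *)

Section MonomialValuation.
Variables (R : comNzRingType) (C : zmodType) (D : oagType).
Variables (v : R -> option D) (k : C -> D).
Hypothesis sv : semival v.
Implicit Types x y : gring R C.

Definition wterm x c : option D := oadd (v (gcf c x)) (Some (k c)).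

Definition wmin x : option D := \big[@omin D/None]_(c <- gsupp x) wterm x c.

Lemma wterm_out x c : c \notin gsupp x -> wterm x c = None.
Proof. by rewrite gsuppE negbK /wterm => /eqP ->; rewrite (sv0 sv). Qed.

Lemma wmin_geP a x : ole a (wmin x) <-> forall c, ole a (wterm x c).
Proof.
rewrite /wmin; split=> [h c|h]; last first.
  by elim/big_rec: _ => [|c b _ ab]; [case: {h}a | rewrite ole_min h].
have [cx|/wterm_out ->] := boolP (c \in gsupp x); last by case: {h}a.
move: cx h; rewrite -[c \in gsupp x]/(c \in enum_fset (gsupp x)).
elim: (enum_fset _) => [|d s IH] //.
rewrite inE big_cons ole_min => /orP[/eqP <-|/IH cs] /andP[h1 h2] //.
exact: cs.
Qed.

Lemma wmin_le x c : ole (wmin x) (wterm x c).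
Proof. by move: c; apply/wmin_geP; apply: ole_refl. Qed.

Lemma wmin_at x : wmin x = None \/ exists c, wmin x = wterm x c.
Proof.
rewrite /wmin; elim: (enum_fset _) => [|d s IH]; first by rewrite big_nil; left.
rewrite big_cons.
have [->|->] := omin_cases (wterm x d) (\big[@omin D/None]_(c <- s) wterm x c).
  by right; exists d.
exact: IH.
Qed.

Lemma wmin_gtP g x : olt (Some g) (wmin x) <-> forall c, olt (Some g) (wterm x c).
Proof.
split=> [h c|h]; first exact: olt_le_trans h (wmin_le x c).
by case: (wmin_at x) => [->|[c ->]].
Qed.

Lemma wminD x y : ole (omin (wmin x) (wmin y)) (wmin (x + y)).
Proof.
apply/wmin_geP => c; rewrite /wterm gcfD !(oaddC _ (Some _)).
set m := omin _ _.
have /andP[mx my] : ole m (wmin x) && ole m (wmin y) by rewrite -ole_min ole_refl.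
have hx := ole_trans mx (wmin_le x c); have hy := ole_trans my (wmin_le y c).
move: hx hy; rewrite /wterm !(oaddC _ (Some (k c))).
have -> : m = oadd (Some (k c)) (oadd (Some (- k c)) m).
  by rewrite oaddKN.
by rewrite !ole_add2; apply: sv_geD.
Qed.

Lemma wmin0 : wmin 0 = None.
Proof.
have : ole None (wmin 0) by apply/wmin_geP => c; rewrite /wterm gcf0 (sv0 sv).
by case: (wmin 0).
Qed.

Lemma wminU c r : wmin (gU c r) = wterm (gU c r) c.
Proof.
apply: ole_anti; first exact: wmin_le.
apply/wmin_geP => d; rewrite /wterm !gcfU eqxx.
by case: eqP => [->|_]; rewrite ?ole_refl // mulr0n (sv0 sv); case: (oadd _ _).
Qed.

Section Twisted.
Variable e : C -> C -> R.
Hypothesis ve : forall c d, v (e c d) = Some (k c + k d - k (c + d)).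

Definition tmul x y : gring R C :=
  glift (fun c a => glift (fun d b => gU (c + d) (a * b * e c d)) y) x.

Let tmulD_r c a d : {morph (fun b => gU (c + d) (a * b * e c d)) : x y / x + y}.
Proof. by move=> x y; rewrite mulrDr mulrDl gUD. Qed.

Let tmulD_l y c :
  {morph (fun a => glift (fun d b => gU (c + d) (a * b * e c d)) y) : x y / x + y}.
Proof.
move=> a b; rewrite /glift -big_split; apply: eq_bigr => d _.
by rewrite !mulrDl gUD.
Qed.

Lemma tmulDl y : {morph tmul^~ y : x x' / x + x'}.
Proof. exact: gliftD (tmulD_l y). Qed.

Lemma tmulDr x : {morph tmul x : y y' / y + y'}.
Proof.
move=> y y'; rewrite /tmul /glift -big_split; apply: eq_bigr => c _.
exact: gliftD (tmulD_r _ _) y y'.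
Qed.

Lemma tmulUU c d a b : tmul (gU c a) (gU d b) = gU (c + d) (a * b * e c d).
Proof. by rewrite /tmul gliftU ?gliftU. Qed.

Lemma gcf_tmul r x y : gcf r (tmul x y) =
  \sum_(c <- gsupp x) gcf c x * gcf (r - c) y * e c (r - c).
Proof.
rewrite {1}/tmul /glift (morphD_sum (gcfD r)); apply: eq_bigr => c _.
set a := gcf c x.
apply: (gring_ext (F := fun y => gcf r (glift (fun d b => gU (c + d) (a * b * e c d)) y))
  (F' := fun y => a * gcf (r - c) y * e c (r - c))) y => [y y'|y y'|d b].
- by rewrite (gliftD (tmulD_r _ _)) gcfD.
- by rewrite gcfD mulrDr mulrDl.
rewrite (gliftU (tmulD_r _ _)) !gcfU.
have -> : (d == r - c) = (c + d == r).
  by apply/eqP/eqP => [->|<-]; rewrite ?addrA [c + _]addrC ?subrK ?addrK.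
by case: eqP => [<-|_]; rewrite ?(mulr0n, mulr0, mul0r) // [c + d]addrC addrK.
Qed.

Let vterm x y c d :
  oadd (v (gcf c x * gcf d y * e c d)) (Some (k (c + d))) =
  oadd (wterm x c) (wterm y d).
Proof.
rewrite !(svM sv) ve /wterm.
case: (v (gcf c x)) (v (gcf d y)) => [a|] [b|] //=; congr Some.
by rewrite -addrA subrK addrACA.
Qed.

Let tmul_ge x y : ole (oadd (wmin x) (wmin y)) (wmin (tmul x y)).
Proof.
apply/wmin_geP => r; rewrite /wterm gcf_tmul.
have -> : oadd (wmin x) (wmin y) =
    oadd (Some (k r)) (oadd (Some (- k r)) (oadd (wmin x) (wmin y))).
  by rewrite oaddKN.
rewrite (oaddC _ (Some (k r))) ole_add2; apply: (sv_sum_ge sv) => [|c _].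
  by case: (oadd _ _).
rewrite -(ole_add2 (k r)) oaddKN (oaddC (Some (k r))).
have -> : k r = k (c + (r - c)) by rewrite addrC subrK.
rewrite vterm.
by apply: ole_oadd; apply: wmin_le.
Qed.

Section Least.
Variable P : C -> Prop.
Hypotheses (P0 : P 0) (PD : forall c d, P c -> P d -> P (c + d)).
Hypothesis Ptot : forall c, P c \/ P (- c).

(** The exponent c is the least one, for the order with nonnegative cone P,
    at which the value g of z is attained. *)
Definition least_at z g c := wterm z c = Some g /\
  forall d, wterm z d = Some g -> P (d - c).

Lemma least_exists z g : wmin z = Some g -> exists c, least_at z g c.
Proof.
move=> zg.
have [c0 c0g] : exists c, wterm z c = Some g.
  by case: (wmin_at z); rewrite zg // => -[c ->]; exists c.
have inz c : wterm z c = Some g -> c \in enum_fset (gsupp z).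
  by move=> h; apply: contraT => /wterm_out; rewrite h.
suff [c [cg cP]] : exists c, wterm z c = Some g /\
    forall d, d \in enum_fset (gsupp z) -> wterm z d = Some g -> P (d - c).
  by exists c; split=> // d dg; apply: cP => //; apply: inz.
elim: (enum_fset _) => [|d s [c [cg cP]]]; first by exists c0.
have [dg|dg] := pselect (wterm z d = Some g); last first.
  exists c; split=> // d'; rewrite inE => /orP[/eqP -> //|]; exact: cP.
case: (Ptot (d - c)) => h.
  exists c; split=> // d'; rewrite inE => /orP[/eqP -> //|]; exact: cP.
exists d; split=> // d'; rewrite inE => /orP[/eqP -> _|d's d'g]; first by rewrite subrr.
by rewrite -(subrK c d') -addrA; apply: PD; [apply: cP | rewrite -opprB].
Qed.

(** There is no cancellation at the sum of the two least exponents. *)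
Lemma wterm_least x y g h c d :
  (forall c', wterm x c' = Some g -> P (c' - c) -> P (- (c' - c)) -> c' = c) ->
  wmin x = Some g -> wmin y = Some h -> least_at x g c -> least_at y h d ->
  wterm (tmul x y) (c + d) = Some (g + h).
Proof.
move=> Pas xg yh [cg cP] [dh dP].
rewrite /wterm gcf_tmul.
have cx : c \in gsupp x.
  by apply: contraT => /wterm_out; rewrite cg.
have cdK : c + d - c = d by rewrite addrC addKr.
rewrite (big_fsetD1 c) //= cdK.
set t1 := gcf c x * _ * _; set t2 := \sum_(_ <- _) _.
have vt1 : oadd (v t1) (Some (k (c + d))) = Some (g + h) by rewrite vterm cg dh.
rewrite (sv_eqD sv) //.
case E: (v t1) vt1 => [t|] // vt1; have tE : t + k (c + d) = g + h by case: vt1.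
rewrite /t2 big_seq_cond; apply: (sv_sum_gt sv) => // c'.
rewrite in_fsetD1 andbT => /andP[c'c _].
have -> : t = - k (c + d) + (g + h) by rewrite -tE addrC addrK.
rewrite -(olt_add2 (k (c + d))) -[Some (- _ + _)]/(oadd (Some (- _)) (Some (g + h))).
rewrite oaddKN (oaddC (Some _)); set d' := c + d - c'.
have -> : k (c + d) = k (c' + d') by rewrite /d' [c' + _]addrC subrK.
rewrite vterm.
have := wmin_le x c'; have := wmin_le y d'; rewrite xg yh.
case E1: (wterm x c') => [g'|] //; case E2: (wterm y d') => [h'|] //= hh' gg'.
rewrite -[X in is_true X]/(olt (Some (g + h)) (Some (g' + h'))) /=.
case: (eqVneq g g') => [gE|gn]; last first.
  by apply: oag_ltleD => //; rewrite lt_neqAle gn.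
case: (eqVneq h h') => [hE|hn]; last first.
  by apply: oag_leltD => //; rewrite lt_neqAle hn.
have p1 : P (c' - c) by apply: cP; rewrite E1 gE.
have p2 : P (- (c' - c)).
  have := dP d'; rewrite E2 hE /d' => /(_ erefl).
  by rewrite addrAC addrK opprB.
by case/eqP: c'c; apply: Pas => //; rewrite E1 gE.
Qed.
End Least.

(** The least terms of two elements multiply to the least term of the product,
    for a suitable total order of the group. *)
Variable S : C -> Prop.
Hypothesis Stf : forall c n, S c -> c *+ n.+1 = 0 -> c = 0.
Hypothesis Sval : forall x y c d g, wterm x c = Some g -> wterm y d = Some g -> S (c - d).

Lemma wmin_tmul x y : wmin (tmul x y) = oadd (wmin x) (wmin y).
Proof.
pose H c := exists n, c *+ n.+1 = 0 :> C.
have [||||P [PD Ptot PH]] := @total_cone_exists C H.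
- by exists 0%N; rewrite mul0rn.
- move=> c d [n cn] [m dm]; exists (n.+1 * m.+1).-1; rewrite prednK // mulrnDl.
  by rewrite mulrnA cn mul0rn add0r mulnC mulrnA dm mul0rn.
- by move=> c [n cn]; exists n; rewrite mulNrn cn oppr0.
- move=> c n [m h]; exists (n.+1 * m.+1).-1; rewrite prednK // mulrnA.
  exact: h.
have P0 : P 0 by have [_ /(_ (ex_intro _ 0%N (mul0rn _ _)))[]] := PH 0.
have ge := tmul_ge x y.
case xg: (wmin x) ge => [g|] ge; last by case: (wmin (tmul x y)) ge.
case yh: (wmin y) ge => [h|] ge; last by case: (wmin (tmul x y)) ge.
have [c cl] := least_exists P0 PD Ptot xg; have [d dl] := least_exists P0 PD Ptot yh.
apply: ole_anti => //; apply: ole_trans (wmin_le _ (c + d)) _.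
rewrite (wterm_least _ xg yh cl dl) ?ole_refl // => c' c'g p1 p2.
have [n nE] : H (c' - c) by apply/PH.
apply/eqP; rewrite -subr_eq0; apply/eqP.
by apply: (Stf _ nE); apply: (Sval c'g cl.1).
Qed.
End Twisted.

Lemma mul_tmul x y : x * y = tmul (fun _ _ => 1) x y.
Proof.
apply: gringP => r; rewrite [LHS]gcfMl [RHS](gcf_tmul (fun _ _ => 1)).
by apply: eq_bigr => c _; rewrite mulr1.
Qed.

Hypothesis kD : {morph k : c d / c + d}.
Hypothesis tf : forall (c : C) n, c *+ n.+1 = 0 -> c = 0.

Lemma one_val c d : v 1 = Some (k c + k d - k (c + d)).
Proof. by rewrite (sv1 sv) kD subrr. Qed.

Lemma wmin_semival : semival wmin.
Proof.
split=> [||x y|x y].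
- exact: wmin0.
- by rewrite g1E wminU /wterm gcfUU (sv1 sv) (morphD0 kD) /= addr0.
- apply: etrans (congr1 wmin (mul_tmul x y)) _.
  exact: (wmin_tmul one_val (S := fun=> True) (fun c n _ => @tf c n) (fun _ _ _ _ _ _ _ => I)).
- exact: wminD.
Qed.
End MonomialValuation.

Lemma vdf_sV_rmorphism (N : valuedDiffField) :
  exists s' : {rmorphism N -> N}, s' =1 @vdf_sV N.
Proof.
have inj := can_inj (vdf_sK (v := N)).
apply: rmorphismP => [x y|x y|]; apply: inj.
- by rewrite rmorphD !vdf_sVK.
- by rewrite rmorphM !vdf_sVK.
- by rewrite vdf_sVK rmorph1.
Qed.

(** The automorphism of a group ring induced by automorphisms of the
    coefficients and of the group. *)
Lemma gring_aut (R : comNzRingType) (G : zmodType) (t t' : {rmorphism R -> R})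
    (h h' : G -> G) :
  {morph h : x y / x + y} -> cancel t t' -> cancel t' t -> cancel h h' -> cancel h' h ->
  exists s s' : {rmorphism gring R G -> gring R G},
    [/\ cancel s s', cancel s' s & forall q a, s (gU q a) = gU (h q) (t a)].
Proof.
move=> hD tK t'K hK h'K.
have h'D : {morph h' : x y / x + y}.
  by move=> x y; apply: (can_inj hK); rewrite hD !h'K.
have [s sE] := rmorphismP (gmapD t h) (gmapM t hD) (gmap1 t hD).
have [s' s'E] := rmorphismP (gmapD t' h') (gmapM t' h'D) (gmap1 t' h'D).
exists s, s'; split=> [f|f|q a]; last by rewrite sE gmapU.
- apply: (gring_ext (F := s' \o s) (F' := id)) f => [x y|//|q a] /=.
    by rewrite !rmorphD.
  by rewrite sE gmapU s'E gmapU hK tK.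
- apply: (gring_ext (F := s \o s') (F' := id)) f => [x y|//|q a] /=.
    by rewrite !rmorphD.
  by rewrite s'E gmapU sE gmapU h'K t'K.
Qed.

(** The coefficient embedding. *)
Lemma gring_const (R : comNzRingType) (G : zmodType) :
  exists c : {rmorphism R -> gring R G}, forall a, c a = gU 0 a.
Proof.
apply: rmorphismP => [x y|x y|]; first exact: gUD.
  by rewrite gUM addr0.
by [].
Qed.

Lemma wmin_map (R : comNzRingType) (C : zmodType) (D : oagType)
    (v : R -> option D) (k : C -> D) (sD : D -> D) (sC sC' : C -> C)
    (th : gring R C -> gring R C) (x : gring R C) :
  {mono sD : x y / x <= y} -> cancel sC' sC ->
  semival v ->
  (forall c, wterm v k (th x) (sC c) = omap sD (wterm v k x c)) ->
  wmin v k (th x) = omap sD (wmin v k x).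
Proof.
move=> sDle sCK sv E.
have sole a b : ole (omap sD a) (omap sD b) = ole a b.
  by case: a b => [a|] [b|] //=; apply: sDle.
apply: ole_anti.
  have [->|[c ->]] := wmin_at v k x; first by case: (wmin _ _ _).
  by rewrite -E wmin_le.
by apply/(wmin_geP _ sv) => c; rewrite -[c]sCK E sole wmin_le.
Qed.

(** * Adjoining a cross-section generically *)

Section SectionExtension.
Variables (N : valuedDiffField) (G : oagType) (i : vf_G N -> G).
Variables (P : G -> Prop) (s0 : G -> N) (sG sG' : G -> G).
Hypotheses (iD : {morph i : x y / x + y}) (ile : {mono i : x y / x <= y}).
Hypotheses (P0 : P 0) (PD : forall x y, P x -> P y -> P (x + y))
  (PN : forall x, P x -> P (- x)).
Hypotheses (s0D : forall x y, P x -> P y -> s0 (x + y) = s0 x * s0 y)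
  (v_s0 : forall x, P x -> omap i (vf_v (s0 x)) = Some x).
Hypotheses (sGD : {morph sG : x y / x + y}) (sGle : {mono sG : x y / x <= y})
  (sGK : cancel sG sG') (sG'K : cancel sG' sG)
  (i_s : forall g, i (vdf_sG g) = sG (i g))
  (P_s : forall x, P (sG x) <-> P x)
  (s0_s : forall x, P x -> s0 (sG x) = vdf_s N (s0 x)).
Hypothesis tf : forall g n, P (i g *+ n.+1) -> P (i g).

Lemma section_extension : exists (N' : sValuedDiffField)
    (f : {rmorphism N -> N'}) (p : G -> vf_G N'),
  [/\ {morph p : x y / x + y}, {mono p : x y / x <= y}, vdf_hom f (p \o i) &
      forall h, P h -> svdf_cs (p h) = f (s0 h)].
Proof.
have PB x y : P x -> P y -> P (x - y) by move=> Px Py; apply: PD => //; apply: PN.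
have [C [pi [piD pi_surj piP]]] := @quotient_group_exists G P PB P0.
case/boolp.choice: pi_surj => sec secK.
have pi0 := morphD0 piD; have piN := morphDN piD; have piB := morphDB piD.
have Psub x y : pi x = pi y -> P (x - y) by move=> e; apply/piP; rewrite piB e subrr.
have Psec q : P (q - sec (pi q)) by apply: Psub; rewrite secK.
pose vv (a : N) := omap i (vf_v a).
have i0 := morphD0 iD.
have svv : semival vv.
  split; rewrite /vv ?vf_v0 ?vf_v1 //= ?i0 //.
  - by move=> x y; rewrite vf_vM; case: (vf_v x) (vf_v y) => [a|] [b|] //=; rewrite iD.
  - move=> x y; have := vf_vD x y.
    case: (vf_v x) (vf_v y) (vf_v (x + y)) => [a|] [b|] [c|] //=;
      rewrite /omin /= ?ile //; by case: ifP; rewrite /= ?ile.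
pose eps c d := s0 (sec c + sec d - sec (c + d)).
have Peps c d : P (sec c + sec d - sec (c + d)) by apply: Psub; rewrite piD !secK.
have v_eps c d : vv (eps c d) = Some (sec c + sec d - sec (c + d)) by apply: v_s0.
pose zeta q := s0 (q - sec (pi q)).
pose F := glift (fun q a => gU (pi q) (a * zeta q)) : gring N G -> gring N C.
have FDa q : {morph (fun a => gU (pi q) (a * zeta q)) : x y / x + y}.
  by move=> x y; rewrite mulrDl gUD.
have FD : {morph F : x y / x + y} by apply: gliftD.
have FU q a : F (gU q a) = gU (pi q) (a * zeta q) by apply: gliftU.
have FM x y : F (x * y) = tmul eps (F x) (F y).
  apply: (gring_ext (F := fun x => F (x * y)) (F' := fun x => tmul eps (F x) (F y))) x
      => [x x'|x x'|q a].
  - by rewrite mulrDl FD.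
  - by rewrite FD tmulDl.
  apply: (gring_ext (F := fun y => F (gU q a * y))
      (F' := fun y => tmul eps (F (gU q a)) (F y))) y => [x x'|x x'|r b].
  - by rewrite mulrDr FD.
  - by rewrite FD tmulDr.
  rewrite gUM !FU tmulUU -piD; congr (gU _ _).
  have -> : zeta (q + r) = zeta q * zeta r * eps (pi q) (pi r).
    rewrite /zeta /eps -!s0D //; last exact: PD.
    congr s0; rewrite -piD; set u := sec (pi (q + r)).
    by rewrite (addrACA q) -opprD addrA subrK.
  by rewrite !mulrA; congr (_ * _ * _); rewrite -!mulrA; congr (_ * _); rewrite mulrC.
pose S c := exists g, c = pi (i g).
have Stf c n : S c -> c *+ n.+1 = 0 -> c = 0.
  move=> [g ->] e; apply/piP/(@tf g n)/piP.
  by rewrite -[RHS]e (morphDMn piD).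
have Sval x y c d g : wterm vv sec x c = Some g -> wterm vv sec y d = Some g -> S (c - d).
  rewrite /wterm /vv; case: (vf_v _) => [a|] //= [ag]; case: (vf_v _) => [b|] //= [bg].
  exists (b - a); rewrite (morphDB iD) -[c]secK -[d]secK -piB; congr pi.
  by apply/eqP; rewrite subr_eq addrAC eq_sym subr_eq bg -ag addrC.
pose w x := wmin vv sec (F x).
have svw : semival w.
  split.
  - by rewrite /w (morphD0 FD) wmin0.
  - rewrite /w g1E FU wminU // /wterm gcfUU mul1r /zeta /vv v_s0 //=.
    by rewrite pi0 sub0r addNr.
  - by move=> x y; rewrite /w FM (wmin_tmul svv v_eps Stf Sval).
  - by move=> x y; rewrite /w FD wminD.
have [sV sVE] := vdf_sV_rmorphism N.
have sVK : cancel (vdf_s N) sV by move=> x; rewrite sVE vdf_sK.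
have sV'K : cancel sV (vdf_s N) by move=> x; rewrite sVE vdf_sVK.
have [s [s' [sK s'K sU]]] := gring_aut sGD sVK sV'K sGK sG'K.
have P_s' x : P (sG' x) <-> P x by rewrite -P_s sG'K.
have sG'D : {morph sG' : x y / x + y}.
  by move=> x y; apply: (can_inj sGK); rewrite sGD !sG'K.
pose sC c := pi (sG (sec c)); pose sC' c := pi (sG' (sec c)).
have sCpi q : sC (pi q) = pi (sG q).
  apply/eqP; rewrite -subr_eq0 -piB; apply/eqP/piP; rewrite -(morphDB sGD); apply/P_s.
  by apply: Psub; rewrite secK.
have sC'pi q : sC' (pi q) = pi (sG' q).
  apply/eqP; rewrite -subr_eq0 -piB; apply/eqP/piP; rewrite -(morphDB sG'D); apply/P_s'.
  by apply: Psub; rewrite secK.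
have sC'K : cancel sC' sC by move=> c; rewrite /sC' sCpi sG'K secK.
have sCK : cancel sC sC' by move=> c; rewrite /sC sC'pi sGK secK.
pose eta c := s0 (sG (sec c) - sec (sC c)).
have Peta c : P (sG (sec c) - sec (sC c)) by apply: Psub; rewrite secK.
pose th := glift (fun c a => gU (sC c) (vdf_s N a * eta c)) : gring N C -> gring N C.
have thDa q : {morph (fun a => gU (sC q) (vdf_s N a * eta q)) : x y / x + y}.
  by move=> x y; rewrite rmorphD mulrDl gUD.
have thD : {morph th : x y / x + y} by apply: gliftD.
have thU q a : th (gU q a) = gU (sC q) (vdf_s N a * eta q) by apply: gliftU.
have Fs x : F (s x) = th (F x).
  apply: (gring_ext (F := F \o s) (F' := th \o F)) x => [x y|x y|q a] /=.
  - by rewrite rmorphD FD.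
  - by rewrite FD thD.
  rewrite sU !FU thU -sCpi; congr (gU _ _); rewrite rmorphM -mulrA; congr (_ * _).
  rewrite /zeta /eta -s0_s // -s0D //; last by apply/P_s.
  by congr s0; rewrite (morphDB sGD) -sCpi addrA subrK.
have th_cf c x : gcf (sC c) (th x) = vdf_s N (gcf c x) * eta c.
  apply: (gring_ext (F := fun x => gcf (sC c) (th x))
    (F' := fun x => vdf_s N (gcf c x) * eta c)) x => [x y|x y|d a].
  - by rewrite thD gcfD.
  - by rewrite gcfD rmorphD mulrDl.
  rewrite thU !gcfU (inj_eq (can_inj sCK)).
  by case: eqP => [->|_] //; rewrite !mulr0n rmorph0 mul0r.
have ws x : w (s x) = omap sG (w x).
  rewrite /w Fs; apply: (wmin_map (sC := sC) (sC' := sC')) => // c.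
  rewrite /wterm th_cf (svM svv) [vv (eta c)]v_s0 // /vv vdf_v_s.
  case: (vf_v (gcf c _)) => [a|] //=; congr Some.
  by rewrite i_s -addrA subrK -sGD.
have [N0 [j [iN [iND iNle vj js]]]] :=
  valued_diff_field_exists svw sK s'K sGle (morphD0 sGD) ws.
have iN_inj := mono_oag_inj iNle.
have wT q : w (gU q 1) = Some q.
  by rewrite /w FU wminU // /wterm gcfUU mul1r /zeta /vv v_s0 //= subrK.
have wc a : w (gU 0 a) = vv a.
  rewrite /w FU wminU // /wterm gcfUU (svM svv) /zeta [vv (s0 _)]v_s0 //.
  by case: (vv a) => [b|] //=; rewrite -addrA subrK addr0.
have vT q : exists g, iN g = q /\ vf_v (j (gU q 1)) = Some g.
  by have := vj (gU q 1); rewrite wT; case: (vf_v _) => [g|] //= [->]; exists g.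
pose cs g := j (gU (iN g) 1).
have csD g h : cs (g + h) = cs g * cs h.
  by rewrite /cs iND -rmorphM gUM mulr1.
have v_cs g : vf_v (cs g) = Some g.
  by have [h [/iN_inj <- ->]] := vT (iN g).
have iN_s g : iN (vdf_sG g) = sG (iN g).
  have := ws (gU (iN g) 1); rewrite !vj js vdf_v_s.
  by rewrite -/(cs g) v_cs /= => -[].
have cs_s g : cs (vdf_sG g) = vdf_s N0 (cs g).
  by rewrite /cs iN_s -js sU rmorph1.
pose N' := @SValuedDiffField N0 cs csD v_cs cs_s.
have [c cE] := gring_const N G.
have /boolp.choice[p pK] : forall q, exists g, iN g = q.
  by move=> q; have [g [gq _]] := vT q; exists g.
have pD : {morph p : x y / x + y} by move=> x y; apply: iN_inj; rewrite iND !pK.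
have ple : {mono p : x y / x <= y} by move=> x y; rewrite -iNle !pK.
exists N', (j \o c), p; split => //; last first.
  move=> h Ph; apply/eqP; rewrite -subr_eq0; apply/eqP/vf_vinf.
  rewrite /= /cs pK cE -rmorphB.
  have : w (gU h 1 - gU 0 (s0 h)) = None.
    rewrite /w (morphDB FD) !FU mul1r; have -> : pi h = pi 0 by rewrite pi0; apply/piP.
    have Ps0 : P (- sec 0) by have := Psec 0; rewrite pi0 sub0r.
    have -> : zeta h = s0 h * zeta 0.
      by rewrite /zeta (_ : pi h = 0) ?pi0 ?sub0r -?s0D //; apply/piP.
    by rewrite subrr wmin0.
  by rewrite vj; case: (vf_v _).
split=> [x y|x y|x|x] /=.
- by rewrite iD pD.
- by rewrite ple ile.
- have := vj (gU 0 x); rewrite wc /vv -cE.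
  rewrite -[X in _ -> X = _]/(vf_v (j (c x))).
  case: (vf_v x) (vf_v (j (c x))) => [a|] [b|] //= [e]; congr Some.
  by apply: iN_inj; rewrite pK.
- by rewrite -js !cE sU (morphD0 sGD).
Qed.
End SectionExtension.

(** * One-units *)

Section OneUnits.
Variable V : valuedField.
Implicit Types x y : V.
Let sv := vf_semival V.

Definition one_unit x : Prop := olt (Some 0) (vf_v (x - 1)).

Lemma ou_v x : one_unit x -> vf_v x = Some 0.
Proof.
by move=> h; rewrite -(vf_v1 V); apply: (sv_eq sv); rewrite (svBC sv) vf_v1.
Qed.

Lemma ou_neq0 x : one_unit x -> x != 0.
Proof. by move/ou_v => h; apply/eqP => x0; rewrite x0 vf_v0 in h. Qed.

Lemma ou1 : one_unit 1.
Proof. by rewrite /one_unit subrr vf_v0. Qed.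

Lemma olt_oadd0 (G : oagType) (a b : option G) :
  olt (Some 0) a -> ole (Some 0) b -> olt (Some 0) (oadd a b).
Proof.
case: a b => [a|] [b|] //= a0 b0; rewrite -[0]addr0; exact: oag_ltleD.
Qed.

Lemma ouM x y : one_unit x -> one_unit y -> one_unit (x * y).
Proof.
move=> hx hy; rewrite /one_unit.
have -> : x * y - 1 = (x - 1) * y + (y - 1) by ring.
apply: (sv_gtD sv) => //; rewrite vf_vM olt_oadd0 // (ou_v hy).
exact: ole_refl.
Qed.

Lemma ouV x : one_unit x -> one_unit x^-1.
Proof.
move=> hx; rewrite /one_unit.
have -> : x^-1 - 1 = - (x - 1) * x^-1 by field; apply: ou_neq0.
rewrite vf_vM (svN sv) olt_oadd0 // (vf_vV (ou_v hx)) oppr0; exact: ole_refl.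
Qed.

Lemma ou_res x : one_unit x -> vf_res x = 1.
Proof.
move=> hx; rewrite -(vf_res1 V); apply/res_sub => //; apply: vf_O_unit.
  exact: ou_v.
exact: vf_v1.
Qed.

Lemma res_ou x : vf_v x = Some 0 -> vf_res x = 1 -> one_unit x.
Proof.
move=> vx; rewrite -(vf_res1 V) => /res_sub; apply; apply: vf_O_unit => //.
exact: vf_v1.
Qed.

Lemma ou_div x y : y != 0 -> olt (vf_v y) (vf_v (x - y)) -> one_unit (x / y).
Proof.
move=> y0; have [g vy] := vf_neq0P y0; rewrite vy => h.
rewrite /one_unit; have -> : x / y - 1 = (x - y) / y by field.
rewrite vf_vM (vf_vV vy) -(olt_add2 g) (oaddC (vf_v _)) oaddKN /= addr0.
exact: h.
Qed.
End OneUnits.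

Lemma vh_ou (N N' : valuedDiffField) (f : {rmorphism N -> N'}) g :
  vdf_hom f g -> forall x, one_unit (f x) <-> one_unit x.
Proof.
move=> h x; rewrite /one_unit.
by rewrite -(rmorph1 f) -rmorphB (vh_v h) (vh_olt0 h).
Qed.

Lemma s_ou (N : valuedDiffField) (x : N) : one_unit x -> one_unit (vdf_s N x).
Proof.
move=> hx; apply: res_ou.
  rewrite vdf_v_s (ou_v hx) /=; congr Some; exact: morphD0 (@vdf_sGD N).
by rewrite vdf_res_s (ou_res hx) vdf_sk1.
Qed.

Lemma vdf_skD0 (N : valuedDiffField) : exists s : {rmorphism vf_k N -> vf_k N},
  s =1 @vdf_sk N.
Proof.
apply: rmorphismP; [exact: vdf_skD | exact: vdf_skM | exact: vdf_sk1].
Qed.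

Lemma gcfM_sub (R : comNzRingType) (G : zmodType) (d : {fset G}) (f g : gring R G) r :
  {subset gsupp f <= d} ->
  gcf r (f * g) = \sum_(q <- d) gcf q f * gcf (r - q) g.
Proof.
move=> sub; rewrite gcfMl; apply: big_fset_incl; first exact/fsubsetP.
by move=> q _; rewrite gsuppE negbK => /eqP ->; rewrite mul0r.
Qed.

Lemma gcf_gmap (R S : comNzRingType) (G H : zmodType) (t : {rmorphism R -> S})
    (h : G -> H) : injective h -> forall q f, gcf (h q) (gmap t h f) = t (gcf q f).
Proof.
move=> hi q f.
apply: (gring_ext (F := fun f => gcf (h q) (gmap t h f)) (F' := fun f => t (gcf q f))) f
    => [x y|x y|r a].
- by rewrite gmapD gcfD.
- by rewrite gcfD rmorphD.
- by rewrite gmapU !gcfU (inj_eq hi) rmorphMn.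
Qed.

(** * Composing the Gauss valuation with a place of the residue ring *)

Section Composite.
Variables (N : valuedDiffField) (Q C : zmodType) (D : oagType).
Variables (P : Q -> Prop) (sQ sQ' : Q -> Q) (s0 z : Q -> N).
Variables (pi : Q -> C) (sC sC' : C -> C).
Variables (u : gring (vf_k N) C -> option D) (sD : D -> D).
Variable tk : {rmorphism vf_k N -> vf_k N}.
Hypothesis tkE : tk =1 @vdf_sk N.
Hypotheses (P0 : P 0) (PD : forall x y, P x -> P y -> P (x + y))
  (PN : forall x, P x -> P (- x)) (P_s : forall x, P x -> P (sQ x)).
Hypotheses (sQD : {morph sQ : x y / x + y}) (sQK : cancel sQ sQ') (sQ'K : cancel sQ' sQ).
Hypotheses (piD : {morph pi : x y / x + y}) (pi_surj : forall c, exists q, pi q = c)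
  (piP : forall q, pi q = 0 <-> P q)
  (sCpi : forall q, sC (pi q) = pi (sQ q)) (sCK : cancel sC sC') (sC'K : cancel sC' sC).
Hypotheses (s0D : forall x y, P x -> P y -> s0 (x + y) = s0 x * s0 y)
  (s0_s : forall x, P x -> s0 (sQ x) = vdf_s N (s0 x))
  (z_neq0 : forall q, z q != 0)
  (zD : forall q r, one_unit (z (q + r) / (z q * z r)))
  (z_s : forall q, one_unit (z (sQ q) / vdf_s N (z q)))
  (s0z : forall h, P h -> one_unit (s0 h / z h)).
Hypotheses (svu : semival u) (u0 : forall x, u x = None -> x = 0)
  (uc : forall a, a != 0 -> u (gU 0 a) = Some 0)
  (uT : forall c, u (gU c 1) = Some 0)
  (uT1 : forall c, olt (Some 0) (u (gU c 1 - 1)))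
  (us : forall x, u (gmap tk sC x) = omap sD (u x))
  (sDD : {morph sD : x y / x + y}) (sDle : {mono sD : x y / x <= y}).

Let sv := vf_semival N.
Let k0 : C -> vf_G N := fun=> 0.
Local Notation wm := (wmin (@vf_v N) k0).

Let gra (a : N) (x : gring N C) : gring (vf_k N) C :=
  \sum_(c <- gsupp x) gU c (vf_res (gcf c x / a)).

Let res0 : vf_res (0 : N) = 0.
Proof. by apply/vf_res_ker; rewrite /vf_in_O vf_v0. Qed.

Let gcf_gra a x c : gcf c (gra a x) = vf_res (gcf c x / a).
Proof.
rewrite /gra (morphD_sum (gcfD c)).
have [cx|cx] := boolP (c \in gsupp x).
  rewrite (big_fsetD1 c) //= gcfUU big1_fset ?addr0 // => d.
  by rewrite in_fsetD1 gcfU => /andP[/negbTE -> _] _.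
move: (cx); rewrite gsuppE negbK => /eqP ->; rewrite mul0r res0.
apply: big1_fset => d dx _; rewrite gcfU; case: eqP => // dc.
by rewrite dc (negbTE cx) in dx.
Qed.

Let wtermE x c : wterm (@vf_v N) k0 x c = vf_v (gcf c x).
Proof. by rewrite /wterm oaddC oadd0. Qed.

Let wm_ge a x : ole a (wm x) <-> forall c, ole a (vf_v (gcf c x)).
Proof.
rewrite (wmin_geP _ sv); split=> h c; have := h c; by rewrite wtermE.
Qed.

Let div_O (a : N) g (x : N) : vf_v a = Some g -> vf_in_O (x / a) = ole (Some g) (vf_v x).
Proof.
move=> va; rewrite /vf_in_O vf_vM (vf_vV va) -(ole_add2 g) (oaddC (vf_v _)).
by rewrite oaddKN /= addr0.
Qed.

Let div_m (a : N) g (x : N) : vf_v a = Some g ->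
  olt (Some 0) (vf_v (x / a)) = olt (Some g) (vf_v x).
Proof.
move=> va; rewrite vf_vM (vf_vV va) -(olt_add2 g) (oaddC (vf_v _)).
by rewrite oaddKN /= addr0.
Qed.

Let gra_eq0 (a : N) g x : vf_v a = Some g -> ole (Some g) (wm x) ->
  gra a x = 0 <-> olt (Some g) (wm x).
Proof.
move=> va /wm_ge gx; rewrite (wmin_gtP _ sv); split=> [h c|h].
  rewrite wtermE -(div_m _ va); apply/vf_res_ker; first by rewrite (div_O _ va).
  by rewrite -gcf_gra h gcf0.
apply: gringP => c; rewrite gcf_gra gcf0; apply/vf_res_ker; first by rewrite (div_O _ va).
by rewrite (div_m _ va) -wtermE.
Qed.

Let graD (a : N) g x y : vf_v a = Some g -> ole (Some g) (wm x) -> ole (Some g) (wm y) ->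
  gra a (x + y) = gra a x + gra a y.
Proof.
move=> va /wm_ge gx /wm_ge gy; apply: gringP => c.
by rewrite gcfD !gcf_gra gcfD mulrDl vf_resD // (div_O _ va).
Qed.

Let gra_scale (a b : N) g x : vf_v a = Some g -> vf_v b = Some g -> ole (Some g) (wm x) ->
  u (gra a x) = u (gra b x).
Proof.
move=> va vb /wm_ge gx.
have a0 : a != 0 by apply/eqP => e; rewrite e vf_v0 in va.
have b0 : b != 0 by apply/eqP => e; rewrite e vf_v0 in vb.
have vba : vf_v (b / a) = Some 0 by rewrite vf_vM vb (vf_vV va) /= subrr.
have -> : gra a x = gU 0 (vf_res (b / a)) * gra b x.
  apply: gringP => c; rewrite gcfUM subr0 !gcf_gra -vf_resM ?(div_O _ vb) //.
    by congr vf_res; field; rewrite a0 b0.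
  exact: vf_O_unit.
by rewrite (svM svu) uc ?oadd0 // vf_res_unit.
Qed.

Let lift (g : vf_G N) : N := projT1 (cid (vf_v_surj (Some g))).
Let liftE g : vf_v (lift g) = Some g.
Proof. by rewrite /lift; case: cid. Qed.

Variables (L : oagType) (pr : vf_G N -> D -> L) (p1 : L -> vf_G N) (p2 : L -> D).
Hypotheses (p1K : forall g d, p1 (pr g d) = g) (p2K : forall g d, p2 (pr g d) = d)
  (prK : forall l, pr (p1 l) (p2 l) = l)
  (prD : forall g d g' d', pr g d + pr g' d' = pr (g + g') (d + d'))
  (ple : forall g d g' d',
     (pr g d <= pr g' d') = (g < g') || ((g == g') && (d <= d'))).

Let plt g d g' d' : (pr g d < pr g' d') = (g < g') || ((g == g') && (d < d')).
Proof.
rewrite oag_ltNge ple negb_or negb_and oag_ltNge -!oag_ltNge -oag_leNgt.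
rewrite le_eqVlt (eq_sym g'); have [->|gg] := eqVneq g g'; first by rewrite ltxx.
by rewrite /= andbT orbF.
Qed.

Definition comp_val (x : gring N C) : option L :=
  if wm x is Some g then omap (pr g) (u (gra (lift g) x)) else None.
Local Notation W := comp_val.

Let W_ge (a : N) g d x : vf_v a = Some g ->
  ole (Some (pr g d)) (W x) <->
  ole (Some g) (wm x) /\ ole (Some d) (u (gra a x)).
Proof.
move=> va; rewrite /W; case E: (wm x) => [h|]; last first.
  split=> // _; split=> //.
  have -> : gra a x = 0 by apply/(gra_eq0 va); rewrite E.
  by rewrite (sv0 svu).
have gr0 : gra (lift h) x <> 0.
  by move/(gra_eq0 (liftE h)); rewrite E /= lexx ltxx => /(_ isT).
case F: (u (gra (lift h) x)) => [d'|]; last by case: gr0; apply: u0.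
rewrite /= ple le_eqVlt; have [gh|gh] := eqVneq g h.
  rewrite gh ltxx /= (@gra_scale a (lift h) h) ?E ?F ?ole_refl //; last by rewrite va gh.
  by rewrite lexx -le_eqVlt; split=> // -[].
rewrite /= orbF; split=> [gh'|[gh' _]]; last by rewrite lt_neqAle gh.
split; first exact: ltW.
have -> : gra a x = 0 by apply/(gra_eq0 va); rewrite E //= ltW.
by rewrite (sv0 svu).
Qed.

Let W_gt (a : N) g d x : vf_v a = Some g -> ole (Some g) (wm x) ->
  olt (Some d) (u (gra a x)) -> olt (Some (pr g d)) (W x).
Proof.
move=> va gx; rewrite /W; case E: (wm x) => [h|] //.
have gr0 : gra (lift h) x <> 0.
  by move/(gra_eq0 (liftE h)); rewrite E /= lexx ltxx => /(_ isT).
case F: (u (gra (lift h) x)) => [d'|]; last by case: gr0; apply: u0.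
move: gx; rewrite E /= plt le_eqVlt; have [gh|gh] := eqVneq g h => //= gh'.
  by rewrite gh ltxx /= (@gra_scale a (lift h) h) ?F ?E //= ?lexx // va gh.
by rewrite gh'.
Qed.

Let W_E (a : N) g x : vf_v a = Some g -> ole (Some g) (wm x) -> gra a x != 0 ->
  W x = omap (pr g) (u (gra a x)).
Proof.
move=> va gx /eqP g0; have : ~~ olt (Some g) (wm x).
  by apply/negP => /(gra_eq0 va gx).
rewrite oltNge negbK => /(ole_anti gx) E.
by rewrite /W -E (@gra_scale a (lift g) g) // -E ole_refl.
Qed.

Let W_None x : W x = None -> x = 0.
Proof.
rewrite /W; case E: (wm x) => [h|].
  have gr0 : gra (lift h) x <> 0.
    by move/(gra_eq0 (liftE h)); rewrite E /= lexx ltxx => /(_ isT).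
  by case F: (u _) => [//|] _; case: gr0; apply: u0.
move=> _; apply: gringP => c; rewrite gcf0; apply/vf_vinf.
have /wm_ge/(_ c) : ole None (wm x) by rewrite E.
by case: (vf_v _).
Qed.

Let W0 : W 0 = None.
Proof. by rewrite /W wmin0. Qed.

Let W_D x y : ole (omin (W x) (W y)) (W (x + y)).
Proof.
case E: (omin _ _) => [l|]; last first.
  have [/W_None -> /W_None ->] : W x = None /\ W y = None.
    by move: E; rewrite /omin; case: ifP; case: (W x) (W y) => [a|] [b|].
  by rewrite addr0 W0.
have : ole (Some l) (omin (W x) (W y)) by rewrite E ole_refl.
rewrite ole_min -(prK l) => /andP[/(W_ge _ _ (liftE _))[gx dx] /(W_ge _ _ (liftE _))[gy dy]].
apply/(W_ge _ _ (liftE _)); split; last by rewrite (graD (liftE _)) ?(sv_geD svu).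
apply/wm_ge => c; rewrite gcfD; apply: (sv_geD sv); first exact: (wm_ge _ _).1.
exact: (wm_ge _ _).1.
Qed.

Let W_semi_sum (I : Type) (r : seq I) (E : I -> N) :
  (forall i, vf_in_O (E i)) ->
  vf_in_O (\sum_(i <- r) E i) /\
  vf_res (\sum_(i <- r) E i) = \sum_(i <- r) vf_res (E i).
Proof.
move=> EO; elim: r => [|i r [IO IR]].
  by rewrite !big_nil res0 /vf_in_O vf_v0.
by rewrite !big_cons vf_resD // IR; split=> //; apply: (sv_geD sv); [exact: EO | ].
Qed.

Variable sec : C -> Q.
Hypothesis secK : forall c, pi (sec c) = c.

Let piB x y : pi (x - y) = pi x - pi y. Proof. exact: morphDB. Qed.
Let Psub x y : pi x = pi y -> P (x - y).
Proof. by move=> e; apply/piP; rewrite piB e subrr. Qed.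
Let Psec q : P (q - sec (pi q)). Proof. by apply: Psub; rewrite secK. Qed.

Let s0_neq0 h : P h -> s0 h != 0.
Proof. by move/s0z/ou_neq0; rewrite mulf_eq0 negb_or => /andP[]. Qed.

Let zeta q := s0 (q - sec (pi q)) * z (sec (pi q)).

Let zeta_neq0 q : zeta q != 0.
Proof. by rewrite mulf_neq0 // s0_neq0. Qed.

Let zeta_ou q : one_unit (zeta q / z q).
Proof.
have := ouM (s0z (Psec q)) (ouV (zD (q - sec (pi q)) (sec (pi q)))).
rewrite subrK; congr one_unit; rewrite /zeta; field.
by rewrite !z_neq0.
Qed.

Let zetaP h q : P h -> zeta (h + q) = s0 h * zeta q.
Proof.
move=> Ph; rewrite /zeta piD (piP h).2 // add0r -addrA.
by rewrite (s0D Ph (Psec q)) mulrA.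
Qed.

Let eps c d := zeta (sec c + sec d) / (zeta (sec c) * zeta (sec d)).

Let zeta_add q r : zeta (q + r) = zeta q * zeta r * eps (pi q) (pi r).
Proof.
have h1 := Psec q; have h2 := Psec r; rewrite /eps.
set c := pi q in h1 *; set d := pi r in h2 *.
have -> : q + r = (q - sec c + (r - sec d)) + (sec c + sec d).
  by rewrite addrACA !subrK.
rewrite (zetaP _ (PD h1 h2)) (s0D h1 h2).
have -> : zeta q = s0 (q - sec c) * zeta (sec c) by rewrite -zetaP // subrK.
have -> : zeta r = s0 (r - sec d) * zeta (sec d) by rewrite -zetaP // subrK.
by field; rewrite !zeta_neq0.
Qed.

Let eps_ou c d : one_unit (eps c d).
Proof.
have := ouM (ouM (zeta_ou (sec c + sec d)) (zD (sec c) (sec d)))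
  (ouV (ouM (zeta_ou (sec c)) (zeta_ou (sec d)))).
congr one_unit; rewrite /eps; field.
by rewrite !zeta_neq0 !z_neq0.
Qed.

Let F := glift (fun q a => gU (pi q) (a * zeta q)) : gring N Q -> gring N C.

Let FDa q : {morph (fun a => gU (pi q) (a * zeta q)) : x y / x + y}.
Proof. by move=> x y; rewrite mulrDl gUD. Qed.

Let FD : {morph F : x y / x + y}. Proof. exact: gliftD. Qed.
Let FU q a : F (gU q a) = gU (pi q) (a * zeta q). Proof. exact: gliftU. Qed.

Let FM x y : F (x * y) = tmul eps (F x) (F y).
Proof.
apply: (gring_ext (F := fun x => F (x * y)) (F' := fun x => tmul eps (F x) (F y))) x
    => [x x'|x x'|q a].
- by rewrite mulrDl FD.
- by rewrite FD tmulDl.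
apply: (gring_ext (F := fun y => F (gU q a * y))
    (F' := fun y => tmul eps (F (gU q a)) (F y))) y => [x x'|x x'|r b].
- by rewrite mulrDr FD.
- by rewrite FD tmulDr.
rewrite gUM !FU tmulUU -piD zeta_add; congr (gU _ _); ring.
Qed.

Let gra_mul (a b : N) g h x y : vf_v a = Some g -> vf_v b = Some h ->
  ole (Some g) (wm x) -> ole (Some h) (wm y) ->
  ole (Some (g + h)) (wm (tmul eps x y)) /\
  gra (a * b) (tmul eps x y) = gra a x * gra b y.
Proof.
move=> va vb /wm_ge gx /wm_ge hy.
have a0 : a != 0 by apply/eqP => e; rewrite e vf_v0 in va.
have b0 : b != 0 by apply/eqP => e; rewrite e vf_v0 in vb.
have vab : vf_v (a * b) = Some (g + h) by rewrite vf_vM va vb.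
pose t r c := gcf c x / a * (gcf (r - c) y / b) * eps c (r - c).
have tE r : gcf r (tmul eps x y) / (a * b) = \sum_(c <- gsupp x) t r c.
  rewrite gcf_tmul mulr_suml; apply: eq_bigr => c _; rewrite /t; field.
  by rewrite a0 b0.
have xO c : vf_in_O (gcf c x / a) by rewrite (div_O _ va).
have yO c : vf_in_O (gcf c y / b) by rewrite (div_O _ vb).
have eO c d : vf_in_O (eps c d) by apply/vf_O_unit/ou_v/eps_ou.
have OM (p q : N) : vf_in_O p -> vf_in_O q -> vf_in_O (p * q).
  by move=> hp hq; rewrite /vf_in_O vf_vM -[Some 0]oadd0 ole_oadd.
have tO r c : vf_in_O (t r c).
  by apply: (OM); [apply: (OM); [exact: xO | exact: yO] | exact: eO].
split.
  by apply/wm_ge => r; rewrite -(div_O _ vab) tE (W_semi_sum _ (tO r)).1.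
apply: gringP => r; rewrite gcf_gra tE (W_semi_sum _ (tO r)).2.
rewrite (@gcfM_sub _ _ (gsupp x)); last first.
  move=> c; rewrite !gsuppE gcf_gra; apply: contra_neq => ->.
  by rewrite mul0r res0.
apply: eq_bigr => c _; rewrite !gcf_gra /t.
rewrite (vf_resM (OM _ _ (xO c) (yO (r - c))) (eO c (r - c))) (vf_resM (xO c) (yO (r - c))).
by rewrite (ou_res (eps_ou _ _)) mulr1.
Qed.

Let tmul0 x : tmul eps 0 x = 0.
Proof. exact: (morphD0 (tmulDl eps x)). Qed.
Let tmulx0 x : tmul eps x 0 = 0.
Proof. exact: (morphD0 (tmulDr eps x)). Qed.

Let W_M x y : W (tmul eps x y) = oadd (W x) (W y).
Proof.
case Ex: (W x) => [l|]; last by rewrite (W_None Ex) tmul0 W0.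
case Ey: (W y) => [l'|]; last by rewrite (W_None Ey) tmulx0 W0.
move: Ex Ey; rewrite {1 2}/W.
case Ex: (wm x) => [g|] //; case Ey: (wm y) => [h|] //.
case Eu: (u _) => [d|] //= [<-]; case Eu': (u _) => [d'|] //= [<-].
have [||ge E] := gra_mul (liftE g) (liftE h) (x := x) (y := y); rewrite ?Ex ?Ey ?ole_refl //.
rewrite (@W_E (lift g * lift h) (g + h)) // ?vf_vM ?liftE // E.
  by rewrite (svM svu) Eu Eu' /= prD.
by apply/eqP => /(congr1 u); rewrite (svM svu) Eu Eu' (sv0 svu).
Qed.

Let zeta0_ou : one_unit (zeta 0).
Proof.
have e : one_unit (z 0).
  have := ouV (zD 0 0); rewrite add0r; congr one_unit; field.
  by rewrite z_neq0 oner_neq0.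
by have := ouM (zeta_ou 0) e; congr one_unit; field; rewrite ?z_neq0.
Qed.

Let W1 a g : vf_v a = Some g -> W (F (gU 0 a)) = Some (pr g 0).
Proof.
move=> va; have z0 := zeta0_ou.
have a0 : a != 0 by apply/eqP => e; rewrite e vf_v0 in va.
have E : gra a (F (gU 0 a)) = gU (pi 0) 1.
  apply: gringP => c; rewrite gcf_gra FU !gcfU; case: eqP => _; last by rewrite !mulr0n mul0r res0.
  by rewrite !mulr1n mulrC mulKf // (ou_res z0).
rewrite (@W_E a g) ?E ?uT //=.
  apply/wm_ge => c; rewrite FU gcfU; case: eqP => _; last by rewrite mulr0n vf_v0.
  by rewrite mulr1n vf_vM va (ou_v z0) /= addr0 lexx.
by apply/eqP => /(congr1 u); rewrite uT (sv0 svu).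
Qed.

Let semival_WF : semival (W \o F).
Proof.
split=> [||x y|x y] /=.
- by rewrite (morphD0 FD) W0.
- have := W1 (vf_v1 N); rewrite -g1E => ->; congr Some.
  by have := prD 0 0 0 0; rewrite !addr0 => /eqP; rewrite -subr_eq0 addrK => /eqP.
- by rewrite FM W_M.
- by rewrite FD W_D.
Qed.

Let eta c := zeta (sQ (sec c)) / vdf_s N (zeta (sec c)).

Let s_neq0 x : x != 0 -> vdf_s N x != 0.
Proof. by rewrite fmorph_eq0. Qed.

Let zeta_s q : zeta (sQ q) = vdf_s N (zeta q) * eta (pi q).
Proof.
have h := Psec q; rewrite /eta; set c := pi q in h *.
have -> : zeta q = s0 (q - sec c) * zeta (sec c) by rewrite -zetaP // subrK.
rewrite -{1}(subrK (sec c) q) sQD (zetaP _ (P_s h)) s0_s // rmorphM.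
by field; rewrite s_neq0.
Qed.

Let eta_ou c : one_unit (eta c).
Proof.
have := ouM (ouM (zeta_ou (sQ (sec c))) (z_s (sec c))) (ouV (s_ou (zeta_ou (sec c)))).
congr one_unit; rewrite /eta fmorph_div; field.
by rewrite !s_neq0 ?z_neq0.
Qed.

Let th := glift (fun c a => gU (sC c) (vdf_s N a * eta c)) : gring N C -> gring N C.

Let thDa q : {morph (fun a => gU (sC q) (vdf_s N a * eta q)) : x y / x + y}.
Proof. by move=> x y; rewrite rmorphD mulrDl gUD. Qed.

Let thD : {morph th : x y / x + y}. Proof. exact: gliftD. Qed.
Let thU q a : th (gU q a) = gU (sC q) (vdf_s N a * eta q). Proof. exact: gliftU. Qed.

Let th_cf c x : gcf (sC c) (th x) = vdf_s N (gcf c x) * eta c.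
Proof.
apply: (gring_ext (F := fun x => gcf (sC c) (th x))
  (F' := fun x => vdf_s N (gcf c x) * eta c)) x => [x y|x y|d a].
- by rewrite thD gcfD.
- by rewrite gcfD rmorphD mulrDl.
rewrite thU !gcfU (inj_eq (can_inj sCK)).
by case: eqP => [->|_] //; rewrite !mulr0n rmorph0 mul0r.
Qed.

Let gra_th (a : N) g x : vf_v a = Some g -> ole (Some g) (wm x) ->
  ole (Some (vdf_sG g)) (wm (th x)) /\
  gra (vdf_s N a) (th x) = gmap tk sC (gra a x).
Proof.
move=> va /wm_ge gx.
have vsa : vf_v (vdf_s N a) = Some (vdf_sG g) by rewrite vdf_v_s va.
have xO c : vf_in_O (gcf c x / a) by rewrite (div_O _ va).
have E c : gcf (sC c) (th x) / vdf_s N a = vdf_s N (gcf c x / a) * eta c.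
  by rewrite th_cf fmorph_div mulrAC.
have eO c : vf_in_O (eta c) by apply/vf_O_unit/ou_v/eta_ou.
have sO c : vf_in_O (vdf_s N (gcf c x / a)) by rewrite vdf_s_O.
split.
  apply/wm_ge => c; rewrite -[c]sC'K -(div_O _ vsa) E /vf_in_O vf_vM.
  by rewrite -[Some 0]oadd0; apply: ole_oadd; [apply: sO | apply: eO].
apply: gringP => c; rewrite -[c]sC'K gcf_gra E (gcf_gmap _ (can_inj sCK)) gcf_gra.
by rewrite (vf_resM (sO _) (eO _)) (ou_res (eta_ou _)) mulr1 vdf_res_s tkE.
Qed.

Let sL l := pr (vdf_sG (p1 l)) (sD (p2 l)).

Let W_th x : W (th x) = omap sL (W x).
Proof.
case Ex: (W x) => [l|]; last by rewrite (W_None Ex) (morphD0 thD) W0.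
move: Ex; rewrite {1}/W; case Ex: (wm x) => [g|] //.
case Eu: (u _) => [d|] //= [<-].
have [|ge E] := gra_th (liftE g) (x := x); rewrite ?Ex ?ole_refl //.
rewrite (@W_E (vdf_s N (lift g)) (vdf_sG g)) // ?vdf_v_s ?liftE // E.
  by rewrite us Eu /= /sL p1K p2K.
by apply/eqP => /(congr1 u); rewrite us Eu (sv0 svu).
Qed.

Let sLle : {mono sL : x y / x <= y}.
Proof.
move=> x y; rewrite -[x]prK -[y]prK /sL !p1K !p2K !ple.
by rewrite sDle !lt_neqAle vdf_sG_le (inj_eq (can_inj (@vdf_sGK N))).
Qed.

Let pr0 : pr 0 0 = 0.
Proof. by apply: (addrI (pr 0 0)); rewrite prD !addr0. Qed.

Lemma composite_extension_aux : exists (N' : valuedDiffField) (f : {rmorphism N -> N'})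
    (g : vf_G N -> vf_G N') (s1 : Q -> N'),
  [/\ vdf_hom f g, forall h, P h -> s1 h = f (s0 h),
      forall q r, s1 (q + r) = s1 q * s1 r,
      forall q, s1 (sQ q) = vdf_s N' (s1 q) &
      forall q, one_unit (s1 q / f (z q))] /\
  forall c n, (exists d, c *+ n.+1 = g d) -> exists d, c = g d.
Proof.
have [sV sVE] := vdf_sV_rmorphism N.
have sVK : cancel (vdf_s N) sV by move=> x; rewrite sVE vdf_sK.
have sV'K : cancel sV (vdf_s N) by move=> x; rewrite sVE vdf_sVK.
have [s [s' [sK s'K sU]]] := gring_aut sQD sVK sV'K sQK sQ'K.
have Fs x : F (s x) = th (F x).
  apply: (gring_ext (F := F \o s) (F' := th \o F)) x => [x y|x y|q a] /=.
  - by rewrite rmorphD FD.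
  - by rewrite FD thD.
  rewrite sU !FU thU -sCpi; congr (gU _ _); rewrite rmorphM -mulrA; congr (_ * _).
  exact: zeta_s.
have sL0 : sL 0 = 0.
  have -> : sL 0 = sL (pr 0 0) by rewrite pr0.
  by rewrite /sL p1K p2K (morphD0 sDD) (morphD0 (@vdf_sGD N)) pr0.
have ws x : (W \o F) (s x) = omap sL ((W \o F) x) by rewrite /= Fs W_th.
have [N0 [j [iN [iND iNle vj js]]]] :=
  valued_diff_field_exists semival_WF sK s'K sLle sL0 ws.
have iN_inj := mono_oag_inj iNle.
have [c cE] := gring_const N Q.
have /boolp.choice[g gE] : forall a, exists b, iN b = pr a 0.
  move=> a; have := vj (gU 0 (lift a)); rewrite /= (W1 (liftE a)).
  by case: (vf_v _) => [b|] //= [->]; exists b.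
have hom : vdf_hom (j \o c) g.
  split=> [x y|x y|x|x] /=.
  - by apply: iN_inj; rewrite iND !gE prD addr0.
  - by rewrite -iNle !gE ple lexx andbT orbC -le_eqVlt.
  - have [->|x0] := eqVneq x 0; first by rewrite !rmorph0 !vf_v0.
    have [a va] := vf_neq0P x0; rewrite va /=.
    have := vj (gU 0 x); rewrite /= (W1 va) -cE.
    by case: (vf_v _) => [b|] //= [e]; congr Some; apply: iN_inj; rewrite gE.
  - by rewrite -js !cE sU (morphD0 sQD).
have j0 x : F x = 0 -> j x = 0.
  move=> Fx; apply/vf_vinf; have := vj x; rewrite /= Fx W0.
  by case: (vf_v _).
exists N0, (j \o c), g, (fun q => j (gU q 1)); split; first split => //.
- move=> h Ph; apply/eqP; rewrite -subr_eq0 /= cE -rmorphB; apply/eqP/j0.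
  rewrite (morphDB FD) !FU mul1r -{1}[h]addr0 -{2}[h]addr0 zetaP // piD.
  by rewrite (piP h).2 // add0r subrr.
- by move=> q r; rewrite -rmorphM gUM mulr1.
- by move=> q; rewrite -js sU rmorph1.
- move=> q /=; have [a va] := vf_neq0P (z_neq0 q).
  apply: ou_div; first by rewrite (fmorph_eq0 (j \o c)) z_neq0.
  have [b [bE vb]] : exists b, iN b = pr a 0 /\ vf_v (j (c (z q))) = Some b.
    have := vj (gU 0 (z q)); rewrite /= (W1 va) -cE.
    by case: (vf_v _) => [b|] //= [e]; exists b.
  rewrite vb -rmorphB.
  set x := F (gU q 1 - c (z q)).
  have xE : x = gU (pi q) (zeta q) - gU 0 (z q * zeta 0).
    by rewrite /x cE (morphDB FD) !FU mul1r (morphD0 piD).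
  have x_cf d : gcf d x / z q = (zeta q / z q) *+ (pi q == d) - zeta 0 *+ (0 == d).
    rewrite xE gcfB !gcfU mulrBl mulrnAl mulrnAl; congr (_ - _ *+ _).
    by rewrite mulrC mulKf.
  have bO (y : N) (t : bool) : one_unit y -> vf_in_O (y *+ t) /\ vf_res (y *+ t) = t%:R.
    case: t => hy; last by rewrite mulr0n /vf_in_O vf_v0 res0.
    by rewrite (ou_res hy); split=> //; apply/vf_O_unit/ou_v.
  have resN (y : N) : vf_in_O y -> vf_res (- y) = - vf_res y.
    move=> yO; have NyO : vf_in_O (- y) by rewrite /vf_in_O (svN sv).
    by apply: (addrI (vf_res y)); rewrite -vf_resD // !subrr res0.
  have E : gra (z q) x = gU (pi q) 1 - 1.
    apply: gringP => d; rewrite gcf_gra x_cf gcfB g1E !gcfU.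
    have [O1 r1] := bO _ (pi q == d) (zeta_ou q); have [O2 r2] := bO _ (0 == d) zeta0_ou.
    rewrite vf_resD ?resN ?r1 ?r2 //.
    by rewrite /vf_in_O (svN sv); apply: O2.
  have ge : ole (Some a) (wm x).
    apply/wm_ge => d; rewrite -(div_O _ va) x_cf; apply: (sv_geB sv).
      exact: (bO _ _ (zeta_ou q)).1.
    exact: (bO _ _ zeta0_ou).1.
  have := @W_gt (z q) a 0 x va ge; rewrite E => /(_ (uT1 _)).
  rewrite -bE -/((W \o F) _) vj.
  by case: (vf_v _) => [b'|] //=; rewrite !oag_ltNge iNle.
- move=> e n [d dE].
  have e2 : p2 (iN e) *+ n.+1 = 0.
    have p2D x y : p2 (x + y) = p2 x + p2 y.
      by rewrite -{1}[x]prK -{1}[y]prK prD p2K.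
    rewrite -(morphDMn p2D) -(morphDMn iND) dE gE p2K //.
  exists (p1 (iN e)); apply: iN_inj; rewrite gE.
  by rewrite -(oag_mulrn_eq0 e2) prK.
Qed.
End Composite.

(** A sigma-invariant valuation of the group ring k[C], trivial on k, whose
    centre is the augmentation: every group element reduces to 1. *)
Record place (k : fieldType) (C : zmodType) (t : {rmorphism k -> k}) (sC : C -> C)
    (D : oagType) (u : gring k C -> option D) (sD : D -> D) : Prop := {
  pl_sv : semival u;
  pl0 : forall x, u x = None -> x = 0;
  plc : forall a, a != 0 -> u (gU 0 a) = Some 0;
  plT : forall c, u (gU c 1) = Some 0;
  plT1 : forall c, olt (Some 0) (u (gU c 1 - 1));
  pls : forall x, u (gmap t sC x) = omap sD (u x);
  plD : {morph sD : x y / x + y};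
  ple : {mono sD : x y / x <= y}
}.

Definition has_place (k : fieldType) (C : zmodType) (t : {rmorphism k -> k})
    (sC : C -> C) : Prop :=
  exists (D : oagType) (u : gring k C -> option D) (sD : D -> D), place t sC u sD.

Lemma composite_extension (N : valuedDiffField) (Q C : zmodType)
    (P : Q -> Prop) (sQ sQ' : Q -> Q) (s0 z : Q -> N)
    (pi : Q -> C) (sC sC' : C -> C) (t : {rmorphism vf_k N -> vf_k N}) :
  t =1 @vdf_sk N -> has_place t sC ->
  (forall x y, P x -> P y -> P (x + y)) -> (forall x, P x -> P (sQ x)) ->
  {morph sQ : x y / x + y} -> cancel sQ sQ' -> cancel sQ' sQ ->
  {morph pi : x y / x + y} -> (forall c, exists q, pi q = c) ->
  (forall q, pi q = 0 <-> P q) -> (forall q, sC (pi q) = pi (sQ q)) ->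
  cancel sC sC' -> cancel sC' sC ->
  (forall x y, P x -> P y -> s0 (x + y) = s0 x * s0 y) ->
  (forall x, P x -> s0 (sQ x) = vdf_s N (s0 x)) ->
  (forall q, z q != 0) -> (forall q r, one_unit (z (q + r) / (z q * z r))) ->
  (forall q, one_unit (z (sQ q) / vdf_s N (z q))) ->
  (forall h, P h -> one_unit (s0 h / z h)) ->
  exists (N' : valuedDiffField) (f : {rmorphism N -> N'})
    (g : vf_G N -> vf_G N') (s1 : Q -> N'),
  [/\ vdf_hom f g, forall h, P h -> s1 h = f (s0 h),
      forall q r, s1 (q + r) = s1 q * s1 r,
      forall q, s1 (sQ q) = vdf_s N' (s1 q) &
      forall q, one_unit (s1 q / f (z q))] /\
  forall c n, (exists d, c *+ n.+1 = g d) -> exists d, c = g d.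
Proof.
move=> tE [D [u [sD pl]]] PD Ps sQD sQK sQ'K piD /boolp.choice[sec secK] piP sCpi sCK sC'K.
move=> s0D s0_s z0 zD z_s s0z.
have [L [pr [p1 [p2 [p1K p2K prK prD ple']]]]] := lex_oag_exists (vf_G N) D.
exact: (@composite_extension_aux N Q C D P sQ sQ' s0 z pi sC sC' u sD t tE PD Ps sQD sQK sQ'K
  piD piP sCpi sCK sC'K s0D s0_s z0 zD z_s s0z (pl_sv pl) (pl0 pl) (plc pl) (plT pl) (plT1 pl)
  (pls pl) (plD pl) (ple pl) L pr p1 p2 p1K p2K prK prD ple' sec secK).
Qed.

(** * The place in residue characteristic 0 *)

Section AdditiveCharacters.
Variables (k : fieldType) (C : zmodType).
Hypothesis k0 : forall n, (n.+1)%:R != 0 :> k.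
Hypothesis tf : forall (c : C) n, c *+ n.+1 = 0 -> c = 0.

Let k0z (n : int) : n != 0 -> n%:~R != 0 :> k.
Proof.
case: n => [[|n]|n] // _; first exact: k0.
by rewrite NegzE rmorphN oppr_eq0; exact: k0.
Qed.

Let tfz (c : C) (n : int) : n != 0 -> c *~ n = 0 -> c = 0.
Proof.
case: n => [[|n]|n] // _; first exact: tf.
by move/eqP; rewrite NegzE mulrNz oppr_eq0 => /eqP; exact: tf.
Qed.

(** An additive map on a cyclic subgroup extends to the whole group, as the
    target is divisible. *)
Lemma char_exists (c : C) : c != 0 ->
  exists chi : C -> k, {morph chi : x y / x + y} /\ chi c != 0.
Proof.
move=> c0.
pose L : set (C * k) := [set a | exists n : int, a = (c *~ n, n%:~R)]%classic.
pose good (A : set (C * k)) := [/\ forall a b, A a -> A b -> A (a.1 - b.1, a.2 - b.2),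
  (L `<=` A)%classic & forall y, A (0, y) -> y = 0].
pose Z A := good (A `|` L)%classic.
have gL : good L.
  split=> // [a b [n ->] [m ->]|y [n [/esym e ->]]].
    by exists (n - m); rewrite mulrzBr rmorphB.
  have [->|n0] := eqVneq n 0; first by rewrite mulr0z.
  by rewrite (tfz n0 e) eqxx in c0.
have Zup (F : set (set (C * k))) : (F `<=` Z)%classic -> total_on F subset ->
    Z (\bigcup_(X in F) X)%classic.
  move=> FZ tot.
  have sub1 x : (\bigcup_(X in F) X `|` L)%classic x ->
      L x \/ exists2 X, F X & (X `|` L)%classic x.
    by move=> [[X FX Xx]|Hx]; [right; exists X => //; left | left].
  have up X x : F X -> (X `|` L)%classic x -> (\bigcup_(X in F) X `|` L)%classic x.
    by move=> FX [Xx|Hx]; [left; exists X | right].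
  split.
  - move=> a b /sub1 ha /sub1 hb.
    case: ha => [La|[X FX Xa]]; case: hb => [Lb|[Y FY Yb]].
    + by right; have [h _ _] := gL; apply: h.
    + by apply: (up Y) => //; have [h _ _] := FZ _ FY; apply: h => //; right.
    + by apply: (up X) => //; have [h _ _] := FZ _ FX; apply: h => //; right.
    + case: (tot _ _ FX FY) => s.
        apply: (up Y) => //; have [h _ _] := FZ _ FY; apply: h => //.
        by case: Xa => [/s|]; [left|right].
      apply: (up X) => //; have [h _ _] := FZ _ FX; apply: h => //.
      by case: Yb => [/s|]; [left|right].
  - by move=> a La; right.
  - move=> y /sub1 [Ly|[X FX Xy]]; first by have [_ _ h] := gL; apply: h.
    by have [_ _ h] := FZ _ FX; apply: h.
have [A' [ZA Amax]] := Zorn_bigcup Zup.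
pose A := (A' `|` L)%classic; have [AB LA A0] : good A by [].
have A00 : A (0, 0) by apply: LA; exists 0; rewrite !mulr0z.
have AN a : A a -> A (- a.1, - a.2).
  by move=> Aa; have := AB _ _ A00 Aa; rewrite /= !sub0r.
have AD a b : A a -> A b -> A (a.1 + b.1, a.2 + b.2).
  by move=> Aa Ab; have := AB _ _ Aa (AN _ Ab); rewrite /= !opprK.
have An a n : A a -> A (a.1 *+ n, a.2 *+ n).
  by move=> Aa; elim: n => [|n IH]; rewrite ?mulr0n // !mulrS; apply: (AD _ _ Aa IH).
have Az a (n : int) : A a -> A (a.1 *~ n, a.2 *~ n).
  move=> Aa; case: n => n; first exact: An.
  by rewrite NegzE !mulrNz; apply: AN (An _ n.+1 Aa).
have dom x : exists y, A (x, y).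
  apply: contrapT => nox.
  have [y0 y0P] : exists y0, forall (n : int) y, A (x *~ n, y) -> y = y0 *~ n.
    have [[n [y [n0 Any]]]|no] := pselect (exists (n : int) y, n != 0 /\ A (x *~ n, y)).
      exists (y / n%:~R) => m y' Amy'.
      have := AB _ _ (Az _ m Any) (Az _ n Amy'); rewrite /= -!mulrzA mulrC subrr.
      move/A0/eqP; rewrite subr_eq0 => /eqP e.
      apply: (mulIf (k0z n0)); rewrite -[in RHS]mulrzr mulrAC divfK ?k0z //.
      by rewrite !mulrzr.
    exists 0 => n y Any; rewrite mul0rz; have [n0|n0] := eqVneq n 0.
      by apply: A0; rewrite -(mulr0z x) -n0.
    by case: no; exists n, y.
  pose B : set (C * k) := [set b | exists a (n : int), A a /\ b = (a.1 + x *~ n, a.2 + y0 *~ n)]%classic.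
  have AsubB a : A a -> B a.
    by case: a => a1 a2 Aa; exists (a1, a2), 0; rewrite !mulr0z !addr0.
  apply: (Amax B).
    split; first by move=> a A'a; apply: AsubB; left.
    move=> /(_ (x, y0)) BA; apply: nox; exists y0; left; apply: BA.
    by exists (0, 0), 1; rewrite !add0r.
  rewrite /Z; have -> : (B `|` L)%classic = B.
    apply/funext => z; apply/propext; split=> [[//|Lz]|]; last by left.
    exact/AsubB/LA.
  split=> [_ _ [a [n [Aa ->]]] [b [m [Ab ->]]]|z Lz|y [a [n [Aa [e ->]]]]].
  - exists (a.1 - b.1, a.2 - b.2), (n - m); split; first exact: AB.
    by rewrite /= !mulrzBr !opprD; congr pair; rewrite addrACA.
  - exact/AsubB/LA.
  - have := AN _ Aa; have -> : - a.1 = x *~ n.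
      by apply/eqP; rewrite eq_sym -addr_eq0 addrC -e.
    by move/y0P/eqP; rewrite eqr_oppLR => /eqP ->; rewrite addNr.
case/boolp.choice: dom => chi chiP.
have uniq x y : A (x, y) -> y = chi x.
  move=> Axy; have := AB _ _ Axy (chiP x); rewrite /= subrr => /A0/eqP.
  by rewrite subr_eq0 => /eqP.
exists chi; split=> [x y|]; first by apply/esym/uniq; apply: (AD (x, chi x) (y, chi y)).
suff <- : 1%:~R = chi c by rewrite k0z.
by apply: uniq; apply: LA; exists 1.
Qed.

Lemma poly_nat_nonroot (p : {poly k}) : p != 0 -> exists n : nat, p.[n%:R] != 0.
Proof.
move=> p0; apply: contrapT => /forallNP h.
have inj : injective (fun n : nat => n%:R : k).
  move=> n m; wlog: n m / (n <= m)%N.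
    move=> W; case: (leqP n m) => [/W //|/ltnW /W e /esym /e]; exact: esym.
  move=> nm /esym/eqP; rewrite -subr_eq0 -natrB //.
  case E: (m - n)%N => [|d]; last by rewrite (negbTE (k0 d)).
  by move=> _; apply/eqP; rewrite eqn_leq nm -subn_eq0 E.
have := @max_poly_roots _ p [seq n%:R | n <- iota 0 (size p)] p0.
rewrite size_map size_iota map_inj_uniq ?iota_uniq // ltnn => /(_ _ isT) F.
suff: false by []. apply: F; apply/allP => _ /mapP[n _ ->].
by rewrite /root; apply: contraT => /h.
Qed.

Let isadd (chi : C -> k) := {morph chi : x y / x + y}.

Lemma char_line (chi1 chi2 : C -> k) (t : k) : isadd chi1 -> isadd chi2 ->
  isadd (fun c => (1 - t) * chi1 c + t * chi2 c).
Proof. by move=> h1 h2 x y; rewrite h1 h2 !mulrDr addrACA. Qed.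

Lemma char_separate (s : seq C) : (forall c, c \in s -> c != 0) ->
  exists chi, isadd chi /\ forall c, c \in s -> chi c != 0.
Proof.
elim: s => [|c s IH] h.
  by exists (fun=> 0); split=> // x y; rewrite addr0.
have [|chi1 [chi1D chi1s]] := IH; first by move=> d ds; apply: h; rewrite inE ds orbT.
have [chi2 [chi2D chi2c]] := char_exists (h _ (mem_head c s)).
pose P d := (chi1 d)%:P * (1 - 'X) + (chi2 d)%:P * 'X.
have PE d t : (P d).[t] = (1 - t) * chi1 d + t * chi2 d.
  by rewrite /P !hornerE mulrC; congr (_ + _); rewrite mulrC.
have P0 d : d \in c :: s -> P d != 0.
  rewrite inE => /orP[/eqP ->|ds]; apply/eqP => E.
    have := PE c 1; rewrite E horner0 subrr mul0r mul1r add0r => /esym/eqP.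
    by rewrite (negbTE chi2c).
  have := PE d 0; rewrite E horner0 subr0 mul0r mul1r addr0 => /esym/eqP.
  by rewrite (negbTE (chi1s _ ds)).
have [|n] := @poly_nat_nonroot (\prod_(d <- c :: s) P d).
  by rewrite prodf_seq_neq0; apply/allP => d /P0.
rewrite horner_prod prodf_seq_neq0 => /allP nz.
exists (fun d => (1 - n%:R) * chi1 d + n%:R * chi2 d); split; first exact: char_line.
by move=> d ds; rewrite -PE; apply: nz.
Qed.

Let ev n (f : gring k C) (chi : C -> k) := glift (fun c a => a * chi c ^+ n) f.

Let evDa n (chi : C -> k) (c : C) : {morph (fun a : k => a * chi c ^+ n) : x y / x + y}.
Proof. by move=> x y; rewrite mulrDl. Qed.

Let evD n chi : {morph (fun f => ev n f chi) : x y / x + y}.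
Proof. by move=> x y; apply: gliftD. Qed.

Let evU n chi c a : ev n (gU c a) chi = a * chi c ^+ n.
Proof. exact: (gliftU (evDa n chi)). Qed.

Let evM N f g chi : isadd chi ->
  ev N (f * g) chi = \sum_(i < N.+1) (ev (N - i) f chi * ev i g chi) *+ 'C(N, i).
Proof.
move=> chiD.
apply: (gring_ext (F := fun f => ev N (f * g) chi)
  (F' := fun f => \sum_(i < N.+1) (ev (N - i) f chi * ev i g chi) *+ 'C(N, i))) f
  => [x y|x y|c a].
- by rewrite mulrDl evD.
- by rewrite -big_split; apply: eq_bigr => i _; rewrite evD mulrDl mulrnDl.
apply: (gring_ext (F := fun g => ev N (gU c a * g) chi)
  (F' := fun g => \sum_(i < N.+1) (ev (N - i) (gU c a) chi * ev i g chi) *+ 'C(N, i))) g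
  => [x y|x y|d b].
- by rewrite mulrDr evD.
- by rewrite -big_split; apply: eq_bigr => i _; rewrite evD mulrDr mulrnDl.
rewrite gUM evU chiD exprDn mulr_sumr; apply: eq_bigr => i _.
by rewrite !evU mulrnAr; congr (_ *+ _); ring.
Qed.

(** Vandermonde: a nonzero element has a nonzero moment. *)
Lemma moment_neq0 f : f != 0 -> exists n chi, isadd chi /\ ev n f chi != 0.
Proof.
move=> f0; apply: contrapT => no.
pose s := [seq c - d | c <- gsupp f, d <- [seq d <- gsupp f | d != c]].
have [|chi [chiD chis]] := @char_separate s.
  by move=> _ /allpairsPdep[c [d [_ + ->]]]; rewrite mem_filter subr_eq0 eq_sym => /andP[].
have sep c d : c \in gsupp f -> d \in gsupp f -> d != c -> chi c != chi d.
  move=> cf df dc; rewrite -subr_eq0 -(morphDB chiD); apply: chis.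
  by apply/allpairsPdep; exists c, d; rewrite mem_filter dc.
have mom0 n : \sum_(c <- gsupp f) gcf c f * chi c ^+ n = 0.
  by apply: contrapT => /eqP e; apply: no; exists n, chi.
have pol0 (p : {poly k}) : \sum_(c <- gsupp f) gcf c f * p.[chi c] = 0.
  under eq_bigr do rewrite horner_coef mulr_sumr.
  rewrite exchange_big /=; apply: big1 => i _.
  by under eq_bigr do rewrite mulrCA; rewrite -mulr_sumr mom0 mulr0.
have [c cf] : exists c, c \in gsupp f.
  apply: contrapT => /forallNP h; case/eqP: f0; rewrite (gringE f) big_seq big1 // => c cf.
  by case: (h c).
have := pol0 (\prod_(d <- gsupp f | d != c) ('X - (chi d)%:P)).
rewrite [X in X = _](bigD1_seq c) ?fset_uniq // [X in _ + X = _]big_seq_cond.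
rewrite [X in _ + X = _]big1 ?addr0; last first.
  move=> d /andP[df dc]; rewrite horner_prod (big_rem d) //= dc.
  by rewrite hornerXsubC subrr mul0r mulr0.
move/eqP; rewrite mulf_eq0 -[gcf c f == 0]negbK -gsuppE cf /= horner_prod.
rewrite prodf_seq_eq0 => /hasP[d df /andP[dc]]; rewrite !hornerE subr_eq0.
by rewrite (negbTE (sep _ _ cf df dc)).
Qed.

Variables (t : {rmorphism k -> k}) (t' : {rmorphism k -> k}) (sC sC' : C -> C).
Hypotheses (tK : cancel t t') (t'K : cancel t' t).
Hypotheses (sCD : {morph sC : x y / x + y}) (sCK : cancel sC sC') (sC'K : cancel sC' sC).

Let nz f n := exists chi, isadd chi /\ ev n f chi != 0.

(** The order of vanishing at E = 0 of the series sum f_c exp(chi(c) E), for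
    a generic additive character chi. *)
Lemma char0_place_exists : has_place t sC.
Proof.
have [||||x y z|D [e [e' [eK e'K eD ele]]]] := @oag_of_rel int (fun x y => x <= y).
- exact: lexx.
- by move=> x y; apply: le_anti.
- by move=> x y z; apply: le_trans.
- exact: le_total.
- by rewrite lerD2l.
have /boolp.choice[ord ordP] : forall f : gring k C, exists o : option nat,
    if o is Some n then nz f n /\ forall m, (m < n)%N -> ~ nz f m else f = 0.
  move=> f; have [->|/moment_neq0 [n [chi h]]] := eqVneq f 0; first by exists None.
  have ex : exists n, `[< nz f n >] by exists n; apply/asboolP; exists chi.
  have [m /asboolP nm mmin] := ex_minnP ex.
  exists (Some m); split=> // m' m'm nm'; have := mmin m'; rewrite leqNgt m'm.
  by move=> h'; have /h' : `[< nz f m' >] by apply/asboolP.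
pose u f := omap (fun n : nat => e n%:Z) (ord f).
have ordE f n : nz f n -> (forall m, (m < n)%N -> ~ nz f m) -> ord f = Some n.
  move=> h1 h2; have := ordP f; case: (ord f) => [m [h3 h4]|f0].
    by congr Some; case: (ltngtP m n) => // [/h2|/h4] //.
  by case: h1 => chi [_]; rewrite f0 (morphD0 (evD n chi)) eqxx.
have ord0 : ord 0 = None.
  have := ordP 0; case: (ord 0) => // n [[chi [_]]].
  by rewrite (morphD0 (evD n chi)) eqxx.
have ordU c a : a != 0 -> ord (gU c a) = Some 0%N.
  move=> a0; apply: ordE => //; exists (fun=> 0); split=> [x y|]; first by rewrite addr0.
  by rewrite evU expr0 mulr1.
have low f n m chi : ord f = Some n -> (m < n)%N -> isadd chi -> ev m f chi = 0.
  move=> fn mn chiD; have := ordP f; rewrite fn => -[_ /(_ _ mn) h].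
  by apply: contrapT => /eqP h'; apply: h; exists chi.
have e0 : e 0 = 0 by apply: morphD0 eD.
have ordM f g : ord (f * g) =
    if ord f is Some n then if ord g is Some m then Some (n + m)%N else None else None.
  have := ordP f; case Ef: (ord f) => [n|]; last by move=> ->; rewrite mul0r ord0.
  have := ordP g; case Eg: (ord g) => [m|]; last by move=> -> _; rewrite mulr0 ord0.
  move=> [[chi2 [chi2D h2]] _] [[chi1 [chi1D h1]] _].
  apply: ordE; last first.
    move=> l lnm [chi [chiD]]; rewrite evM // big1 ?eqxx // => i _.
    case: (ltnP (l - i) n) => ln; first by rewrite (low _ _ _ _ Ef ln) // mul0r mul0rn.
    rewrite (low _ _ _ _ Eg _ chiD) ?mulr0 ?mul0rn //; move: (ltn_ord i); lia.
  pose lin (c : C) : {poly k} := (1 - 'X) * (chi1 c)%:P + 'X * (chi2 c)%:P.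
  have linE c x : (lin c).[x] = (1 - x) * chi1 c + x * chi2 c by rewrite /lin !hornerE.
  pose pol h l : {poly k} := \sum_(c <- gsupp h) (gcf c h)%:P * lin c ^+ l.
  have polE h l x : (pol h l).[x] = ev l h (fun c => (1 - x) * chi1 c + x * chi2 c).
    rewrite /pol horner_sum; apply: eq_bigr => c _.
    by rewrite hornerM hornerC horner_exp linE.
  have [|x] := @poly_nat_nonroot (pol f n * pol g m).
    rewrite mulf_neq0 //; apply/eqP => E.
      have := polE f n 0; rewrite E horner0 subr0.
      have -> : (fun c => 1 * chi1 c + 0 * chi2 c) = chi1.
        by apply/funext => c; rewrite mul1r mul0r addr0.
      by move/esym/eqP; rewrite (negbTE h1).
    have := polE g m 1; rewrite E horner0 subrr.
    have -> : (fun c => 0 * chi1 c + 1 * chi2 c) = chi2.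
      by apply/funext => c; rewrite mul1r mul0r add0r.
    by move/esym/eqP; rewrite (negbTE h2).
  rewrite hornerM !polE mulf_eq0 negb_or; set chi := fun c => _ => /andP[nf ng].
  have chiD : isadd chi by apply: char_line.
  exists chi; split=> //; rewrite evM //.
  have mlt : (m < (n + m).+1)%N by rewrite ltnS leq_addl.
  rewrite (bigD1 (Ordinal mlt)) //= big1 ?addr0; last first.
    move=> i; rewrite -val_eqE /= => im.
    case: (ltnP (n + m - i) n) => ln; first by rewrite (low _ _ _ _ Ef ln) // mul0r mul0rn.
    rewrite (low _ _ _ _ Eg _ chiD) ?mulr0 ?mul0rn //.
    by move: (ltn_ord i) im ln; lia.
  rewrite addnK -mulr_natr mulf_neq0 ?(mulf_neq0 nf ng) //.
  have : (0 < 'C(n + m, m))%N by rewrite bin_gt0 leq_addl.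
  by case: 'C(_, _) => // b _; apply: k0.
have ominl (a b : option D) : ole (omin a b) a.
  by have := ole_refl (omin a b); rewrite ole_min => /andP[].
have ominr (a b : option D) : ole (omin a b) b.
  by have := ole_refl (omin a b); rewrite ole_min => /andP[].
exists D, u, id; split=> //.
- split; rewrite /u ?ord0 //.
  + by rewrite g1E ordU ?oner_neq0 //= e0.
  + move=> f g; rewrite ordM; case: (ord f) (ord g) => [n|] [m|] //=.
    by rewrite -eD PoszD.
  + move=> f g; have := ordP (f + g); case Efg: (ord _) => [l|] //.
    move=> [[chi [chiD]]]; rewrite evD => h _.
    have [fn|gn] : ev l f chi != 0 \/ ev l g chi != 0.
      by apply/orP; rewrite -negb_and; apply: contra h => /andP[/eqP -> /eqP ->]; rewrite addr0.
    * have := ordP f; case Ef: (ord f) => [n|]; last first.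
        by move=> f0; rewrite f0 (morphD0 (evD l chi)) eqxx in fn.
      move=> _; have nl : (n <= l)%N.
        by rewrite leqNgt; apply/negP => ln; rewrite (low _ _ _ _ Ef ln) ?eqxx in fn.
      by apply: ole_trans (ominl _ _) _; rewrite /= ele lez_nat.
    * have := ordP g; case Eg: (ord g) => [n|]; last first.
        by move=> f0; rewrite f0 (morphD0 (evD l chi)) eqxx in gn.
      move=> _; have nl : (n <= l)%N.
        by rewrite leqNgt; apply/negP => ln; rewrite (low _ _ _ _ Eg ln) ?eqxx in gn.
      by apply: ole_trans (ominr _ _) _; rewrite /= ele lez_nat.
- by move=> f; rewrite /u; have := ordP f; case: (ord f).
- by move=> a a0; rewrite /u ordU //= e0.
- by move=> c; rewrite /u ordU ?oner_neq0 //= e0.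
- move=> c; rewrite /u; have := ordP (gU c 1 - 1); case: (ord _) => [[|n]|] //=.
    move=> [[chi [_ ]]]; rewrite (morphDB (evD 0 chi)) g1E !evU !expr0 subrr eqxx //.
  by move=> _; rewrite -e0 lt_neqAle ele /= (inj_eq (can_inj eK)).
- move=> f; rewrite /u.
  have sC'D : {morph sC' : x y / x + y}.
    by move=> x y; apply: (can_inj sCK); rewrite sCD !sC'K.
  have evs n chi : ev n (gmap t sC f) (t \o chi \o sC') = t (ev n f chi).
    apply: (gring_ext (F := fun f => ev n (gmap t sC f) (t \o chi \o sC'))
      (F' := fun f => t (ev n f chi))) f => [x y|x y|c a].
    - by rewrite gmapD evD.
    - by rewrite evD rmorphD.
    - by rewrite gmapU !evU /= sCK rmorphM rmorphXn.
  have nzs n : nz (gmap t sC f) n <-> nz f n.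
    split=> [[chi [chiD h]]|[chi [chiD h]]].
      exists (t' \o chi \o sC); split=> [x y|]; first by rewrite /= sCD chiD rmorphD.
      rewrite -(fmorph_eq0 t) -evs; congr (_ != 0): h; congr (ev n _ _).
      by apply/funext => c /=; rewrite t'K sC'K.
    exists (t \o chi \o sC'); split=> [x y|]; first by rewrite /= sC'D chiD rmorphD.
    by rewrite evs fmorph_eq0.
  have -> : omap id (omap (fun n : nat => e n) (ord f)) = omap (fun n : nat => e n) (ord f).
    by case: (ord f).
  congr omap; have := ordP f; case: (ord f) => [n [h1 h2]|->].
    by apply: ordE; [apply/nzs | move=> m /h2 h /nzs].
  by rewrite (morphD0 (gmapD t sC)) ord0.
Qed.
End AdditiveCharacters.

(** * Orthogonal bases of filtered p-divisible groups *)

(** A separated filtration of a p-divisible group by subgroups, indexed by the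
    integers, in which multiplication by p shifts the index by e. *)
Record p_filtration (V : zmodType) (fil : int -> V -> Prop) (p e : nat) : Prop := {
  pf_prime : prime p;
  pf_gt0 : (0 < e)%N;
  pfB : forall j x y, fil j x -> fil j y -> fil j (x - y);
  pf_le : forall i j x, i <= j -> fil j x -> fil i x;
  pf_p : forall j x, fil (j + e%:Z) (x *+ p) <-> fil j x;
  pf_ex : forall x, exists j, fil j x;
  pf_sep : forall x, x != 0 -> exists j, ~ fil j x;
  pf_div : forall x : V, exists y, y *+ p = x
}.

Section FilteredGroup.
Variables (V : zmodType) (fil : int -> V -> Prop) (p e : nat).
Hypothesis pf : p_filtration fil p e.

Let p_pr := pf_prime pf.
Let e_gt0 := pf_gt0 pf.
Let filB := pfB pf.
Let fil_le := pf_le pf.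
Let filp := pf_p pf.
Let fil_ex := pf_ex pf.
Let fil_sep := pf_sep pf.
Let pdiv := pf_div pf.
Let p_gt0 : (0 < p)%N := prime_gt0 p_pr.

Lemma fil0 j : fil j 0.
Proof.
have [i fi] := fil_ex 0.
have H n : fil (i + n%:Z * e%:Z) 0.
  elim: n => [|n IH]; first by rewrite mul0r addr0.
  by have := (filp (i + n%:Z * e%:Z) 0).2 IH; rewrite mul0rn -addrA intS mulrDl mul1r (addrC e%:Z).
have := H `|j - i|%N; apply: fil_le.
rewrite -lerBlDl; apply: le_trans (_ : `|j - i|%N%:Z <= _); first by lia.
by rewrite ler_peMr //; lia.
Qed.

Lemma filN j x : fil j x -> fil j (- x).
Proof. by move=> h; rewrite -sub0r; apply: filB (fil0 j) h. Qed.

Lemma filD j x y : fil j x -> fil j y -> fil j (x + y).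
Proof. by move=> hx /filN hy; rewrite -(opprK y); apply: filB. Qed.

Lemma filMn j x n : fil j x -> fil j (x *+ n).
Proof. by move=> h; elim: n => [|n IH]; rewrite ?mulr0n ?mulrS; [apply: fil0 | apply: filD]. Qed.

Lemma filMz j x n : fil j x -> fil j (x *~ n).
Proof. by case: n => n h; [apply: filMn | rewrite NegzE mulrNz; apply/filN/filMn]. Qed.

Lemma fil_sum j I (r : seq I) (P : pred I) F :
  (forall i, P i -> fil j (F i)) -> fil j (\sum_(i <- r | P i) F i).
Proof. by move=> h; apply: (big_ind (fil j)); [apply: fil0 | apply: filD | ]. Qed.

Lemma fil_sum_seq j (r : seq V) F :
  (forall i, i \in r -> fil j (F i)) -> fil j (\sum_(i <- r) F i).
Proof. by move=> h; rewrite big_seq; apply: fil_sum. Qed.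

Lemma filX j x q : fil (j + (e * q)%N%:Z) (x *+ p ^ q) <-> fil j x.
Proof.
elim: q j => [|q IH] j; first by rewrite muln0 addr0 expn0 mulr1n.
rewrite expnSr mulrnA mulnS addnC PoszD addrA; split=> [/filp/IH //|/IH h].
exact/filp.
Qed.

Lemma fil_eq0 x : (forall j, fil j x) -> x = 0.
Proof. by move=> h; apply: contrapT => /eqP/fil_sep[j]. Qed.

Lemma mulp_inj q : injective (fun x : V => x *+ p ^ q).
Proof.
apply: morphD_inj => [x y|x x0]; first by rewrite mulrnDl.
by apply: fil_eq0 => j; apply/(filX j x q); rewrite x0; apply: fil0.
Qed.

Lemma pXdiv q x : exists y : V, y *+ p ^ q = x.
Proof.
elim: q x => [|q IH] x; first by exists x; rewrite mulr1n.
by have [y <-] := pdiv x; have [z <-] := IH y; exists z; rewrite expnSr mulrnA.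
Qed.

Lemma lev_exists : exists lev : V -> int, forall x, x != 0 ->
  fil (lev x) x /\ ~ fil (lev x + 1) x.
Proof.
suff /boolp.choice[lev levP] : forall x, exists j, x != 0 -> fil j x /\ ~ fil (j + 1) x.
  by exists lev.
move=> x; have [->|x0] := eqVneq x 0; first by exists 0.
have [i fi] := fil_ex x; have [j nj] := fil_sep x0.
have ex : exists n : nat, `[< ~ fil (i + n%:Z) x >].
  exists `|j - i|%N; apply/asboolP => h; apply: nj; apply: fil_le h.
  by rewrite -lerBlDl; lia.
have [[|n] /asboolP nn nmin] := ex_minnP ex; first by rewrite addr0 in nn.
exists (i + n%:Z) => _; split; last by rewrite -addrA -PoszD addn1.
apply: contrapT => h; have /nmin : `[< ~ fil (i + n%:Z) x >] by apply/asboolP.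
by rewrite ltnn.
Qed.

Section Basis.
Variable lev : V -> int.
Hypothesis levP : forall x, x != 0 -> fil (lev x) x /\ ~ fil (lev x + 1) x.

Lemma lev_uniq x j : fil j x -> ~ fil (j + 1) x -> x != 0 /\ lev x = j.
Proof.
move=> h1 h2; have x0 : x != 0 by apply/eqP => x0; apply: h2; rewrite x0; apply: fil0.
split=> //; have [h3 h4] := levP x0; apply/eqP; rewrite eq_le.
apply/andP; split; rewrite leNgt; apply/negP => h.
  by apply: h2; apply: fil_le h3; lia.
by apply: h4; apply: fil_le h1; lia.
Qed.

(** The leading terms of the elements of B of a given level are independent
    over the prime field. *)
Definition orthogonal (B : set V) :=
  (forall b, B b -> b != 0 /\ 0 <= lev b < e%:Z) /\
  forall (j : int) (s : seq V) (a : V -> int), uniq s ->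
    (forall b, b \in s -> B b /\ lev b = j) -> fil (j + 1) (\sum_(b <- s) b *~ a b) ->
    forall b, b \in s -> (p%:Z %| a b)%Z.

Definition spanning (B : set V) := forall (j : int) c, 0 <= j < e%:Z -> fil j c ->
  exists l : seq V, [/\ forall b, b \in l -> B b /\ lev b = j,
    forall b, (count_mem b l < p)%N & fil (j + 1) (c - \sum_(b <- l) b)].

Lemma count_expand (s : seq V) (n : V -> nat) : uniq s ->
  let l := flatten [seq nseq (n b) b | b <- s] in
  [/\ {subset l <= s}, forall b, (count_mem b l <= n b)%N &
      \sum_(b <- l) b = \sum_(b <- s) b *+ n b].
Proof.
elim: s => [|c s IH] /=; first by rewrite !big_nil.
case/andP=> cs /IH /= [h1 h2 h3]; split.
- move=> b; rewrite mem_cat inE mem_nseq => /orP[/andP[_ ->] //|/h1 ->].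
  by rewrite orbT.
- move=> b; rewrite count_cat count_nseq /=; case: eqVneq => [<-|_]; last by rewrite mul0n h2.
  rewrite mul1n; suff -> : count_mem c (flatten [seq nseq (n b) b | b <- s]) = 0%N.
    by rewrite addn0.
  by apply/count_memPn; apply: contra cs => /h1.
by rewrite big_cat big_cons h3 big_nseq iter_addr_0.
Qed.

Lemma orthogonal_basis_exists : exists B, orthogonal B /\ spanning B.
Proof.
have Zup (F : set (set V)) : (F `<=` orthogonal)%classic -> total_on F subset ->
    orthogonal (\bigcup_(X in F) X)%classic.
  move=> FZ tot; split=> [b [X FX Xb]|j s a us sF h b bs].
    by have [h _] := FZ _ FX; apply: h.
  have [X [FX sX]] : exists X, F X /\ forall c, c \in s -> X c.
    have [X0 FX0 _] := (sF b bs).1.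
    elim: s {us h bs} sF => [|c s IH] sF; first by exists X0.
    have [|X [FX sX]] := IH; first by move=> d ds; apply: sF; rewrite inE ds orbT.
    have [Y FY Yc] := (sF c (mem_head _ _)).1.
    case: (tot _ _ FX FY) => XY.
      by exists Y; split=> // d; rewrite inE => /orP[/eqP -> //|/sX/XY].
    by exists X; split=> // d; rewrite inE => /orP[/eqP ->|/sX //]; apply: XY.
  have [_ o] := FZ _ FX; apply: (o j s a us) => // c cs.
  by split; [apply: sX | case: (sF c cs)].
have [B [Bo Bmax]] := Zorn_bigcup Zup.
exists B; split=> // j c j_e jc.
have [nc|nc] := pselect (fil (j + 1) c).
  by exists [::]; rewrite big_nil subr0; split=> // b; apply: p_gt0.
have [c0 cj] := lev_uniq jc nc.
have [Bc|nBc] := pselect (B c).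
  exists [:: c]; rewrite big_seq1 subrr; split; last exact: fil0.
    by move=> b; rewrite inE => /eqP ->.
  move=> b /=; rewrite addn0; apply: leq_ltn_trans (prime_gt1 p_pr).
  by case: (c == b).
have [o1 o2] := Bo.
have : ~ orthogonal (B `|` [set c])%classic.
  by apply: Bmax; split=> [b|/(_ c)]; [left | move=> h; apply: nBc; apply: h; right].
move=> no; have [j' [s [a [[us sB sf] [b0 b0s nb0]]]]] :
   exists j' s (a : V -> int), [/\ uniq s,
      forall b, b \in s -> (B `|` [set c])%classic b /\ lev b = j' &
      fil (j' + 1) (\sum_(b <- s) b *~ a b)] /\ exists2 b, b \in s & ~ (p%:Z %| a b)%Z.
  apply: contrapT => no'; apply: no; split=> [b [/o1 //| ->]|j' s a us sB sf b bs].
    by split=> //; rewrite cj.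
  by apply: contrapT => nb; apply: no'; exists j', s, a; split=> //; exists b.
have cs : c \in s.
  apply/negPn/negP => ncs; apply: nb0; apply: (o2 j' s a) => // b bs.
  have [[//|bc] lb] := sB b bs; by move: ncs; rewrite -[c]bc bs.
have jE : j' = j by rewrite -cj; have [_ ->] := sB c cs.
rewrite jE {j' jE} in sB sf.
have sfc := sf; rewrite (bigD1_seq c) // -big_filter /= in sfc.
set s' := filter _ s in sfc.
have us' : uniq s' by rewrite filter_uniq.
have s'B b : b \in s' -> B b /\ lev b = j.
  rewrite mem_filter => /andP[bc /sB[[//|/= bE] lb]]; split=> //.
  by rewrite bE eqxx in bc.
have pfil (x : V) m : fil j x -> (p%:Z %| m)%Z -> fil (j + 1) (x *~ m).
  move=> jx /dvdzP[m' ->]; rewrite mulrzA.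
  apply: (@fil_le _ (j + e%:Z)); last by apply/filp; apply: filMz.
  by rewrite lerD2l; lia.
have levs b : b \in s -> fil j b.
  move=> /sB[Bb <-]; apply: (levP _).1.
  by case: Bb => [/o1[]//|->].
have npac : ~ (p%:Z %| a c)%Z.
  move=> pac; apply: nb0; have [->//|b0c] := eqVneq b0 c.
  apply: (o2 j s' a us' s'B); last by rewrite mem_filter b0c.
  have := filB sfc (pfil c _ jc pac).
  by rewrite addrAC subrr add0r.
have cop : coprimez (a c) p%:Z.
  rewrite coprimez_sym coprimezE /= prime_coprime //; apply/negP => h; exact: npac.
have [n nE] : exists n : int, (p%:Z %| 1 - n * a c)%Z.
  have [u [v uv]] := Bezoutz (a c) p%:Z.
  exists u; have : u * a c + v * p%:Z = 1 by rewrite uv; apply/eqP.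
  by move=> <-; rewrite addrAC subrr add0r dvdz_mull.
pose al b : nat := `|((- n * a b) %% p%:Z)%Z|%N.
have p0 : p%:Z != 0 by rewrite eqz_nat -lt0n.
have alE b : (al b)%:Z = ((- n * a b) %% p%:Z)%Z by rewrite /al gez0_abs // modz_ge0.
have [h1 h2 h3] := count_expand al us'.
exists (flatten [seq nseq (al b) b | b <- s']); split; [ | |rewrite h3].
- by move=> b /h1/s'B.
- move=> b; apply: leq_ltn_trans (h2 b) _.
  by rewrite -ltz_nat alE ltz_pmod // ltz_nat.
have -> : c - \sum_(b <- s') b *+ al b =
   c *~ (1 - n * a c) + (c *~ a c + \sum_(b <- s') b *~ a b) *~ n
     + \sum_(b <- s') b *~ ((- n * a b) - (al b)%:Z).
  rewrite mulrzDl -mulrzA [a c * n]mulrC addrA -mulrzDr subrK mulr1z -addrA; congr (_ + _).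
  rewrite mulrz_suml -big_split -sumrN; apply: eq_bigr => b _ /=.
  by rewrite mulrzBr -mulrzA addrA -mulrzDr mulrC mulNr subrr mulr0z sub0r.
apply: filD; first (apply: filD); [exact: pfil | exact: filMz | apply: fil_sum_seq => b bs].
apply: pfil; first by apply: levs; move: bs; rewrite mem_filter => /andP[].
by rewrite alE {1}(divz_eq (- n * a b) p%:Z) addrK dvdz_mull.
Qed.


Variable B : set V.
Hypotheses (Bo : orthogonal B) (Bs : spanning B).

(** The number of multiples p^q b, counted from q = 0, that lie below level J. *)
Definition digits (J : nat) (b : V) : nat := (J + e.-1 - `|lev b|) %/ e.

Lemma B_lev b : B b -> exists2 d : nat, (d < e)%N & lev b = d.
Proof. by move=> /Bo.1[_]; case: (lev b) => // d /= ?; exists d. Qed.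

Lemma digitsS b q d : B b -> (d < e)%N ->
  if lev b == d%:Z then digits (e * q + d) b = q /\ digits (e * q + d).+1 b = q.+1
  else digits (e * q + d).+1 b = digits (e * q + d) b /\
       (e * q + d < e * digits (e * q + d) b + `|lev b|)%N.
Proof.
rewrite /digits => /B_lev[d' d'e ->] de; rewrite absz_nat eqz_nat.
have dv a r q' : (r < e)%N -> a = (q' * e + r)%N -> (a %/ e)%N = q'.
  by move=> re ->; rewrite divnMDl // divn_small // addn0.
rewrite (mulnC e q); have [<-|dd'] := eqVneq d' d.
  by split; [apply: (dv _ e.-1) | apply: (dv _ 0%N)]; rewrite ?mulSn; lia.
case: (ltnP d d') => h.
  have -> : (((q * e + d).+1 + e.-1 - d') %/ e)%N = q by apply: (dv _ (e + d - d')%N); lia.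
  have -> : ((q * e + d + e.-1 - d') %/ e)%N = q by apply: (dv _ (e.-1 + d - d')%N); lia.
  by split=> //; lia.
have -> : (((q * e + d).+1 + e.-1 - d') %/ e)%N = q.+1.
  by apply: (dv _ (d - d')%N); rewrite ?mulSn; lia.
have -> : ((q * e + d + e.-1 - d') %/ e)%N = q.+1.
  by apply: (dv _ (d - d'.+1)%N); rewrite ?mulSn; lia.
by split=> //; rewrite mulnS mulnC; lia.
Qed.

Lemma digits0 b : B b -> digits 0 b = 0%N.
Proof. by move=> /B_lev[d de]; rewrite /digits => ->; rewrite divn_small //; lia. Qed.

Lemma digits_le b J J' : (J <= J')%N -> (digits J b <= digits J' b)%N.
Proof. by move=> h; rewrite leq_div2r // leq_sub2r // leq_add2r. Qed.

Lemma digits_ge b J : B b -> (J <= e * digits J b + `|lev b|)%N.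
Proof.
move=> Bb; rewrite (divn_eq J e) mulnC.
have := digitsS (J %/ e) Bb (ltn_pmod J e_gt0).
case: eqP => [lb [-> _]|_ [_ /ltnW //]].
by rewrite lb.
Qed.

(** p-adic digits: every element is approximated by sums of basis elements. *)
Lemma approximation c J J' : fil J%:Z c -> (J <= J')%N ->
  exists l : seq V, [/\ forall b, b \in l -> B b,
    forall b, B b -> (p ^ digits J b %| count_mem b l)%N,
    forall b, B b -> (count_mem b l < p ^ digits J' b)%N &
    fil J'%:Z (c - \sum_(b <- l) b)].
Proof.
move=> Jc; elim: J' => [|J' IH].
  rewrite leqn0 => /eqP J0; rewrite J0 in Jc *; exists [::].
  by rewrite big_nil subr0; split=> // b Bb; rewrite expn_gt0 p_gt0.
rewrite leq_eqVlt => /orP[/eqP JE|]; last rewrite ltnS => JJ'.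
  exists [::]; rewrite big_nil subr0 -JE; split=> // b Bb; by rewrite ?expn_gt0 ?p_gt0.
have {IH} [l [lB ld lc lf]] := IH JJ'.
set q := (J' %/ e)%N; set d := (J' %% e)%N; have de : (d < e)%N by rewrite ltn_pmod.
have J'E : J' = (e * q + d)%N by rewrite mulnC -divn_eq.
have [y yE] := pXdiv q (c - \sum_(b <- l) b).
have [||l1 [l1B l1c l1f]] := @Bs d%:Z y; first by rewrite lez_nat ltz_nat.
  by apply/(filX _ _ q); rewrite yE -PoszD addnC -J'E.
exists (l ++ flatten (nseq (p ^ q) l1)).
have cnt b : count_mem b (l ++ flatten (nseq (p ^ q) l1)) =
    (count_mem b l + p ^ q * count_mem b l1)%N.
  rewrite count_cat count_flatten map_nseq sumn_nseq mulnC.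
  by [].
have sumE : \sum_(b <- flatten (nseq (p ^ q) l1)) b = (\sum_(b <- l1) b) *+ p ^ q.
  by rewrite big_flatten big_nseq iter_addr_0.
split.
- move=> b; rewrite mem_cat => /orP[/lB //|/flattenP[x]].
  by rewrite mem_nseq => /andP[_ /eqP ->] /l1B[].
- move=> b Bb; rewrite cnt dvdn_add ?ld //.
  have [/l1B[_ lb]|/count_memPn ->] := boolP (b \in l1); last by rewrite muln0.
  apply/dvdn_mulr/dvdn_exp2l; apply: leq_trans (digits_le b JJ') _.
  by have := digitsS q Bb de; rewrite lb eqxx -J'E => -[->].
- move=> b Bb; rewrite cnt.
  have [/l1B[_ lb]|/count_memPn ->] := boolP (b \in l1); last first.
    by rewrite muln0 addn0; apply: leq_trans (lc b Bb) _; rewrite leq_exp2l ?prime_gt1 ?digits_le.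
  have := digitsS q Bb de; rewrite lb eqxx -J'E => -[d1 d2].
  move: (lc b Bb) (l1c b); rewrite d1 d2 expnS; nia.
rewrite big_cat sumE /= opprD addrA -yE -mulrnBl.
have -> : J'.+1%:Z = (d%:Z + 1) + (e * q)%N%:Z by lia.
exact/filX.
Qed.

Lemma sum_count (l s : seq V) : uniq s -> {subset l <= s} ->
  \sum_(b <- l) b = \sum_(b <- s) b *+ count_mem b l.
Proof.
move=> us; elim: l => [|c l IH] ls; first by rewrite big_nil big1 // => b _; rewrite mulr0n.
rewrite big_cons IH; last by move=> b bl; apply: ls; rewrite inE bl orbT.
rewrite [RHS](bigD1_seq c) ?ls ?mem_head //= eqxx mulrS -addrA; congr (_ + _).
rewrite (bigD1_seq c) ?ls ?mem_head //=; congr (_ + _).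
by apply: eq_bigr => b /negbTE bc; rewrite eq_sym bc.
Qed.

Lemma digits_uniq l l' J : (forall b, b \in l -> B b) -> (forall b, b \in l' -> B b) ->
  fil J%:Z (\sum_(b <- l) b - \sum_(b <- l') b) ->
  forall b, B b -> ((p ^ digits J b)%N%:Z %| (count_mem b l)%:Z - (count_mem b l')%:Z)%Z.
Proof.
move=> lB l'B; pose s := undup (l ++ l').
have us : uniq s by rewrite undup_uniq.
have sB b : b \in s -> B b by rewrite mem_undup mem_cat => /orP[/lB|/l'B].
pose n b : int := (count_mem b l)%:Z - (count_mem b l')%:Z.
have sumE : \sum_(b <- l) b - \sum_(b <- l') b = \sum_(b <- s) b *~ n b.
  rewrite (@sum_count l s) ?(@sum_count l' s) // => [|b bl|b bl]; first last.
  - by rewrite mem_undup mem_cat bl.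
  - by rewrite mem_undup mem_cat bl orbT.
  by rewrite -sumrB; apply: eq_bigr => b _; rewrite mulrzBr.
rewrite sumE => {sumE}.
suff: fil J%:Z (\sum_(b <- s) b *~ n b) ->
  forall b, B b -> ((p ^ digits J b)%N%:Z %| n b)%Z by [].
elim: J => [|J IH] f b Bb.
  by rewrite digits0 // expn0 dvd1z.
have {}IH : forall b, B b -> ((p ^ digits J b)%N%:Z %| n b)%Z.
  by apply: IH; apply: fil_le f; lia.
set q := (J %/ e)%N; set d := (J %% e)%N; have de : (d < e)%N by rewrite ltn_pmod.
have JE : J = (e * q + d)%N by rewrite mulnC -divn_eq.
have := digitsS q Bb de; rewrite -JE; case: eqP => [lb [_ ->]|_ [-> _]]; last exact: IH.
have [bs|bs] := boolP (b \in s); last first.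
  move: bs; rewrite mem_undup mem_cat negb_or => /andP[/count_memPn bl /count_memPn bl'].
  by rewrite /n bl bl' subrr dvdz0.
have nE c : exists a : int, B c /\ lev c = d%:Z -> n c = a * (p ^ q)%N%:Z.
  have [[Bc lc]|no] := pselect (B c /\ lev c = d%:Z); last by exists 0.
  have /dvdzP[a aE] := IH c Bc; exists a => _; rewrite aE; congr (_ * (p ^ _)%N%:Z).
  by have := digitsS q Bc de; rewrite lc eqxx -JE => -[].
case/boolp.choice: nE => a aE.
pose s' := [seq c <- s | lev c == d%:Z].
have s'B c : c \in s' -> B c /\ lev c = d%:Z.
  by rewrite mem_filter => /andP[/eqP ? /sB].
have bs' : b \in s' by rewrite mem_filter lb eqxx.
rewrite (aE b) // expnS PoszM dvdz_mul //.
have [_ o2] := Bo; apply: (o2 d%:Z s' a _ s'B _ b bs'); first by rewrite filter_uniq.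
apply/(filX _ _ q).
have -> : (\sum_(c <- s') c *~ a c) *+ p ^ q =
    \sum_(c <- s) c *~ n c - \sum_(c <- s | lev c != d%:Z) c *~ n c.
  rewrite [X in _ = X - _](bigID (fun c => lev c == d%:Z)) /= addrK -sumrMnl.
  rewrite -[RHS]big_filter -/s'; by apply: eq_big_seq => c /s'B/aE ->; rewrite mulrzA.
have -> : d%:Z + 1 + (e * q)%N%:Z = J.+1%:Z by lia.
apply: filB => //; rewrite -big_filter; apply: fil_sum_seq => c.
rewrite mem_filter => /andP[/negbTE lc /sB Bc].
have := digitsS q Bc de; rewrite lc -JE => -[_ h].
have /dvdzP[m ->] := IH c Bc; rewrite mulrzA.
apply: (@fil_le _ (lev c + (e * digits J c)%N%:Z)); first by have [d' _ lE] := B_lev Bc; lia.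
by apply/filX/filMz; apply: (levP _).1; case: (Bo.1 c Bc).
Qed.

End Basis.
End FilteredGroup.

(** * The place in positive residue characteristic *)

Lemma realalg_total : total (<=%R : rel realalg).
Proof. exact: le_total. Qed.

Lemma realalg_leD2l (x y z : realalg) : y <= z -> x + y <= x + z.
Proof. by rewrite lerD2l. Qed.

HB.instance Definition _ := isOrderedAbelian.Build realalg realalg_total realalg_leD2l.

Lemma realalg_root (p e : nat) : (1 < p)%N -> (0 < e)%N ->
  exists2 x : realalg, 1 < x & x ^+ e = p%:R.
Proof.
move=> p1 e0.
have [||x /andP[x1 _] /rootP] := @poly_ivt realalg ('X^e - p%:R%:P) 1 p%:R.
- by rewrite ler1n ltnW.
- rewrite !hornerE expr1n subr_le0 ler1n ltnW // subr_ge0 -{1}[p%:R]expr1.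
  by rewrite ler_weXn2l // ler1n ltnW.
rewrite !hornerE => /eqP; rewrite subr_eq0 => /eqP xE; exists x => //.
rewrite lt_neqAle x1 andbT; apply: contraTneq p1 => x1E.
by move: xE; rewrite -x1E expr1n => /esym/eqP; rewrite pnatr_eq1 => /eqP ->.
Qed.

Section Near.
Variables (A : comNzRingType) (u : A -> option realalg).
Hypothesis sv : semival u.
Implicit Types (x y z : A) (r : realalg).

Definition near r x y := ole (Some r) (u (x - y)).

Lemma near_refl r x : near r x x.
Proof. by rewrite /near subrr (sv0 sv). Qed.

Lemma near_sym r x y : near r x y -> near r y x.
Proof. by rewrite /near (svBC sv). Qed.

Lemma near_trans r y x z : near r x y -> near r y z -> near r x z.
Proof. by move=> h1 h2; rewrite /near -(subrK y x) -addrA; apply: (sv_geD sv). Qed.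

Lemma near_le r r' x y : r' <= r -> near r x y -> near r' x y.
Proof. by move=> h; apply: (ole_trans (b := Some r)). Qed.

Lemma nearD r x y x' y' : near r x y -> near r x' y' -> near r (x + x') (y + y').
Proof. by move=> h1 h2; rewrite /near opprD addrACA; apply: (sv_geD sv). Qed.

Lemma near_sum r I (s : seq I) (F G : I -> A) : (forall i, near r (F i) (G i)) ->
  near r (\sum_(i <- s) F i) (\sum_(i <- s) G i).
Proof.
by move=> h; apply: (big_ind2 (near r)) => //; [exact: near_refl | move=> *; exact: nearD].
Qed.

Lemma nearM r x y x' y' : ole (Some 0) (u x) -> ole (Some 0) (u y') ->
  near r x y -> near r x' y' -> near r (x * x') (y * y').
Proof.
move=> x0 y0 h1 h2; rewrite /near.
have -> : x * x' - y * y' = x * (x' - y') + (x - y) * y' by ring.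
apply: (sv_geD sv); rewrite (svM sv) -[Some r]/(Some r).
  by rewrite -[Some r]oadd0; apply: ole_oadd.
by rewrite -[Some r]oadd0 oaddC; apply: ole_oadd.
Qed.

Lemma ge0_prod I (s : seq I) (P : pred I) (F : I -> A) :
  (forall i, ole (Some 0) (u (F i))) -> ole (Some 0) (u (\prod_(i <- s | P i) F i)).
Proof.
move=> h; apply: (big_ind (fun x => ole (Some 0) (u x))) => // [|x y x0 y0].
  by rewrite (sv1 sv) ole_refl.
by rewrite (svM sv) -[Some 0]oadd0; apply: ole_oadd.
Qed.

Let exp_prod x n : x ^+ n = \prod_(i <- iota 0 n) x.
Proof. by rewrite big_const_seq count_predT size_iota iter_mulr_1. Qed.

Lemma ge0X x n : ole (Some 0) (u x) -> ole (Some 0) (u (x ^+ n)).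
Proof. by move=> h; rewrite exp_prod; apply: ge0_prod. Qed.

Lemma near_prod (I : eqType) r (s : seq I) (F G : I -> A) :
  (forall i, i \in s -> ole (Some 0) (u (F i))) ->
  (forall i, i \in s -> ole (Some 0) (u (G i))) ->
  (forall i, i \in s -> near r (F i) (G i)) ->
  near r (\prod_(i <- s) F i) (\prod_(i <- s) G i).
Proof.
elim: s => [|i s IH] F0 G0 FG; first by rewrite !big_nil near_refl.
rewrite !big_cons; apply: nearM.
- exact/F0/mem_head.
- rewrite big_seq; apply: (big_ind (fun x => ole (Some 0) (u x))) => [|x y x0 y0|j js].
  + by rewrite (sv1 sv) ole_refl.
  + by rewrite (svM sv) -[Some 0]oadd0; apply: ole_oadd.
  + by apply: G0; rewrite inE js orbT.
- exact/FG/mem_head.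
- by apply: IH => j js; [apply: F0 | apply: G0 | apply: FG]; rewrite inE js orbT.
Qed.

Lemma nearX r x y n : ole (Some 0) (u x) -> ole (Some 0) (u y) ->
  near r x y -> near r (x ^+ n) (y ^+ n).
Proof.
move=> x0 y0 h; rewrite !exp_prod; exact: near_prod.
Qed.

Lemma near_ge r x y : near r x y -> ole (Some r) (u x) -> ole (Some r) (u y).
Proof.
by move=> h hx; rewrite -(subrK x y) addrC; apply: (sv_geD sv) => //; apply: near_sym.
Qed.

Lemma near_eq r x y : near r x y -> olt (u x) (Some r) -> u y = u x.
Proof. by move=> h hx; apply: (sv_eq sv); apply: olt_le_trans hx h. Qed.
End Near.

Section WeightedRing.
Variables (k : fieldType) (V : zmodType) (p : nat) (wb : V -> realalg).
Hypotheses (p_pr : prime p) (pk : p%:R = 0 :> k).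

(** Exponents with rational entries: the ring contains all p-power roots of
    its variables. *)
Local Notation expo := (gring rat V).
Local Notation wring := (gring k expo).

Definition trivial_val (a : k) : option realalg := if a == 0 then None else Some 0.
Definition expo_weight (n : expo) : realalg := glift (fun b r => ratr r * wb b) n.
Definition wval : wring -> option realalg := wmin trivial_val expo_weight.

Let wtDa b : {morph (fun r : rat => ratr r * wb b) : x y / x + y}.
Proof. by move=> x y; rewrite rmorphD mulrDl. Qed.

Lemma expo_weightD : {morph expo_weight : x y / x + y}.
Proof. exact: (gliftD wtDa). Qed.

Lemma expo_weightU b r : expo_weight (gU b r) = ratr r * wb b.
Proof. exact: (gliftU wtDa). Qed.

Lemma trivial_val_semival : semival trivial_val.
Proof.
rewrite /trivial_val; split=> [||x y|x y].
- by rewrite eqxx.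
- by rewrite oner_eq0.
- rewrite mulf_eq0; case: eqP => //= _; case: eqP => //= _; by rewrite addr0.
- have [->|_] := eqVneq x 0; first by rewrite add0r; case: ifP => _ //=; rewrite lexx.
  have [->|_] := eqVneq y 0; first by rewrite addr0; case: ifP => _ //=; rewrite lexx.
  by case: ifP => _ //=; rewrite /omin /= lexx /= lexx.
Qed.

Lemma expo_tf (n : expo) m : n *+ m.+1 = 0 -> n = 0.
Proof.
move=> h; apply: gringP => b; rewrite gcf0.
have := congr1 (gcf b) h; rewrite (morphDMn (gcfD b)) gcf0 => /eqP.
by rewrite mulrn_eq0 => /eqP.
Qed.

Lemma wval_semival : semival wval.
Proof. exact: (wmin_semival trivial_val_semival expo_weightD expo_tf). Qed.

Lemma wvalU n a : wval (gU n a) = if a == 0 then None else Some (expo_weight n).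
Proof.
rewrite /wval (wminU _ trivial_val_semival) /wterm gcfUU /trivial_val.
by case: eqP => //= _; rewrite add0r.
Qed.

Lemma wval_le x n : gcf n x != 0 -> ole (wval x) (Some (expo_weight n)).
Proof.
move=> h; apply: ole_trans (wmin_le expo_weight trivial_val_semival x n) _.
by rewrite /wterm /trivial_val (negbTE h) /= add0r lexx.
Qed.

Lemma wring_pchar : p \in [pchar wring].
Proof.
rewrite inE p_pr; apply/eqP; apply: gringP => n.
rewrite (morphDMn (gcfD n)) gcf0 g1E gcfU; case: eqP => _; last by rewrite mul0rn.
by rewrite mulr1n pk.
Qed.

Lemma frobD q (x y : wring) : (x + y) ^+ (p ^ q) = x ^+ (p ^ q) + y ^+ (p ^ q).
Proof.
apply: exprDn_pchar; rewrite pnatX; apply/orP; left.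
by rewrite pnatE // wring_pchar.
Qed.

Definition evar m b : expo := gU b ((p%:R ^+ m)^-1).
Definition wvar m b : wring := locked (gU (evar m b) 1).

Lemma wvarE m b : wvar m b = gU (evar m b) 1.
Proof. by rewrite /wvar -lock. Qed.

(** The image of the sum of p^-m b for b in l. *)
Definition T m (l : seq V) : wring := \prod_(b <- l) (1 + wvar m b).

Lemma pXrat m : (p%:R : rat) ^+ m != 0.
Proof. by rewrite expf_neq0 // pnatr_eq0 -lt0n prime_gt0. Qed.

Lemma evar_weight m b : expo_weight (evar m b) = (p%:R ^+ m)^-1 * wb b.
Proof. by rewrite expo_weightU fmorphV rmorphXn rmorph_nat. Qed.

Lemma wvar_val m b : wval (wvar m b) = Some ((p%:R ^+ m)^-1 * wb b).
Proof. by rewrite wvarE wvalU oner_eq0 evar_weight. Qed.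

Lemma wvarX m b d : wvar (m + d) b ^+ (p ^ d) = wvar m b.
Proof.
have E : evar (m + d) b *+ p ^ d = evar m b.
  rewrite -(morphDMn (gUD b)); congr (gU _ _).
  by rewrite -[LHS]mulr_natr natrX exprD invfM mulfVK ?pXrat.
by rewrite !wvarE (gU_X (evar (m + d) b) (1 : k)) E (expr1n k).
Qed.

Lemma T_cat m l l' : T m (l ++ l') = T m l * T m l'.
Proof. exact: big_cat. Qed.

Lemma T_raise m d l : T (m + d) (flatten (nseq (p ^ d) l)) = T m l.
Proof.
rewrite /T big_flatten big_nseq iter_mulr_1 -prodrXl; apply: eq_bigr => b _.
by rewrite frobD expr1n wvarX.
Qed.

Lemma prod_count (A : comNzRingType) (F : V -> A) (l s : seq V) :
  uniq s -> {subset l <= s} ->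
  \prod_(b <- l) F b = \prod_(b <- s) F b ^+ count_mem b l.
Proof.
move=> us; elim: l => [|c l IH] ls; first by rewrite big_nil big1.
rewrite big_cons IH; last by move=> b bl; apply: ls; rewrite inE bl orbT.
rewrite [RHS](bigD1_seq c) ?ls ?mem_head //= eqxx exprS -mulrA; congr (_ * _).
rewrite (bigD1_seq c) ?ls ?mem_head //=; congr (_ * _).
by apply: eq_bigr => b /negbTE bc; rewrite eq_sym bc.
Qed.

Hypothesis wb_gt0 : forall b, 0 < wb b.

Lemma wvar_gt0 m b : (0 : realalg) < (p%:R ^+ m)^-1 * wb b.
Proof. by rewrite mulr_gt0 // invr_gt0 exprn_gt0 // ltr0n prime_gt0. Qed.

Lemma wvar1_ge0 m b : ole (Some 0) (wval (1 + wvar m b)).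
Proof.
apply: (sv_geD wval_semival); first by rewrite (sv1 wval_semival) /= lexx.
by rewrite wvar_val /=; apply/ltW/wvar_gt0.
Qed.

Lemma T_ge0 m l : ole (Some 0) (wval (T m l)).
Proof. by apply: (ge0_prod wval_semival) => b; apply: wvar1_ge0. Qed.

Lemma wvar_pow_near m b q n n' (r : realalg) :
  ((p ^ q)%N%:Z %| n%:Z - n'%:Z)%Z -> r <= p%:R ^+ q * ((p%:R ^+ m)^-1 * wb b) ->
  near wval r ((1 + wvar m b) ^+ n) ((1 + wvar m b) ^+ n').
Proof.
move=> + hr; wlog nn' : n n' / (n' <= n)%N => [W|] h.
  case: (leqP n' n) => [/W|/ltnW/W W']; first exact.
  by apply: (near_sym wval_semival); apply: W'; rewrite -opprB rpredN.
move: h; rewrite subzn // => /dvdzP[m' mE].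
have [j jE] : exists j : nat, (n = n' + p ^ q * j)%N.
  have pq : 0 < (p ^ q)%N%:Z by rewrite ltz_nat expn_gt0 prime_gt0.
  have : 0 <= m' by rewrite -(pmulr_lge0 _ pq) -mE.
  case: m' mE => // j /eqP; rewrite -PoszM eqz_nat mulnC => /eqP jE _.
  by exists j; rewrite -jE subnKC.
rewrite jE exprD exprM frobD expr1n -{2}[_ ^+ n']mulr1.
apply: (nearM wval_semival).
- by apply: (ge0X wval_semival); apply: wvar1_ge0.
- by rewrite (sv1 wval_semival) /= lexx.
- apply: (near_refl wval_semival r).
have X : wval (wvar m b ^+ (p ^ q)) = Some (((p%:R ^+ m)^-1 * wb b) *+ p ^ q).
  exact: (svX wval_semival _ (wvar_val m b)).
have X0 : ole (Some r) (wval (wvar m b ^+ (p ^ q))).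
  by rewrite X /=; apply: le_trans hr _; rewrite -[X in _ <= X]mulr_natl natrX.
rewrite -[X in near _ _ _ X](expr1n _ j); apply: (nearX wval_semival).
- apply: (sv_geD wval_semival); first by rewrite (sv1 wval_semival) /= lexx.
  by rewrite X /= mulrn_wge0 // ltW // wvar_gt0.
- by rewrite (sv1 wval_semival) /= lexx.
by rewrite /near addrC addKr.
Qed.

Lemma T_near m l l' (r : realalg) :
  (forall b, b \in l \/ b \in l' -> exists2 q : nat,
    ((p ^ q)%N%:Z %| (count_mem b l)%:Z - (count_mem b l')%:Z)%Z &
    r <= p%:R ^+ q * ((p%:R ^+ m)^-1 * wb b)) ->
  near wval r (T m l) (T m l').
Proof.
move=> h; pose s := undup (l ++ l').
rewrite /T (@prod_count _ _ l s) ?undup_uniq //; last first.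
  by move=> b bl; rewrite mem_undup mem_cat bl.
rewrite (@prod_count _ _ l' s) ?undup_uniq //; last first.
  by move=> b bl; rewrite mem_undup mem_cat bl orbT.
apply: (near_prod wval_semival) => b bs.
- by apply: (ge0X wval_semival); apply: wvar1_ge0.
- by apply: (ge0X wval_semival); apply: wvar1_ge0.
have [|q q1 q2] := h b; first by move: bs; rewrite mem_undup mem_cat => /orP.
exact: wvar_pow_near q1 q2.
Qed.

End WeightedRing.

Section ExponentLists.
Variables (k : fieldType) (V : zmodType) (p : nat) (wb : V -> realalg).
Hypotheses (p_pr : prime p) (pk : p%:R = 0 :> k).
Local Notation E := (gring rat V).
Local Notation R := (gring k (gring rat V)).
Local Notation T := (@T k V p).
Local Notation wvar := (@wvar k V p).
Implicit Types (l : seq V) (n : E) (x y : R).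

Definition esum m l : E := \sum_(b <- l) evar p m b.

Lemma esum_cons m b l : esum m (b :: l) = evar p m b + esum m l.
Proof. exact: big_cons. Qed.

Lemma gcf_esum m l c : gcf c (esum m l) = (p%:R ^+ m)^-1 *+ count_mem c l.
Proof.
elim: l => [|b l IH]; first by rewrite /esum big_nil gcf0 mulr0n.
by rewrite esum_cons gcfD IH gcfU /= mulrnDr eq_sym.
Qed.

Lemma esum_perm m l l' : esum m l = esum m l' -> perm_eq l l'.
Proof.
move=> h; apply/allP => c _ /=; have := congr1 (gcf c) h.
rewrite !gcf_esum -!(mulr_natl (p%:R ^+ m)^-1) => /mulIf; rewrite invr_eq0 pXrat // => /(_ isT).
by move/eqP; rewrite eqr_nat.
Qed.

Lemma prod_wvar m l : \prod_(b <- l) wvar m b = gU (esum m l) 1 :> R.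
Proof.
elim: l => [|b l IH]; first by rewrite /esum !big_nil g1E.
rewrite big_cons IH wvarE gUM esum_cons.
rewrite (mulr1 (1 : k)); reflexivity.
Qed.

Lemma T_cons m b l : T m (b :: l) = T m l + wvar m b * T m l.
Proof. by rewrite /T big_cons mulrDl mul1r. Qed.

Lemma T_supp m l n : gcf n (T m l) != 0 -> exists l', subseq l' l /\ n = esum m l'.
Proof.
elim: l n => [|b l IH] n.
  rewrite /T big_nil g1E gcfU; have [<- _|_] := eqVneq 0 n; last by rewrite mulr0n eqxx.
  by exists [::]; rewrite /esum big_nil.
rewrite T_cons gcfD wvarE gcfUM mul1r.
have [h|] := eqVneq (gcf n (T m l)) 0; last first.
  move=> /IH[l' [h ->]] _; exists l'; split=> //.
  exact: subseq_trans h (subseq_cons _ _).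
rewrite h add0r => /IH[l' [h' nE]]; exists (b :: l'); split; first by rewrite /= eqxx.
by rewrite esum_cons -nE addrC subrK.
Qed.

Lemma T_top m l l' : (size l <= size l')%N ->
  gcf (esum m l') (T m l) = (perm_eq l l')%:R.
Proof.
move=> ll'; have lt0 l1 l2 : (size l1 < size l2)%N -> gcf (esum m l2) (T m l1) = 0.
  move=> h; apply: contraTeq h => /T_supp[l3 [/size_subseq s31 /esum_perm/perm_size s23]].
  by rewrite -leqNgt s23.
have [ll|nl] := boolP (perm_eq l l'); last first.
  apply: contraNeq nl => /T_supp[l3 [s3 /esum_perm s23]].
  suff <- : l3 = l by rewrite perm_sym.
  apply/eqP; have := size_subseq_leqif s3; case=> h <-; rewrite eqn_leq h.
  by rewrite -(perm_size s23).
have -> : esum m l' = esum m l by apply/esym/perm_big.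
elim: l {l' ll' ll} => [|b l IH].
  by rewrite /T /esum !big_nil g1E gcfUU.
by rewrite T_cons gcfD lt0 // add0r wvarE gcfUM mul1r esum_cons addrC addKr IH.
Qed.

Section Tail.
Variables (m : nat) (B : set V) (D : V -> nat).

Let good x := forall n, gcf n x != 0 -> exists l, n = esum m l /\ forall b, b \in l -> B b.
Let bad x := forall n, gcf n x != 0 -> exists l, [/\ n = esum m l, forall b, b \in l -> B b &
  exists2 b, B b & (p ^ D b <= count_mem b l)%N].

Lemma T_tail l0 l1 l : (forall b, b \in l0 -> B b) -> (forall b, b \in l1 -> B b) ->
  (forall b, B b -> (p ^ D b %| count_mem b l1)%N) ->
  (forall b, B b -> (count_mem b l < p ^ D b)%N) ->
  gcf (esum m l) (T m l0 * T m l1) = gcf (esum m l) (T m l0).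
Proof.
move=> l0B l1B dv lt.
have badD x y : bad x -> bad y -> bad (x + y).
  move=> hx hy n; rewrite gcfD; have [->|/hx h _] := eqVneq (gcf n x) 0; last exact: h.
  by rewrite add0r => /hy.
have badM x y : bad x -> good y -> bad (x * y).
  move=> hx hy n; rewrite -gsuppE => /gsuppM[q]; rewrite !gsuppE.
  move=> /hx[l2 [qE h2 [b Bb cb]]] /hy[l3 [rE h3]].
  exists (l2 ++ l3); split; first by rewrite -(subrK q n) rE qE addrC /esum big_cat.
    by move=> c; rewrite mem_cat => /orP[/h2|/h3].
  by exists b => //; rewrite count_cat (leq_trans cb) ?leq_addr.
have good1 : good 1.
  move=> n; rewrite g1E gcfU; have [<- _|_] := eqVneq 0 n; last by rewrite mulr0n eqxx.
  by exists [::]; rewrite /esum big_nil.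
have badg x : bad x -> good (1 + x).
  move=> hx n; rewrite gcfD; have [->|h] := eqVneq (gcf n (1 : R)) 0; last by move=> _; apply: (good1 n).
  by rewrite add0r => /hx[l2 [-> h2 _]]; exists l2.
have bad0 : bad 0 by move=> n; rewrite gcf0 eqxx.
pose one x := bad (x - 1).
have oneM x y : one x -> one y -> one (x * y).
  move=> hx hy; rewrite /one.
  have -> : x * y - 1 = (x - 1) * (1 + (y - 1)) + (y - 1) by ring.
  by apply: badD => //; apply: badM => //; apply: badg.
have one1 : one 1 by rewrite /one subrr.
have oneX x i : one x -> one (x ^+ i).
  by move=> h; elim: i => [|i IH]; rewrite ?expr0 ?exprS //; apply: oneM.
have T1 : one (T m l1).
  rewrite /T (@prod_count _ _ _ l1 (undup l1)) ?undup_uniq //; last first.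
    by move=> b; rewrite mem_undup.
  rewrite big_seq; apply: (big_ind one) => // b; rewrite mem_undup => /l1B Bb.
  have /dvdnP[i ->] := dv b Bb; rewrite mulnC exprM frobD // expr1n; apply: oneX.
  rewrite /one addrAC subrr add0r wvarE gU_X expr1n => n.
  rewrite gcfU; have [<- _|_] := eqVneq (evar p m b *+ p ^ D b) n; last by rewrite mulr0n eqxx.
  exists (nseq (p ^ D b) b); split.
  - by rewrite /esum big_nseq iter_addr_0.
  - by move=> c; rewrite mem_nseq => /andP[_ /eqP ->].
  - by exists b; rewrite ?count_nseq //= eqxx mul1n.
have T0 : good (T m l0).
  move=> n /T_supp[l2 [s2 ->]]; exists l2; split=> // b.
  by move=> /(mem_subseq s2)/l0B.
rewrite -{1}[T m l1](subrK 1) mulrDr mulr1 gcfD; apply/eqP.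
rewrite -[X in _ == X]add0r (inj_eq (addIr _)); apply: contraT => h.
have [n [/esum_perm ll _ [b Bb]]] := badM _ _ T1 T0 _ (eq_ind _ (fun x => gcf _ x != 0) h _ (mulrC _ _)).
by rewrite leqNgt -(permP ll) lt.
Qed.
End Tail.
End ExponentLists.

Section Coordinates.
Variables (k : fieldType) (V : zmodType) (fil : int -> V -> Prop) (p e : nat).
Hypotheses (pf : p_filtration fil p e) (pk : p%:R = 0 :> k).
Let p_pr := pf_prime pf.
Let e_gt0 := pf_gt0 pf.
Let filB := pfB pf.
Let fil_le := pf_le pf.
Variables (lev : V -> int) (B : set V).
Hypothesis levP : forall x, x != 0 -> fil (lev x) x /\ ~ fil (lev x + 1) x.
Hypotheses (Bo : orthogonal fil p e lev B) (Bs : spanning fil p e lev B).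
Variable om : realalg.
Hypotheses (om1 : 1 < om) (ome : om ^+ e = p%:R).

Let filX := filX pf.
Let filD := filD pf.
Let om0 : om != 0. Proof. by rewrite gt_eqF // (lt_trans ltr01). Qed.
Let wb (b : V) : realalg := om ^ lev b.

Let wb_gt0 b : 0 < wb b.
Proof. by rewrite exprz_gt0 // (lt_trans ltr01). Qed.

Lemma om_le i j : i <= j -> om ^ i <= om ^ j.
Proof. by move=> ij; rewrite ler_weXz2l // ltW. Qed.

Lemma om_shift (i : int) q : om ^ (i + (e * q)%N%:Z) = p%:R ^+ q * om ^ i.
Proof. by rewrite expfzDr // mulrC -ome -exprM. Qed.

Lemma om_arch (r : realalg) : exists M0 : nat, forall M, (M0 <= M)%N -> r < om ^ M%:Z.
Proof.
exists (e * Num.bound `|r|)%N => M hM; apply: le_lt_trans (ler_norm r) _.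
apply: lt_le_trans (archi_boundP (normr_ge0 r)) _.
apply: le_trans (om_le (_ : (e * Num.bound `|r|)%N%:Z <= M%:Z)) => //.
rewrite -[(e * _)%N%:Z]add0r om_shift expr0z mulr1 -natrX ler_nat.
exact/ltnW/ltn_expl/prime_gt1.
Qed.

Local Notation T := (@T k V p).
Local Notation w := (@wval k V wb).
Local Notation R := (gring k (gring rat V)).
Local Notation near := (near w).
Let sv : semival w := wval_semival k wb.

(** The list l approximates c to the precision M, with denominator p^m. *)
Definition coord (M : int) (m : nat) (c : V) (l : seq V) :=
  (forall b, b \in l -> B b) /\ fil (M + (e * m)%N%:Z) (c *+ p ^ m - \sum_(b <- l) b).

Lemma coord_ex c : exists m0, forall m, (m0 <= m)%N -> fil 0 (c *+ p ^ m) /\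
  forall M : nat, exists l, coord M m c l.
Proof.
have [j jc] := pf_ex pf c; exists `|j|%N => m jm.
have c0 : fil 0%N%:Z (c *+ p ^ m).
  apply: (@fil_le _ (j + (e * m)%N%:Z)); last exact/filX.
  by have := leq_pmull m e_gt0; lia.
split=> // M.
have [l [lB _ _ lf]] := approximation pf Bo Bs c0 (leq0n (M + e * m)).
by exists l; split=> //; rewrite -PoszD.
Qed.

Lemma coord_le M M' m c l : M' <= M -> coord M m c l -> coord M' m c l.
Proof. by move=> h [lB lf]; split=> //; apply: fil_le lf; rewrite lerD2r. Qed.

Lemma coord_raise M m c l d : coord M m c l ->
  coord M (m + d) c (flatten (nseq (p ^ d) l)).
Proof.
move=> [lB lf]; split.
  by move=> b /flattenP[x]; rewrite mem_nseq => /andP[_ /eqP ->] /lB.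
rewrite big_flatten big_nseq iter_addr_0 expnD mulrnA -mulrnBl mulnDr PoszD addrA.
exact/filX.
Qed.

Lemma coord_cat M m c l c' l' : coord M m c l -> coord M m c' l' ->
  coord M m (c + c') (l ++ l').
Proof.
move=> [lB lf] [lB' lf']; split.
  by move=> b; rewrite mem_cat => /orP[/lB|/lB'].
by rewrite big_cat mulrnDl opprD addrACA; apply: filD.
Qed.

Lemma coord_near M m c l c' l' : coord M m c l -> coord M m c' l' -> fil M (c - c') ->
  near (om ^ M) (T m l) (T m l').
Proof.
move=> [lB lf] [lB' lf'] cc'.
have ll' : fil (M + (e * m)%N%:Z) (\sum_(b <- l) b - \sum_(b <- l') b).
  have h : fil (M + (e * m)%N%:Z) (c *+ p ^ m - c' *+ p ^ m).
    by rewrite -mulrnBl; apply/filX.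
  have -> : \sum_(b <- l) b - \sum_(b <- l') b = (c' *+ p ^ m - \sum_(b <- l') b)
      - (c *+ p ^ m - \sum_(b <- l) b) + (c *+ p ^ m - c' *+ p ^ m).
    set a := c *+ _; set a' := c' *+ _; set x := \sum_(_ <- _) _; set y := \sum_(_ <- _) _.
    by rewrite opprB [_ - y + _]addrC -addrA [_ - y + _]addrC !subrKA.
  by apply: filD => //; apply: filB.
have omM : om ^ M = (p%:R ^+ m)^-1 * om ^ (M + (e * m)%N%:Z).
  by rewrite om_shift mulKf // -natrX pnatr_eq0 -lt0n expn_gt0 prime_gt0.
apply: T_near => // b lb; have Bb : B b by case: lb => [/lB|/lB'].
have [d de lE] := B_lev Bo Bb.
case: (lerP 0 (M + (e * m)%N%:Z)) => h; last first.
  exists 0%N; first by rewrite expn0 dvd1z.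
  rewrite mul1r omM ler_pM2l ?invr_gt0 ?exprn_gt0 ?ltr0n ?prime_gt0 //.
  by apply: om_le; rewrite lE; lia.
have [J JE] : exists J : nat, M + (e * m)%N%:Z = J by case: (M + _) h => // J _; exists J.
rewrite JE in ll' omM; exists (digits e lev J b).
  exact: (digits_uniq pf levP Bo lB lB' ll').
rewrite mulrCA omM ler_pM2l ?invr_gt0 ?exprn_gt0 ?ltr0n ?prime_gt0 //.
rewrite -om_shift; apply: om_le; have := digits_ge pf Bo J Bb.
by rewrite lE; lia.
Qed.

Lemma coord_near2 M m c l m' c' l' : coord M m c l -> coord M m' c' l' -> fil M (c - c') ->
  near (om ^ M) (T m l) (T m' l').
Proof.
move=> h h' cc'; rewrite -(T_raise p_pr pk m m') -(T_raise p_pr pk m' m) [(m' + m)%N]addnC.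
apply: coord_near cc'; first exact: coord_raise.
by rewrite addnC; apply: coord_raise.
Qed.

Lemma coords_exist : exists cd : nat -> V -> nat * seq V, forall (M : nat) c,
  coord M (cd M c).1 c (cd M c).2.
Proof.
suff /boolp.choice[cd cdP] : forall x : nat * V, exists y : nat * seq V,
    coord x.1 y.1 x.2 y.2.
  by exists (fun M c => cd (M, c)) => M c; apply: (cdP (M, c)).
move=> [M c]; have [m0 /(_ m0 (leqnn _))[_ /(_ M)[l h]]] := coord_ex c.
by exists (m0, l).
Qed.

Section Approximants.
Variable cd : nat -> V -> nat * seq V.
Hypothesis cdP : forall (M : nat) c, coord M (cd M c).1 c (cd M c).2.
Local Notation A := (gring k V).
Implicit Types f g : A.

(** Approximate images of T_c, and of an element of the group ring. *)
Definition Tc M c : R := T (cd M c).1 (cd M c).2.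
Definition approx M f : R := glift (fun c a => gU 0 a * Tc M c) f.

Lemma Tc_near (M : nat) (J : int) m c c' l : J <= M -> coord J m c' l -> fil J (c - c') ->
  near (om ^ J) (Tc M c) (T m l).
Proof. by move=> JM h cc'; apply: coord_near2 h cc'; apply: coord_le (cdP M c). Qed.

Lemma Tc_near_le (M M' : nat) (J : int) c c' : J <= M -> J <= M' -> fil J (c - c') ->
  near (om ^ J) (Tc M c) (Tc M' c').
Proof. by move=> h h' cc'; apply: Tc_near h _ cc'; apply: coord_le (cdP M' c'). Qed.

Lemma fil_self J c : fil J (c - c).
Proof. by rewrite subrr; apply: fil0 pf J. Qed.

Lemma Tc_ge0 M c : ole (Some 0) (w (Tc M c)).
Proof. exact: T_ge0. Qed.

Lemma TcD (M : nat) c c' : near (om ^ M) (Tc M (c + c')) (Tc M c * Tc M c').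
Proof.
rewrite {2 3}/Tc -(T_raise p_pr pk (cd M c).1 (cd M c').1).
rewrite -(T_raise p_pr pk (cd M c').1 (cd M c).1) [((cd M c').1 + _)%N]addnC -T_cat.
apply: (Tc_near _ _ (fil_self _ (c + c'))) => //; apply: coord_cat.
  exact/coord_raise/cdP.
by rewrite addnC; apply/coord_raise/cdP.
Qed.

Lemma Tc1 (M : nat) (J : int) c : J <= M -> fil J c -> near (om ^ J) (Tc M c) 1.
Proof.
move=> JM Jc; have -> : 1 = T 0 [::] by rewrite /T big_nil.
apply: (Tc_near JM (c' := 0)); last by rewrite subr0.
by split=> //; rewrite big_nil mul0rn subr0; apply: fil0 pf _.
Qed.

Let approxDc M c : {morph (fun a : k => (gU 0 a : R) * Tc M c) : x y / x + y}.
Proof. by move=> x y; rewrite gUD mulrDl. Qed.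

Lemma approxD M : {morph approx M : f g / f + g}.
Proof. exact: (gliftD (approxDc M)). Qed.

Lemma approxU M c a : approx M (gU c a) = gU 0 a * Tc M c.
Proof. exact: (gliftU (approxDc M)). Qed.

Lemma const_ge0 a : ole (Some 0) (w (gU 0 a : R)).
Proof.
rewrite wvalU; case: eqP => //= _.
by rewrite (morphD0 (expo_weightD wb)) lexx.
Qed.

Lemma approx_ge0 M f : ole (Some 0) (w (approx M f)).
Proof.
apply: (sv_sum_ge sv) => // c _; rewrite (svM sv) -[Some 0]oadd0.
by apply: ole_oadd; [apply: const_ge0 | apply: Tc_ge0].
Qed.

Lemma approxM (M : nat) f g : near (om ^ M) (approx M (f * g)) (approx M f * approx M g).
Proof.
elim/gring_ind: f g => [|c a f IH] g.
  by rewrite mul0r (morphD0 (approxD M)) mul0r; apply: (near_refl sv).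
rewrite mulrDl !approxD mulrDl; apply: (nearD sv); last exact: IH.
elim/gring_ind: g => [|d b g IHg].
  by rewrite mulr0 (morphD0 (approxD M)) mulr0; apply: (near_refl sv).
rewrite [in approx M _]mulrDr (approxD M (gU c a * gU d b)) (approxD M (gU d b)) mulrDr.
apply: (nearD sv); last exact: IHg.
have -> : approx M (gU c a) * approx M (gU d b) = gU 0 (a * b) * (Tc M c * Tc M d).
  rewrite !approxU mulrACA; congr (_ * _).
  rewrite (gUM (0 : gring rat V) 0 a b) (addr0 (0 : gring rat V)); reflexivity.
have -> : approx M (gU c a * gU d b) = gU 0 (a * b) * Tc M (c + d).
  by rewrite -approxU; congr (approx M _); apply: gUM.
apply: (nearM sv).
- exact: const_ge0.
- by rewrite (svM sv) -[Some 0]oadd0; apply: ole_oadd; apply: Tc_ge0.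
- exact: (near_refl sv).
- exact: TcD.
Qed.

Lemma approx_near (M M' : nat) (J : int) f : J <= M -> J <= M' -> near (om ^ J) (approx M f) (approx M' f).
Proof.
move=> h h'; apply: (near_sum sv) => c; apply: (nearM sv).
- exact: const_ge0.
- exact: Tc_ge0.
- exact: (near_refl sv).
- exact: Tc_near_le h h' (fil_self _ _).
Qed.

(** The coefficient of the monomial of an element c of the support of f with
    the longest expansion survives in all approximate images of f. *)
Lemma approx_neq0 f : f != 0 -> exists M : nat, olt (w (approx M f)) (Some (om ^ M%:Z)).
Proof.
move=> f0; pose s : seq V := gsupp f.
have [m mP] : exists m, forall c, c \in s -> fil 0 (c *+ p ^ m) /\
    forall M : nat, exists l, coord M m c l.
  suff [m0 h] : exists m0, forall c, c \in s -> forall m, (m0 <= m)%N ->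
      fil 0 (c *+ p ^ m) /\ forall M : nat, exists l, coord M m c l.
    by exists m0 => c cs; apply: h.
  elim: s => [|c s [m0 IH]]; first by exists 0%N.
  have [m1 h1] := coord_ex c; exists (maxn m0 m1) => d.
  rewrite inE => /orP[/eqP ->|ds] m; rewrite geq_max => /andP[h h'].
    exact: h1.
  exact: IH.
have [J0 J0P] : exists J0 : nat, forall c d, c \in s -> d \in s -> c != d ->
    ~ fil J0 ((c - d) *+ p ^ m).
  suff [J0 h] : exists J0 : nat, forall x, x \in [seq c - d | c <- s, d <- s] -> x != 0 ->
      ~ fil J0 (x *+ p ^ m).
    exists J0 => c d cs ds cd'; apply: h; last by rewrite subr_eq0.
    exact: allpairs_f.
  elim: [seq _ | _ <- _, _ <- _] => [|x r [J0 IH]]; first by exists 0%N.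
  have [->|x0] := eqVneq x 0.
    by exists J0 => y; rewrite inE => /orP[/eqP -> /eqP //|]; apply: IH.
  have xp0 : x *+ p ^ m != 0.
    by apply: contra x0 => /eqP h; apply/eqP; apply: (mulp_inj pf (q := m)); rewrite /= h mul0rn.
  have [j nj] := pf_sep pf xp0; exists (maxn J0 `|j|) => y.
  rewrite inE => /orP[/eqP -> _ h|yr y0 h].
    by apply: nj; apply: fil_le h; lia.
  by apply: (IH y yr y0); apply: fil_le h; lia.
have /boolp.choice[l0 l0P] : forall c, exists l : seq V, c \in s -> [/\ forall b, b \in l -> B b,
    forall b, B b -> (count_mem b l < p ^ digits e lev J0 b)%N &
    fil J0%:Z (c *+ p ^ m - \sum_(b <- l) b)].
  move=> c; case: (boolP (c \in s)) => cs; last by exists [::].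
  have [l [h1 _ h3 h4]] := approximation pf Bo Bs (mP c cs).1 (leq0n J0).
  by exists l.
have [c0 c0s] : exists c, c \in s.
  apply: contrapT => /forallNP h; case/eqP: f0; rewrite (gringE f) big_seq big1 // => c cf.
  by case: (h c).
have [c1 c1s c1max] : exists2 c1, c1 \in s & forall c, c \in s -> (size (l0 c) <= size (l0 c1))%N.
  elim: (s) c0 c0s => // c r IH c0 _.
  case: r IH => [|d r] IH.
    by exists c; [exact: mem_head | move=> d; rewrite inE => /eqP ->].
  have [c1 c1r c1m] := IH d (mem_head _ _).
  case: (leqP (size (l0 c)) (size (l0 c1))) => h.
    by exists c1; [rewrite inE c1r orbT | move=> x; rewrite inE => /orP[/eqP ->|/c1m]].
  exists c; first exact: mem_head.
  move=> x; rewrite inE => /orP[/eqP -> //|/c1m xc1]; exact: leq_trans xc1 (ltnW h).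
pose n1 := esum p m (l0 c1).
have [M0 M0P] := om_arch (expo_weight wb n1).
pose M := maxn M0 J0; have J0M : (J0 <= M + e * m)%N by rewrite /M; lia.
have /boolp.choice[l1 l1P] : forall c, exists l : seq V, c \in s -> [/\ forall b, b \in l -> B b,
    forall b, B b -> (p ^ digits e lev J0 b %| count_mem b l)%N &
    coord M m c (l0 c ++ l)].
  move=> c; case: (boolP (c \in s)) => cs; last by exists [::].
  have [h1 _ h3] := l0P c cs; have [l [h4 h5 _ h6]] := approximation pf Bo Bs h3 J0M.
  exists l => _; split=> //; split.
    by move=> b; rewrite mem_cat => /orP[/h1|/h4].
  by rewrite big_cat opprD addrA -PoszD.
exists M.
pose G : R := \sum_(c <- s) gU 0 (gcf c f) * T m (l0 c ++ l1 c).
have FG : near (om ^ M) (approx M f) G.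
  rewrite /approx /glift /G /near -sumrB big_seq; apply: (sv_sum_ge sv) => // c cs.
  apply: (nearM sv).
  - exact: const_ge0.
  - exact: T_ge0.
  - exact: (near_refl sv).
  - have [_ _ h] := l1P c cs; exact: Tc_near h (fil_self _ _).
have cG : gcf n1 G = gcf c1 f.
  rewrite /G (morphD_sum (gcfD n1)) (bigD1_seq c1) ?fset_uniq //= big_seq_cond big1 => [|c].
    rewrite addr0 gcfUM subr0 T_cat.
    have [h1 h2 h3] := l0P c1 c1s; have [h4 h5 h6] := l1P c1 c1s.
    by rewrite (T_tail p_pr pk m h1 h4 h5 h2) T_top // perm_refl mulr1.
  move=> /andP[cs cc1]; rewrite gcfUM subr0 T_cat.
  have [h1 h2 h3] := l0P c cs; have [h4 h5 h6] := l1P c cs; have [k1 k2 k3] := l0P c1 c1s.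
  rewrite (T_tail p_pr pk m h1 h4 h5 k2) T_top ?c1max //.
  case: (boolP (perm_eq _ _)) => [/(perm_big _)|]; last by rewrite mulr0.
  move=> /(_ _ _ _ xpredT id) /= E; case: (J0P c c1 cs c1s cc1).
  have -> : (c - c1) *+ p ^ m =
      (c *+ p ^ m - \sum_(b <- l0 c) b) - (c1 *+ p ^ m - \sum_(b <- l0 c1) b).
    by rewrite E opprB subrKA mulrnBl.
  exact: filB.
rewrite oltNge; apply/negP => h; have := near_ge sv FG h.
have : gcf n1 G != 0 by rewrite cG -gsuppE.
move=> /(wval_le wb) /(ole_trans _) W /W /=.
by rewrite leNgt M0P ?leq_maxl.
Qed.

End Approximants.
End Coordinates.

Section Place.
Variables (k : fieldType) (V : zmodType) (fil : int -> V -> Prop) (p e : nat).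
Hypotheses (pf : p_filtration fil p e) (pk : p%:R = 0 :> k).
Let p_pr := pf_prime pf.
Let e_gt0 := pf_gt0 pf.
Let filB := pfB pf.
Let fil_le := pf_le pf.
Variables (lev : V -> int) (B : set V).
Hypothesis levP : forall x, x != 0 -> fil (lev x) x /\ ~ fil (lev x + 1) x.
Hypotheses (Bo : orthogonal fil p e lev B) (Bs : spanning fil p e lev B).
Variable om : realalg.
Hypotheses (om1 : 1 < om) (ome : om ^+ e = p%:R).
Let filX := filX pf.
Let filD := filD pf.
Let om0 : om != 0. Proof. by rewrite gt_eqF // (lt_trans ltr01). Qed.
Let wb (b : V) : realalg := om ^ lev b.
Let om_gt0 (i : int) : 0 < om ^ i.
Proof. by rewrite exprz_gt0 // (lt_trans ltr01). Qed.
Variable cd : nat -> V -> nat * seq V.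
Hypothesis cdP : forall (M : nat) c, coord fil p e B M (cd M c).1 c (cd M c).2.
Local Notation T := (@T k V p).
Local Notation w := (@wval k V wb).
Local Notation R := (gring k (gring rat V)).
Local Notation A := (gring k V).
Local Notation Fa := (@approx k V p cd).
Local Notation near := (near w).
Let sv : semival w := wval_semival k wb.
Implicit Types f g : A.

Section Minimal.
Variable u : A -> option realalg.
Hypothesis svu : semival u.
Hypothesis u_const : forall a, ole (Some 0) (u (gU 0 a)).
Hypothesis u_fil : forall c j, fil j c -> ole (Some (om ^ j)) (u (gU c 1 - 1)).

Lemma expand_prod m (dv : V -> V) l : exists L : seq (seq V),
  T m l = \sum_(l' <- L) gU (esum p m l') 1 /\
  gU (\sum_(b <- l) dv b) 1 = \sum_(l' <- L) \prod_(b <- l') (gU (dv b) 1 - 1) :> A.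
Proof.
elim: l => [|b l [L [TL gL]]].
  exists [:: [::]]; rewrite !big_seq1 /T /esum !big_nil; split; reflexivity.
exists (L ++ [seq b :: l' | l' <- L]); rewrite !big_cat !big_map; split.
  rewrite T_cons TL; congr (_ + _); rewrite mulr_sumr; apply: eq_bigr => l' _.
  by rewrite wvarE esum_cons gUM mulr1; reflexivity.
rewrite big_cons -[X in gU _ X](mulr1 1) -gUM gL.
under [X in _ = _ + X]eq_bigr do rewrite big_cons.
by rewrite -mulr_sumr -{2}[\sum_(l' <- L) _]mul1r -mulrDl addrC subrK; reflexivity.
Qed.

Lemma u_unit c : ole (Some 0) (u (gU c 1)).
Proof.
rewrite -(subrK 1 (gU c 1)); apply: (sv_geD svu).
  have [j jc] := pf_ex pf c; apply: ole_trans (u_fil jc).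
  by rewrite /= ltW.
by rewrite (sv1 svu) /= lexx.
Qed.

(** Substituting T_b - 1 for the variables recovers f from its approximate
    image up to a small error. *)
Lemma approx_minimal f (M : nat) r : r <= om ^ M -> ole (Some r) (w (Fa M f)) -> ole (Some r) (u f).
Proof.
move=> rM rw; pose s : seq V := gsupp f.
have [m mP] : exists m, forall c, c \in s -> ((cd M c).1 <= m)%N.
  exists (\max_(c <- s) (cd M c).1) => c cs; rewrite (big_rem c cs) /=; exact: leq_maxl.
pose l c := flatten (nseq (p ^ (m - (cd M c).1)) (cd M c).2).
have lT c : c \in s -> Tc k p cd M c = T m (l c).
  by move=> /mP cm; rewrite /Tc -(T_raise p_pr pk _ (m - (cd M c).1)) subnKC.
have lP c : c \in s -> coord fil p e B M m c (l c).
  move=> /mP cm; have := coord_raise pf (m - (cd M c).1) (cdP M c).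
  by rewrite subnKC.
have /boolp.choice[dv dvP] := pXdiv pf m.
pose Ql l' : A := \prod_(b <- l') (gU (dv b) 1 - 1).
have /boolp.choice[Q QP] : forall n, exists q, forall l', n = esum p m l' -> q = Ql l'.
  move=> n; have [[l0 ->]|no] := pselect (exists l', n = esum p m l'); last first.
    by exists 0 => l' nE; case: no; exists l'.
  by exists (Ql l0) => l' /(esum_perm p_pr)/(perm_big _) h; apply: h.
have Ea n : {morph (fun a : k => gU 0 a * Q n) : x y / x + y}.
  by move=> x y; rewrite gUD mulrDl.
pose Ev (x : R) : A := glift (fun n a => gU 0 a * Q n) x.
have EvD : {morph Ev : x y / x + y} by apply: (gliftD Ea).
have EvU n a : Ev (gU n a) = gU 0 a * Q n by apply: (gliftU Ea).
have EvT a l' : Ev (gU 0 a * T m l') = gU 0 a * gU (\sum_(b <- l') dv b) 1.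
  have [L [-> ->]] := expand_prod m dv l'.
  rewrite !mulr_sumr (morphD_sum EvD); apply: eq_bigr => l2 _.
  by rewrite gUM add0r mulr1 EvU (QP _ l2 erefl).
have EvF : Ev (Fa M f) = \sum_(c <- s) gU 0 (gcf c f) * gU (\sum_(b <- l c) dv b) 1.
  rewrite /approx /glift (morphD_sum EvD) [LHS]big_seq [RHS]big_seq.
  by apply: eq_bigr => c cs; rewrite lT // EvT.
have err : ole (Some r) (u (f - Ev (Fa M f))).
  rewrite EvF {1}(gringE f) -sumrB big_seq; apply: (sv_sum_ge svu) => // c cs.
  set d := \sum_(b <- l c) dv b.
  have -> : gU c (gcf c f) - gU 0 (gcf c f) * gU d 1 =
      gU 0 (gcf c f) * gU d 1 * (gU (c - d) 1 - 1).
    rewrite mulrBr mulr1 !gUM !add0r !mulr1 [d + _]addrC subrK; reflexivity.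
  rewrite !(svM svu) -[Some r]oadd0; apply: ole_oadd.
    by rewrite -[Some 0]oadd0; apply: ole_oadd; [apply: u_const | apply: u_unit].
  apply: ole_trans (_ : ole _ (Some (om ^ M))) _; first exact: rM.
  apply: u_fil; apply/(filX _ _ m); have [_ h] := lP c cs.
  rewrite mulrnBl /d -sumrMnl; congr (fil _ (_ - _)): h.
  by apply: eq_bigr => b _; rewrite dvP.
rewrite -(subrK (Ev (Fa M f)) f); apply: (sv_geD svu) => //.
rewrite /Ev /glift big_seq; apply: (sv_sum_ge svu) => // n.
rewrite gsuppE => nF.
have [l' [lB nE]] : exists l', (forall b, b \in l' -> B b) /\ n = esum p m l'.
  have [c cs h] : exists2 c, c \in s & gcf n (Tc k p cd M c) != 0.
    apply: contrapT => no; case/eqP: nF.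
    rewrite /approx /glift (morphD_sum (gcfD n)) big_seq big1 // => c cs.
    rewrite gcfUM subr0; apply/eqP; rewrite mulf_eq0; apply/orP; right.
    by apply: contraT => h; case: no; exists c.
  rewrite lT // in h; have [l' [s' ->]] := T_supp h; exists l'; split=> // b.
  by move=> /(mem_subseq s'); case: (lP c cs) => lB _ /lB.
have Qge : ole (Some (expo_weight wb n)) (u (Q n)).
  rewrite (QP n l' nE) nE; elim: l' lB {nE} => [|b l' IH] lB.
    rewrite /Ql /esum !big_nil (sv1 svu) (morphD0 (expo_weightD wb)) /= lexx; reflexivity.
  rewrite /Ql big_cons esum_cons expo_weightD (svM svu) -[Some (_ + _)]/(oadd (Some _) (Some _)).
  apply: ole_oadd; last by apply: IH => c cl; apply: lB; rewrite inE cl orbT.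
  have Bb : B b by apply: lB; rewrite mem_head.
  have -> : expo_weight wb (evar p m b) = om ^ (lev b - (e * m)%N%:Z).
    have pm0 : p%:R ^+ m != 0 :> realalg by rewrite -natrX pnatr_eq0 -lt0n expn_gt0 prime_gt0.
    rewrite evar_weight /wb -[in LHS](subrK (e * m)%N%:Z (lev b)).
    by rewrite (om_shift om1 ome) mulKf.
  apply: u_fil; apply/(filX _ _ m); rewrite subrK dvP.
  by apply: (levP _).1; case: (Bo.1 b Bb).
rewrite (svM svu) -[Some r]oadd0; apply: ole_oadd; first exact: u_const.
apply: ole_trans Qge; apply: ole_trans rw _; exact: wval_le.
Qed.
End Minimal.

Let P f r := exists M : nat, w (Fa M f) = Some r /\ r < om ^ M.

Let Fa_st f r (M M' : nat) : w (Fa M f) = Some r -> r < om ^ M -> (M <= M')%N ->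
  w (Fa M' f) = Some r.
Proof.
move=> h rM MM'; rewrite -h.
apply: (near_eq sv (r := om ^ M)); last by rewrite h.
by apply: (approx_near pf pk levP Bo om1 ome cdP); lia.
Qed.

Let arch := om_arch pf om1 ome.

(** The value of f is that of any of its approximate images that is precise
    enough to have a definite value. *)
Lemma limit_exists : exists u : A -> option realalg, semival u /\
  forall f, (u f = None <-> f = 0) /\
    exists M0 : nat, forall M, (M0 <= M)%N -> w (Fa M f) = u f /\
      forall r, u f = Some r -> r < om ^ M.
Proof.
have FaD := @approxD k V p cd.
have ex f : exists o, if o is Some r then P f r else f = 0.
  have [->|f0] := eqVneq f 0; first by exists None.
  have [M] := approx_neq0 pf pk levP Bo Bs om1 ome cdP f0.
  by case E: (w (Fa M f)) => [r|] // rM; exists (Some r), M.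
case/boolp.choice: ex => u uP.
have u0 f : u f = None <-> f = 0.
  have := uP f; case: (u f) => [r|] // [M [h _]]; split=> // f0.
  by move: h; rewrite f0 (morphD0 (FaD M)) (sv0 sv).
have uS f : exists M0 : nat, forall M, (M0 <= M)%N -> w (Fa M f) = u f /\
      forall r, u f = Some r -> r < om ^ M.
  have := uP f; case E: (u f) => [r|] h.
    have [M0 [h1 h2]] := h; exists M0 => M MM; split; first exact: Fa_st h1 h2 MM.
    by move=> _ [<-]; apply: lt_le_trans h2 _; apply: (om_le om1).
  by exists 0%N => M _; rewrite h (morphD0 (FaD M)) (sv0 sv).
exists u; split=> //; split.
- exact/u0.
- have [M0 /(_ M0 (leqnn _)) [<- _]] := uS 1.
  have h : near (om ^ 0%:Z) (Fa M0 1) 1.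
    rewrite g1E (approxU p cd); have -> : 1 = gU 0 1 * 1 :> R by rewrite mulr1.
    apply: (nearM sv).
    + by rewrite (sv1 sv) /= lexx.
    + by rewrite (sv1 sv) /= lexx.
    + exact: (near_refl sv).
    + by apply: (Tc1 pf pk levP Bo om1 ome cdP); [lia | apply: fil0 pf _].
  move: h; rewrite expr0z => h; have n1 : (0 : realalg) < 1 by rewrite ltr01.
  rewrite -(sv1 sv); apply: (near_eq sv (near_sym sv h)).
  by rewrite (sv1 sv).
- move=> f g.
  have [->|f0] := eqVneq f 0; first by rewrite mul0r (u0 0).2.
  have [->|g0] := eqVneq g 0; first by rewrite mulr0 (u0 0).2 //; case: (u f).
  have [M1 h1] := uS f; have [M2 h2] := uS g; have [M3 h3] := uS (f * g).
  case Ef: (u f) => [r|]; last by move/u0: Ef f0 => ->; rewrite eqxx.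
  case Eg: (u g) => [r'|]; last by move/u0: Eg g0 => ->; rewrite eqxx.
  have [M4 h4] := arch (r + r').
  pose M := (M1 + M2 + M3 + M4)%N.
  have [|<- _] := h3 M; first by rewrite /M; lia.
  have E : w (Fa M f * Fa M g) = Some (r + r').
    have [|e1 _] := h1 M; first by rewrite /M; lia.
    have [|e2 _] := h2 M; first by rewrite /M; lia.
    have E0 := svM sv (Fa M f) (Fa M g).
    move: (etrans e1 Ef) (etrans e2 Eg) => {}e1 {}e2.
    exact (etrans E0 (f_equal2 (@oadd realalg) e1 e2)).
  rewrite -[Some (r + r')]/(oadd (Some r) (Some r')) in E *.
  transitivity (w (Fa M f * Fa M g)); last by rewrite E.
  apply: (near_eq sv (r := om ^ M)).
    by apply: (near_sym sv); apply: (approxM pf pk levP Bo om1 ome cdP).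
  by rewrite E /=; apply: h4; rewrite /M; lia.
- move=> f g.
  have [M1 h1] := uS f; have [M2 h2] := uS g; have [M3 h3] := uS (f + g).
  pose M := (M1 + M2 + M3)%N.
  have [|<- _] := h3 M; first by rewrite /M; lia.
  have [|<- _] := h1 M; first by rewrite /M; lia.
  have [|<- _] := h2 M; first by rewrite /M; lia.
  rewrite (FaD M f g); exact: (svD sv).
Qed.

End Place.

Section CharPPlace.
Variables (k : fieldType) (V : zmodType) (fil : int -> V -> Prop) (p e : nat).
Hypotheses (pf : p_filtration fil p e) (pk : p%:R = 0 :> k).
Variables (t t' : {rmorphism k -> k}) (sV sV' : V -> V) (s : int).
Hypotheses (tK : cancel t t') (t'K : cancel t' t).
Hypotheses (sVD : {morph sV : x y / x + y}) (sVK : cancel sV sV') (sV'K : cancel sV' sV).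
Hypothesis sV_fil : forall j x, fil (j + s) (sV x) <-> fil j x.

Let sV'D : {morph sV' : x y / x + y}.
Proof. by move=> x y; apply: (can_inj sVK); rewrite sVD !sV'K. Qed.

(** A valuation that grows at the rate om^j on the j-th step of the filtration
    and is least with this property is multiplied by om^s under sigma. *)
Lemma charp_place_exists : has_place t sV.
Proof.
have p1 := prime_gt1 (pf_prime pf).
have [om om1 ome] := realalg_root p1 (pf_gt0 pf).
have [lev levP] := lev_exists pf.
have [B [Bo Bs]] := orthogonal_basis_exists pf levP.
have [cd cdP] := coords_exist pf Bo Bs om1.
have [u [svu uS]] := limit_exists pf pk levP Bo Bs om1 ome cdP.
set wb := fun b : V => om ^ lev b; have svw := wval_semival k wb.
have om_gt0 (i : int) : 0 < om ^ i by rewrite exprz_gt0 // (lt_trans ltr01).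
have FaD := @approxD k V p cd; have FaU := @approxU k V p cd.
have u_const a : a != 0 -> u (gU 0 a) = Some 0.
  move=> a0; have [_ [M0 /(_ M0 (leqnn _)) [<- _]]] := uS (gU 0 a); rewrite FaU.
  have h : near (wval wb) (om ^ 0%:Z) (Tc k p cd M0 0) 1.
    by apply: (Tc1 pf pk levP Bo om1 ome cdP); [lia | apply: fil0 pf _].
  have -> : wval wb (gU 0 a * Tc k p cd M0 0) =
      oadd (wval wb (gU 0 a)) (wval wb (Tc k p cd M0 0)) by apply: (svM svw).
  have -> : wval wb (Tc k p cd M0 0) = Some 0.
    rewrite -(sv1 svw); apply: (near_eq svw (near_sym svw h)).
    by rewrite (sv1 svw) expr0z /= ltr01.
  by rewrite wvalU (negbTE a0) (morphD0 (expo_weightD wb)) /= addr0.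
have u_const0 a : ole (Some 0) (u (gU 0 a)).
  have [->|/u_const ->] := eqVneq a 0; last exact: ole_refl.
  by rewrite gU0 (sv0 svu).
have u_fil c j : fil j c -> ole (Some (om ^ j)) (u (gU c 1 - 1)).
  move=> jc; have [_ [M0 h0]] := uS (gU c 1 - 1); pose M := (M0 + `|j|)%N.
  have [|<- _] := h0 M; first by rewrite /M; lia.
  have FaT d : approx p cd M (gU d 1) = Tc k p cd M d.
    by rewrite FaU; apply: (mul1r (Tc k p cd M d)).
  rewrite (morphDB (FaD M)) g1E !FaT.
  apply: (Tc_near_le pf pk levP Bo om1 ome cdP); rewrite ?subr0 // /M; lia.
have u1 c : olt (Some 0) (u (gU c 1 - 1)).
  by have [j jc] := pf_ex pf c; apply: olt_le_trans (u_fil c j jc); apply: om_gt0.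
have least (u' : gring k V -> option realalg) : semival u' ->
    (forall a, ole (Some 0) (u' (gU 0 a))) ->
    (forall c j, fil j c -> ole (Some (om ^ j)) (u' (gU c 1 - 1))) ->
    forall f, ole (u f) (u' f).
  move=> svu' c' f' f; case E: (u f) => [r|]; last first.
    by move/(uS f).1: E => ->; rewrite (sv0 svu').
  have [M0 /(_ M0 (leqnn _)) [h1 h2]] := (uS f).2.
  apply: (approx_minimal pf pk levP Bo om1 ome cdP svu' c' f' (M := M0)).
    exact/ltW/h2.
  by rewrite h1 E; apply: ole_refl.
pose scale (c : realalg) : option realalg -> option realalg := omap (fun x => c * x).
have scale_sv (c : realalg) (F : {rmorphism gring k V -> gring k V}) : 0 < c ->
    semival (fun f => scale c (u (F f))).
  move=> c0; split.
  - by rewrite rmorph0 (sv0 svu).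
  - by rewrite rmorph1 (sv1 svu) /= mulr0.
  - move=> f g; rewrite rmorphM (svM svu).
    by case: (u (F f)) (u (F g)) => [x|] [y|] //=; rewrite mulrDr.
  - move=> f g; rewrite rmorphD; have := svD svu (F f) (F g); rewrite /omin.
    case: (u (F f)) (u (F g)) (u (F f + F g)) => [x|] [y|] [z|] //=.
    + rewrite (ler_pM2l c0); case: ifP => _ /=; by rewrite (ler_pM2l c0).
    + by rewrite (ler_pM2l c0).
    + by rewrite (ler_pM2l c0).
have [F FE] := rmorphismP (gmapD t sV) (gmapM t sVD) (gmap1 t sVD).
have [F' F'E] := rmorphismP (gmapD t' sV') (gmapM t' sV'D) (gmap1 t' sV'D).
have FF' f : F (F' f) = f.
  apply: (gring_ext (F := fun f => F (F' f)) (F' := id)) f => [x y|//|c a].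
    by rewrite !rmorphD.
  by rewrite F'E gmapU FE gmapU t'K sV'K.
have rho0 : (0 : realalg) < om ^ s by apply: om_gt0.
have omD i j : om ^ (i + j) = om ^ i * om ^ j.
  by rewrite expfzDr // gt_eqF // (lt_trans ltr01).
have le1 f : ole (u f) (scale (om ^ (- s)) (u (F f))).
  apply: (least (fun f => scale (om ^ (- s)) (u (F f)))) => [|a|c j jc].
  - exact: scale_sv.
  - rewrite FE gmapU (morphD0 sVD).
    by have := u_const0 (t a); case: (u _) => //= x x0; rewrite mulr_ge0 // ltW.
  - rewrite rmorphB rmorph1 FE gmapU rmorph1.
    have := u_fil (sV c) (j + s); case: (u _) => //= x /(_ ((sV_fil j c).2 jc)) h.
    by rewrite -(ler_pM2l rho0) mulrA -!omD subrr expr0z mul1r addrC.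
have le2 f : ole (u f) (scale (om ^ s) (u (F' f))).
  apply: (least (fun f => scale (om ^ s) (u (F' f)))) => [|a|c j jc].
  - exact: scale_sv.
  - rewrite F'E gmapU (morphD0 sV'D).
    by have := u_const0 (t' a); case: (u _) => //= x x0; rewrite mulr_ge0 // ltW.
  - rewrite rmorphB rmorph1 F'E gmapU rmorph1.
    have hf : fil (j - s) (sV' c) by apply/sV_fil; rewrite subrK sV'K.
    have := u_fil (sV' c) (j - s) hf; case: (u _) => //= x h.
    rewrite -(ler_pM2l (om_gt0 (- s))) mulrA -!omD addNr expr0z mul1r addrC.
    exact: h.
exists realalg, u, (fun x => om ^ s * x); split=> //.
- by move=> f; move/(uS f).1.
- by move=> c; rewrite -(subrK 1 (gU c 1)) addrC (sv_eqD svu) (sv1 svu).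
- move=> f; rewrite -FE; apply: ole_anti.
    apply: ole_trans (le2 (F f)) _.
    have -> : F' (F f) = f.
      apply: (gring_ext (F := fun f => F' (F f)) (F' := id)) f => [x y|//|c a].
        by rewrite !rmorphD.
      by rewrite FE gmapU F'E gmapU tK sVK.
    exact: ole_refl.
  have := le1 f; case: (u f) (u (F f)) => [x|] [y|] //=.
  by rewrite -(ler_pM2l rho0) mulrA -omD subrr expr0z mul1r.
- by move=> x y; rewrite mulrDr.
- by move=> x y; rewrite (ler_pM2l rho0).
Qed.
End CharPPlace.

Lemma has_place_sub (k : fieldType) (C V : zmodType) (t : {rmorphism k -> k})
    (sC : C -> C) (sV : V -> V) (i : C -> V) :
  {morph i : x y / x + y} -> injective i -> (forall c, i (sC c) = sV (i c)) ->
  has_place t sV -> has_place t sC.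
Proof.
move=> iD iinj is_ [D [u [sD [svu u0 uc uT uT1 us sDD sDe]]]].
pose I : {rmorphism k -> k} := idfun.
have [F FE] := rmorphismP (gmapD I i) (gmapM I iD) (gmap1 I iD).
exists D, (fun x => u (F x)), sD; split=> //.
- split=> /= [||x y|x y].
  + by rewrite rmorph0 (sv0 svu).
  + by rewrite rmorph1 (sv1 svu).
  + by rewrite rmorphM (svM svu).
  + by rewrite rmorphD (svD svu).
- move=> f /u0; rewrite FE => h; apply: gringP => c; rewrite gcf0.
  by have := congr1 (gcf (i c)) h; rewrite gcf_gmap // gcf0.
- by move=> a a0; rewrite FE gmapU (morphD0 iD) uc.
- by move=> c; rewrite FE gmapU uT.
- by move=> c; rewrite rmorphB rmorph1 FE gmapU uT1.
- move=> f; rewrite -us; congr (u _); rewrite !FE.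
  apply: (gring_ext (F := fun f => gmap I i (gmap t sC f))
    (F' := fun f => gmap t sV (gmap I i f))) f => [x y|x y|c a].
  + by rewrite !gmapD.
  + by rewrite !gmapD.
  + by rewrite !gmapU is_.
Qed.

(** * Norms on cyclic modules over the rational Laurent polynomials *)

Lemma int_total : total (<=%R : rel int).
Proof. exact: le_total. Qed.

Lemma int_leD2l (x y z : int) : y <= z -> x + y <= x + z.
Proof. by rewrite lerD2l. Qed.

HB.instance Definition _ := isOrderedAbelian.Build int int_total int_leD2l.

Lemma omin_le1 (G : oagType) (a b : option G) : ole (omin a b) a.
Proof. by have := ole_refl (omin a b); rewrite ole_min => /andP[]. Qed.

Lemma omin_le2 (G : oagType) (a b : option G) : ole (omin a b) b.
Proof. by have := ole_refl (omin a b); rewrite ole_min => /andP[]. Qed.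

Lemma seq_argmax (T : eqType) d (O : orderType d) (r : T -> O) (s : seq T) x : x \in s ->
  exists2 j, j \in s & forall i, i \in s -> (r i <= r j)%O.
Proof.
elim: s x => // a s IH x _; case: s IH => [|b s] IH.
  by exists a; [exact: mem_head | move=> i; rewrite inE => /eqP ->].
have [j js jm] := IH b (mem_head _ _).
case: (leP (r a) (r j)) => [aj|/ltW ja].
  by exists j; [rewrite inE js orbT | move=> i; rewrite inE => /orP[/eqP ->|/jm]].
exists a; first exact: mem_head.
by move=> i; rewrite inE => /orP[/eqP -> //|/jm ij]; apply: le_trans ij ja.
Qed.

Section PadicValuation.
Variable p : nat.
Hypothesis p_pr : prime p.

Let lg (a : int) : int := (logn p `|a|)%:Z.

Definition padic (x : rat) : option int :=
  if x == 0 then None else Some (lg (numq x) - lg (denq x)).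

Let lgM a b : a != 0 -> b != 0 -> lg (a * b) = lg a + lg b.
Proof. by move=> a0 b0; rewrite /lg abszM lognM ?absz_gt0. Qed.

Lemma padic_frac a b : a != 0 -> b != 0 -> padic (a%:~R / b%:~R) = Some (lg a - lg b).
Proof.
move=> a0 b0; set x := _ / _.
have x0 : x != 0 by rewrite mulf_neq0 ?invr_eq0 ?intr_eq0.
rewrite /padic (negbTE x0); congr Some.
have E : numq x * b = a * denq x.
  apply: (@intr_inj rat); rewrite !rmorphM /=.
  have bb : b%:~R != 0 :> rat by rewrite intr_eq0.
  by rewrite numqE /x mulrAC divfK.
have := congr1 lg E; rewrite !lgM ?numq_eq0 ?denq_neq0 // => h.
by apply/eqP; rewrite subr_eq addrAC eq_sym subr_eq h.
Qed.

Lemma padic_semival : semival padic.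
Proof.
have fr (x : rat) : x != 0 -> exists a b : int, [/\ a != 0, b != 0 & x = a%:~R / b%:~R].
  by move=> x0; exists (numq x), (denq x); rewrite numq_eq0 x0 denq_neq0 divq_num_den.
split.
- by rewrite /padic eqxx.
- have -> : 1 = 1%:~R / 1%:~R :> rat by rewrite divr1.
  by rewrite padic_frac // subrr.
- move=> x y; have [->|x0] := eqVneq x 0; first by rewrite mul0r /padic eqxx.
  have [->|y0] := eqVneq y 0; first by rewrite mulr0 /padic eqxx; case: ifP.
  have [a [b [a0 b0 ->]]] := fr _ x0; have [c [d [c0 d0 ->]]] := fr _ y0.
  have -> : a%:~R / b%:~R * (c%:~R / d%:~R) = (a * c)%:~R / (b * d)%:~R :> rat.
    by rewrite !rmorphM invfM mulrACA.
  rewrite !padic_frac ?mulf_neq0 // !lgM //=; congr Some.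
  by rewrite opprD addrACA.
- move=> x y; have [->|x0] := eqVneq x 0; first by rewrite add0r omin_le2.
  have [->|y0] := eqVneq y 0; first by rewrite addr0 omin_le1.
  have [xy0|xy0] := eqVneq (x + y) 0; first by rewrite [padic (x + y)]/padic xy0 eqxx.
  have [a [b [a0 b0 E1]]] := fr _ x0; have [c [d [c0 d0 E2]]] := fr _ y0.
  have bq : b%:~R != 0 :> rat by rewrite intr_eq0.
  have dq : d%:~R != 0 :> rat by rewrite intr_eq0.
  have E : x + y = (a * d + c * b)%:~R / (b * d)%:~R :> rat.
    by rewrite E1 E2 rmorphD !rmorphM addf_div.
  have s0 : a * d + c * b != 0.
    by apply: contra xy0 => /eqP h; rewrite E h mul0r.
  rewrite E padic_frac ?mulf_neq0 // E1 E2 !padic_frac // /omin /=.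
  have key m : m%:Z <= lg (a * d) -> m%:Z <= lg (c * b) -> m%:Z <= lg (a * d + c * b).
    rewrite /lg !lez_nat -!pfactor_dvdn ?absz_gt0 ?mulf_neq0 //.
    move=> h1 h2; suff : ((p ^ m)%N%:Z %| a * d + c * b)%Z by [].
    by apply: rpredD.
  have [m mE] : exists m : nat, Num.min (lg (a * d)) (lg (c * b)) = m%:Z.
    by rewrite /lg minEle; case: ifP => _; eexists.
  have := key m; rewrite -mE !ge_min !lexx orbT => /(_ isT isT).
  rewrite !lgM //; case: ifP => /= h /orP[] h'; rewrite ?mulf_neq0 //; lia.
Qed.

Lemma padic_p : padic p%:R = Some 1.
Proof.
have p0 : p%:Z != 0 by rewrite eqz_nat -lt0n prime_gt0.
have -> : p%:R = p%:Z%:~R / 1%:~R :> rat by rewrite divr1.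
rewrite padic_frac // /lg absz_nat absz1 logn1 subr0.
by rewrite -{2}[p]expn1 pfactorK.
Qed.
End PadicValuation.

Section GaussNorm.
Variables (p e : nat) (s : int).
Hypotheses (p_pr : prime p) (e_gt0 : (0 < e)%N).
Local Notation A := (gring rat int).
Implicit Types a b f h : A.

Definition coef_val (x : rat) : option int := omap (fun z => e%:Z * z) (padic p x).
Definition exp_weight (i : int) : int := s * i.
Definition gauss : A -> option int := wmin coef_val exp_weight.

Let e0 : 0 < e%:Z. Proof. by rewrite ltz_nat. Qed.

Lemma coef_val_semival : semival coef_val.
Proof.
have sv := padic_semival p_pr; rewrite /coef_val; split=> [||x y|x y].
- by rewrite (sv0 sv).
- by rewrite (sv1 sv) /= mulr0.
- by rewrite (svM sv); case: (padic p x) (padic p y) => [a|] [b|] //=; rewrite mulrDr.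
- have := svD sv x y; rewrite /omin.
  case: (padic p x) (padic p y) (padic p (x + y)) => [a|] [b|] [c|] //=;
    rewrite ?(ler_pM2l e0) //; by case: ifP => _ /=; rewrite (ler_pM2l e0).
Qed.

Lemma exp_weightD : {morph exp_weight : i j / i + j}.
Proof. by move=> i j; rewrite /exp_weight mulrDr. Qed.

Lemma gauss_semival : semival gauss.
Proof.
apply: (wmin_semival coef_val_semival exp_weightD) => c n /eqP.
by rewrite mulrn_eq0 => /eqP.
Qed.

Lemma gaussU i x : x != 0 -> gauss (gU i x) = oadd (coef_val x) (Some (s * i)).
Proof.
by move=> x0; rewrite /gauss (wminU _ coef_val_semival) /wterm gcfUU.
Qed.

(** The least and the greatest index at which a product attains its norm are
    the sums of those of the factors. *)
Lemma gauss_one_add f h m i j : gauss f = Some m -> i != j ->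
  wterm coef_val exp_weight f i = Some m -> wterm coef_val exp_weight f j = Some m ->
  ~ ole (Some (1 : int)) (gauss (1 + f * h)).
Proof.
have sv := coef_val_semival; move=> fm ij fi fj fh1.
have Pc c : ole (Some (1 : int)) (wterm coef_val exp_weight (1 + f * h) c).
  by move: c; apply/(wmin_geP _ sv).
have wout c : c != 0 -> ole (Some (1 : int)) (wterm coef_val exp_weight (f * h) c).
  move=> c0; have := Pc c; rewrite /wterm gcfD g1E gcfU eq_sym (negbTE c0).
  by rewrite mulr0n add0r.
have w0 : wterm coef_val exp_weight (f * h) 0 = Some 0.
  have := Pc 0; rewrite /wterm gcfD g1E gcfU eqxx mulr1n.
  rewrite !(oaddC _ (Some (exp_weight 0))) /exp_weight mulr0 !oadd0 => h1.
  rewrite -[RHS](sv1 sv) -(svN sv 1); apply: (sv_eq sv).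
  by rewrite -opprD !(svN sv) (sv1 sv); apply: olt_le_trans h1.
have g0 : gauss (f * h) = Some 0.
  apply: ole_anti; first by rewrite -w0; apply: wmin_le sv _ _.
  apply/(wmin_geP _ sv) => c; have [->|/wout] := eqVneq c 0; first by rewrite w0 ole_refl.
  exact: ole_trans.
have := svM gauss_semival f h; rewrite g0 fm.
case hm: (gauss h) => [m'|] //= [mm'].
have key (P : int -> Prop) : P 0 -> (forall c d, P c -> P d -> P (c + d)) ->
    (forall c, P c \/ P (- c)) -> (forall c, P c -> P (- c) -> c = 0) ->
    exists c d, [/\ least_at coef_val exp_weight P f m c,
      least_at coef_val exp_weight P h m' d & c + d = 0].
  move=> P0 PD Pt Pa.
  have [c cl] := least_exists sv P0 PD Pt fm; have [d dl] := least_exists sv P0 PD Pt hm.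
  exists c, d; split=> //.
  have := wterm_least sv (e := fun _ _ => 1) (one_val sv exp_weightD) _ fm hm cl dl.
  rewrite -mul_tmul -mm' => E; apply/eqP/negPn/negP => /wout; rewrite E //.
  by move=> c' _ h1 h2; apply/eqP; rewrite -subr_eq0; apply/eqP; apply: Pa.
have [||||c [d [[fc cl] [hd dl] cd]]] := key (fun x => 0 <= x) => //.
- exact: addr_ge0.
- by move=> x; lia.
- by move=> x; lia.
have [||||c' [d' [[fc' cl'] [hd' dl'] cd']]] := key (fun x => x <= 0) => //.
- by move=> x y; lia.
- by move=> x; lia.
- by move=> x; lia.
have h1 := cl _ fi; have h2 := cl _ fj; have h3 := cl' _ fi; have h4 := cl' _ fj.
have h5 := dl _ hd'; have h6 := dl' _ hd; move/eqP: ij; lia.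
Qed.


End GaussNorm.

(** Norming a module by the best Gauss norm of a representative. *)
Lemma quotient_place (p e : nat) (s : int) (I : gring rat int -> Prop) :
  prime p -> (0 < e)%N ->
  I 0 -> (forall a b, I a -> I b -> I (a - b)) -> (forall a b, I b -> I (a * b)) ->
  (forall a, ~ I a -> exists j, forall h, I h -> ~ ole (Some j) (gauss p e s (a + h))) ->
  exists (V : zmodType) (pr : gring rat int -> V) (sV : V -> V),
    [/\ {morph pr : a b / a + b}, forall a, pr a = 0 <-> I a,
        forall a, sV (pr a) = pr (gU 1 1 * a) &
        forall (k : fieldType) (t t' : {rmorphism k -> k}),
          cancel t t' -> cancel t' t -> p%:R = 0 :> k -> has_place t sV].
Proof.
move=> p_pr e_gt0 I0 IB IM Isep.
have sv := gauss_semival s p_pr e_gt0.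
have [V [pr [prD prS prI]]] := quotient_group_exists IB I0.
have prN := morphDN prD; have prB := morphDB prD.
have prM a b c : pr b = pr c -> pr (a * b) = pr (a * c).
  move=> h; apply/eqP; rewrite -subr_eq0 -prB -mulrBr; apply/eqP/prI/IM/prI.
  by rewrite prB h subrr.
have /boolp.choice[rep repP] := prS.
pose mon (i : int) : gring rat int := gU i 1.
have monD i j : mon i * mon j = mon (i + j) by rewrite /mon gUM mulr1.
have mon0 : mon 0 = 1 by [].
pose act (i : int) (v : V) := pr (mon i * rep v).
have actE i a : act i (pr a) = pr (mon i * a) by apply: prM; rewrite repP.
have act2 i j v : act i (act j v) = act (i + j) v.
  by rewrite -(repP v) !actE mulrA monD.
have act0 v : act 0 v = v by rewrite /act mon0 mul1r repP.
pose fil (j : int) v := exists2 a, pr a = v & ole (Some j) (gauss p e s a).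
have gmon i a : gauss p e s (mon i * a) = oadd (Some (s * i)) (gauss p e s a).
  rewrite (svM sv) (gaussU s p_pr e_gt0) ?oner_eq0 //.
  by rewrite (sv1 (coef_val_semival p_pr e_gt0)) oadd0.
have filS (j i : int) v : fil j v -> fil (j + s * i) (act i v).
  move=> [a <- ja]; exists (mon i * a); first by rewrite actE.
  by rewrite gmon -[Some (j + _)]/(oadd (Some j) (Some (s * i))) oaddC ole_add2.
pose pc (x : rat) : gring rat int := gU 0 x.
have pq0 : p%:R != 0 :> rat by rewrite pnatr_eq0 -lt0n prime_gt0.
have pcM x a : x != 0 -> gauss p e s (pc x * a) = oadd (coef_val p e x) (gauss p e s a).
  by move=> x0; rewrite (svM sv) (gaussU s p_pr e_gt0) // mulr0 (oaddC _ (Some 0)) oadd0.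
have pcn a : a *+ p = pc p%:R * a.
  by rewrite -[in LHS](mul1r a) -mulrnAl g1E -(morphDMn (gUD 0)).
have vp : coef_val p e p%:R = Some e%:Z.
  by rewrite /coef_val padic_p //= mulr1.
have pcK a : pc p%:R^-1 * (pc p%:R * a) = a.
  by rewrite mulrA /pc gUM addr0 mulVf // -g1E mul1r.
have prMn a n : pr (a *+ n) = pr a *+ n := morphDMn prD n a.
have pdivV (v : V) : exists y, y *+ p = v.
  exists (pr (pc p%:R^-1 * rep v)); rewrite -prMn pcn -{2}(repP v); congr pr.
  by rewrite mulrCA pcK.
have pf : p_filtration fil p e.
  split=> //.
  - move=> j _ _ [a <- ja] [b <- jb]; exists (a - b); first exact: prB.
    exact: (sv_geB sv).
  - move=> i j v ij [a <- ja]; exists a => //; exact: (ole_trans (b := Some j)).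
  - move=> j v; split=> [[a av ja]|[a <- ja]]; last first.
      exists (pc p%:R * a); first by rewrite -pcn prMn.
      by rewrite pcM // vp -[Some (j + _)]/(oadd (Some j) (Some e%:Z)) oaddC ole_add2.
    exists (pc p%:R^-1 * a).
      rewrite -(repP v) -[RHS](congr1 pr (pcK _)); apply: prM.
      by rewrite -pcn prMn repP.
    rewrite -(ole_add2 e%:Z) -[X in oadd X (gauss _ _ _ _)]vp -pcM // mulrCA pcK.
    by move: ja; rewrite addrC.
  - move=> v; case E: (gauss p e s (rep v)) => [j|].
      by exists j, (rep v); rewrite ?repP // E ole_refl.
    by exists 0, (rep v); rewrite ?repP // E.
  - move=> v v0; have [|j jP] := Isep (rep v).
      by move/prI; rewrite repP => v00; rewrite v00 eqxx in v0.
    exists j => -[a av ja]; apply: (jP (a - rep v)); last by rewrite addrC subrK.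
    by apply/prI; rewrite prB repP av subrr.
exists V, pr, (act 1); split=> // k t t' tK t'K pk.
apply: (@charp_place_exists k V fil p e pf pk t t' (act 1) (act (-1)) s tK t'K).
- by move=> x y; rewrite -(repP x) -(repP y) -prD !actE mulrDr prD.
- by move=> v; rewrite act2 addNr act0.
- by move=> v; rewrite act2 subrr act0.
- move=> j v; split=> [/(filS _ (-1))|/(filS _ 1)]; last by rewrite mulr1.
  by rewrite act2 addNr act0 mulrN1 addrK.
Qed.

Section LaurentPolynomials.
Local Notation A := (gring rat int).

Lemma laurent_exists : exists L : {rmorphism {poly rat} -> A},
  [/\ forall q (i : nat), gcf i%:Z (L q) = q`_i,
      forall q (i : int), i < 0 -> gcf i (L q) = 0,
      forall c, L c%:P = gU 0 c & L 'X = gU 1 1].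
Proof.
have [||k0 k0E] := @rmorphismP rat A (gU 0) (gUD 0) _ _; last 1 first.
- have [L [LC LX]] : exists L : {rmorphism {poly rat} -> A},
      (forall c, L c%:P = gU 0 c) /\ L 'X = gU 1 1.
    exists (horner_morph (fun a => mulrC (gU 1 1) (k0 a))).
    split=> [c|]; last exact: horner_morphX.
    by rewrite -k0E; apply: horner_morphC.
  have E q : L q = \sum_(i < size q) gU i%:Z q`_i.
    rewrite -{1}(coefK q) poly_def rmorph_sum; apply: eq_bigr => i _.
    rewrite -mul_polyC rmorphM rmorphXn [X in X * _]LC [X in X ^+ _]LX.
    by rewrite gU_X expr1n gUM add0r mulr1 -mulr_natr mul1r natz.
  exists L; split=> // q i; rewrite ?E.
    rewrite (morphD_sum (gcfD _)); have [lt|ge] := ltnP i (size q); last first.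
      rewrite nth_default // big1 // => j _; rewrite gcfU eqz_nat; case: eqP => // ij.
      by move: ge; rewrite -ij leqNgt ltn_ord.
    rewrite (bigD1 (Ordinal lt)) //= gcfUU big1 ?addr0 // => j; rewrite -val_eqE /= => ji.
    by rewrite gcfU eqz_nat (negbTE ji) mulr0n.
  move=> i0; rewrite (morphD_sum (gcfD _)) big1 // => j _; rewrite gcfU.
  by case: eqP => // ji; move: i0; rewrite -ji.
- by move=> x y; rewrite gUM addr0.
- by rewrite g1E.
Qed.

Variable L : {rmorphism {poly rat} -> A}.
Hypotheses (Lcf : forall q (i : nat), gcf i%:Z (L q) = q`_i)
  (Lneg : forall q (i : int), i < 0 -> gcf i (L q) = 0)
  (LC : forall c, L c%:P = gU 0 c) (LX : L 'X = gU 1 1).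

Lemma laurent_mono (n : nat) : L 'X^n = gU n%:Z 1.
Proof. by rewrite rmorphXn LX gU_X expr1n -mulr_natr mul1r natz. Qed.

Lemma laurent_clear a : exists (n : nat) q, gU n%:Z 1 * a = L q.
Proof.
elim/gring_ind: a => [|i c a [n [q E]]]; first by exists 0%N, 0; rewrite mulr0 rmorph0.
pose m := (n + absz i)%N; exists m, (c%:P * 'X^(absz (m%:Z + i)) + 'X^(absz i) * q).
have -> : L (c%:P * 'X^(absz (m%:Z + i)) + 'X^(absz i) * q) =
    gU 0 c * gU (absz (m%:Z + i))%:Z 1 + gU (absz i)%:Z 1 * (gU n%:Z 1 * a).
  by rewrite E -LC -!laurent_mono (rmorphD L) !(rmorphM L).
have -> : gU m%:Z 1 * (gU i c + a) = gU m%:Z 1 * gU i c + gU m%:Z 1 * a by apply: mulrDr.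
have -> : gU m%:Z 1 * gU i c = gU 0 c * gU (absz (m%:Z + i))%:Z 1.
  rewrite (gUM m%:Z i) (gUM 0 (absz (m%:Z + i))%:Z) mul1r mulr1 add0r; congr (gU _ _).
  by rewrite gez0_abs /m //; lia.
congr (_ + _); rewrite mulrA (gUM (absz i)%:Z n%:Z) mulr1; congr (gU _ _ * _).
by rewrite /m PoszD addrC.
Qed.

Section Irreducible.
Variables (p : nat) (f : {poly rat}).
Hypotheses (p_pr : prime p) (f0 : f`_0 != 0) (f_irr : irreducible_poly f).

(** The last segment of the Newton polygon of f: with the index scaled by its
    slope, f attains its Gauss norm twice. *)
Lemma newton_slope : exists (e : nat) (s m : int) (j : nat), [/\ (0 < e)%N,
  (0 < j)%N, gauss p e s (L f) = Some m,
  wterm (coef_val p e) (exp_weight s) (L f) 0 = Some m &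
  wterm (coef_val p e) (exp_weight s) (L f) j%:Z = Some m].
Proof.
pose v i : int := odflt 0 (padic p f`_i).
have vE i : f`_i != 0 -> padic p f`_i = Some (v i).
  by rewrite /v /padic => /negbTE ->.
pose r i : rat := (v 0%N - v i)%:~R / i%:R.
pose J := [seq i <- iota 1 (size f).-1 | f`_i != 0].
have [sf _] := f_irr.
have fn0 : f != 0 by rewrite -size_poly_gt0 ltnW.
have JP i : i \in J <-> (0 < i)%N /\ f`_i != 0.
  rewrite mem_filter mem_iota add1n prednK; last exact: ltnW.
  split=> [/and3P[]//|[i0 fi]]; rewrite fi i0 /= ltnNge; apply: contra fi => h.
  by rewrite nth_default.
have [|j jJ jmax] := @seq_argmax _ _ rat r J (size f).-1.
  by apply/JP; rewrite -subn1 subn_gt0 sf subn1 -[f`__]/(lead_coef f) lead_coef_eq0.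
have [j0 fj] := (JP j).1 jJ.
exists j, (v 0%N - v j), (j%:Z * v 0%N), j.
have wtE i : wterm (coef_val p j) (exp_weight (v 0%N - v j)) (L f) i%:Z =
    if f`_i == 0 then None else Some (j%:Z * v i + (v 0%N - v j) * i%:Z).
  rewrite /wterm Lcf /coef_val; case: (eqVneq f`_i 0) => [->|fi]; first by rewrite /padic eqxx.
  by rewrite vE.
have w0 := wtE 0%N; rewrite (negbTE f0) mulr0 addr0 in w0.
have wj := wtE j; rewrite (negbTE fj) in wj.
have -> : j%:Z * v 0%N = j%:Z * v j + (v 0%N - v j) * j%:Z by rewrite mulrBl !(mulrC j%:Z) addrC subrK.
have E : j%:Z * v 0%N = j%:Z * v j + (v 0%N - v j) * j%:Z by rewrite mulrBl !(mulrC j%:Z) addrC subrK.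
split=> //; last by rewrite -E.
rewrite -E; apply: ole_anti; first by rewrite -w0; apply: wmin_le (coef_val_semival p_pr j0) _ _.
apply/(wmin_geP _ (coef_val_semival p_pr j0)) => -[i|i]; last first.
  by rewrite /wterm Lneg // /coef_val /padic eqxx.
rewrite wtE; case: (eqVneq f`_i 0) => //= fi.
case: (posnP i) => [->|i0]; first by rewrite mulr0 addr0.
have := jmax i ((JP i).2 (conj i0 fi)); rewrite /r.
rewrite ler_pdivrMr ?ltr0n // mulrAC ler_pdivlMr ?ltr0n //.
rewrite !pmulrn -!rmorphM /= ler_int => h.
by move: h; rewrite mulrBl [X in _ -> X]/=; nia.
Qed.

(** If f generates the ideal I, the image of 1 has norm 0, and multiplying by
    an inverse bounds the norm of every other class. *)
Lemma irreducible_separated (I : A -> Prop) :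
  (forall a b, I a -> I b -> I (a - b)) -> (forall a b, I b -> I (a * b)) ->
  I (L f) -> ~ I 1 -> exists e s, (0 < e)%N /\
  forall a, ~ I a -> exists j, forall h, I h -> ~ ole (Some j) (gauss p e s (a + h)).
Proof.
move=> IB IM If I1.
have I0 : I 0 by rewrite -(subrr (L f)); apply: (IB).
have ID a b : I a -> I b -> I (a + b).
  by move=> ha hb; rewrite -(opprK b); apply: (IB) => //; rewrite -sub0r; apply: (IB).
have [e [s [m [j [e0 j0 fm w0 wj]]]]] := newton_slope.
have sv := gauss_semival s p_pr e0.
have [sf firr] := f_irr.
have cop q : ~~ (f %| q) -> exists u v, L v * L q = 1 - L u * L f.
  move=> nfq; have /Bezout_coprimepP[[u v] /= /eqpP[[c1 c2] /= /andP[c10 c20] E]] : coprimep f q.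
    rewrite coprimep_def; apply: contraNT nfq => h.
    have /firr : size (gcdp f q) != 1 by [].
    by move/(_ (dvdp_gcdl _ _))/eqp_dvdl <-; apply: dvdp_gcdr.
  exists ((c2^-1 * c1)%:P * u), ((c2^-1 * c1)%:P * v).
  rewrite -!(rmorphM L) -(rmorph1 L) -(rmorphB L); congr (L _).
  have E' : (c2^-1 * c1)%:P * (u * f + v * q) = 1.
    rewrite mul_polyC -scalerA E scalerA mulVf // scale1r //.
  by rewrite -[X in _ = X - _]E' mulrDr !mulrA addrAC subrr add0r.
have Idvd q : I (L q) -> f %| q.
  move=> Iq; apply: contraT => /cop[u [v E]]; case: I1.
  have -> : 1 = L v * L q + L u * L f by rewrite E subrK.
  by apply: ID; apply: (IM).
have mono_unit (n : nat) (a : A) : gU (- n%:Z) 1 * (gU n%:Z 1 * a) = a.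
  by rewrite mulrA gUM addNr mulr1 -g1E mul1r.
have Igen h : I h -> exists h', h = L f * h'.
  move=> Ih; have [n [q E]] := laurent_clear h.
  have /Idvd/dvdpP[q' qE] : I (L q) by rewrite -E; apply: (IM).
  exists (gU (- n%:Z) 1 * L q'); rewrite mulrCA -rmorphM [f * _]mulrC -qE -E; exact/esym/mono_unit.
exists e, s; split=> // a na.
have [n [q E]] := laurent_clear a.
have /cop[u [v uv]] : ~~ (f %| q).
  apply/negP => /dvdpP[q' qE]; apply: na; rewrite -(mono_unit n a) E qE rmorphM.
  by apply: (IM); apply: (IM).
pose b := L v * gU n%:Z 1.
have bE : b * a = 1 - L u * L f by rewrite /b -mulrA E.
exists (1 - odflt 0 (gauss p e s b)) => h Ih H.
have Ih' : I (b * h - L u * L f) by apply: (IB); apply: (IM).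
have [h' hE] := Igen _ Ih'.
have E1 : b * (a + h) = 1 + L f * h'.
  by rewrite mulrDr bE -hE [LHS]addrAC addrA.
apply: (@gauss_one_add p e s p_pr e0 (L f) h' m 0 j%:Z fm _ w0 wj).
  by rewrite eq_sym eqz_nat -lt0n.
rewrite -E1 (svM sv); case: (gauss p e s b) H => [be|] //= H.
have -> : Some (1 : int) = oadd (Some be) (Some (1 - be)) by rewrite /= addrC subrK.
by rewrite ole_add2.
Qed.

End Irreducible.
End LaurentPolynomials.

(** * Lifting approximate sections step by step *)

(** A pure subgroup of the value group that is stable under sigma. *)
Record pure_stable (N : valuedDiffField) (H : vf_G N -> Prop) : Prop := {
  ps0 : H 0;
  psB : forall x y, H x -> H y -> H (x - y);
  pss : forall x, H x -> H (vdf_sG x);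
  psV : forall x, H x -> H (vdf_sGV x);
  psp : forall x n, H (x *+ n.+1) -> H x
}.

Section Lifting.
Variables (N : valuedDiffField) (z : vf_G N -> N) (H0 : vf_G N -> Prop) (s0 : vf_G N -> N).
Hypotheses (z0 : forall x, z x != 0) (zD : forall x y, one_unit (z (x + y) / (z x * z y)))
  (zs : forall x, one_unit (z (vdf_sG x) / vdf_s N (z x))).
Local Notation G := (vf_G N).
Implicit Types (H : G -> Prop) (x y : G).

(** An extension N1 in which the values of z can be corrected by one-units, on
    the subgroup H, to an equivariant homomorphism s1 that extends s0. *)
Record lift_on H (N1 : valuedDiffField) (f : {rmorphism N -> N1}) (g : G -> vf_G N1)
    (s1 : G -> N1) : Prop := {
  lo_hom : vdf_hom f g;
  lo_ou : forall x, H x -> one_unit (s1 x / f (z x));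
  loD : forall x y, H x -> H y -> s1 (x + y) = s1 x * s1 y;
  lo_s : forall x, H x -> s1 (vdf_sG x) = vdf_s N1 (s1 x);
  lo_pure : forall c n, (exists d, c *+ n.+1 = g d) -> exists d, c = g d;
  lo_base : forall x, H0 x -> s1 x = f (s0 x)
}.

Definition liftable H := exists N1 f g s1, @lift_on H N1 f g s1.

Lemma psD H : pure_stable H -> forall x y, H x -> H y -> H (x + y).
Proof.
move=> hH x y hx hy; rewrite -(opprK y); apply: (psB hH) => //.
by rewrite -sub0r; apply: (psB hH) => //; apply: ps0 hH.
Qed.

Lemma skV_rmorphism (N1 : valuedDiffField) : exists t t' : {rmorphism vf_k N1 -> vf_k N1},
  [/\ t =1 @vdf_sk N1, cancel t t' & cancel t' t].
Proof.
have [t tE] := vdf_skD0 N1.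
have [|||t' t'E] := @rmorphismP _ _ (@vdf_skV N1); last first.
- by exists t, t'; split=> // c; rewrite tE t'E ?vdf_skK ?vdf_skVK.
- by apply: (can_inj (@vdf_skK N1)); rewrite vdf_skVK -tE rmorph1.
- by move=> c d; apply: (can_inj (@vdf_skK N1)); rewrite vdf_skVK -tE rmorphM !tE !vdf_skVK.
- by move=> c d; apply: (can_inj (@vdf_skK N1)); rewrite vdf_skVK -tE rmorphD !tE !vdf_skVK.
Qed.

Lemma lift_step H H2 (V : zmodType) (j : G -> V) (sV : V -> V) :
  pure_stable H -> pure_stable H2 -> (forall x, H x -> H2 x) -> (forall x, H0 x -> H x) ->
  (forall x y, H2 x -> H2 y -> j (x + y) = j x + j y) ->
  (forall x, H2 x -> j x = 0 <-> H x) ->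
  (forall x, H2 x -> j (vdf_sG x) = sV (j x)) ->
  (forall (k : fieldType) (t t' : {rmorphism k -> k}) (r : {rmorphism vf_k N -> k}),
     cancel t t' -> cancel t' t -> has_place t sV) ->
  liftable H -> liftable H2.
Proof.
move=> hH hH2 HH2 H0H jD jH js place [N1 [f [g [s1 lo]]]].
have h := lo_hom lo.
have [Q [i [iD ii iP]]] := subgroup_exists (psB hH2) (ps0 hH2).
have i0 := morphD0 iD; have iB := morphDB iD.
have H2i q : H2 (i q) by apply/iP; exists q.
have PB q r : H (i q) -> H (i r) -> H (i (q - r)) by rewrite iB; apply: psB.
have P0 : H (i 0) by rewrite i0; apply: ps0 hH.
have [C [pi [piD piS piP]]] := quotient_group_exists PB P0.
have /boolp.choice[sQ sQE] : forall q, exists r, i r = vdf_sG (i q).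
  by move=> q; apply/iP/(pss hH2).
have /boolp.choice[sQ' sQ'E] : forall q, exists r, i r = vdf_sGV (i q).
  by move=> q; apply/iP/(psV hH2).
have sQD : {morph sQ : x y / x + y}.
  by move=> q r; apply: ii; rewrite iD !sQE iD vdf_sGD.
have sQK : cancel sQ sQ' by move=> q; apply: ii; rewrite sQ'E sQE vdf_sGK.
have sQ'K : cancel sQ' sQ by move=> q; apply: ii; rewrite sQE sQ'E vdf_sGVK.
have piB := morphDB piD; have pi0 := morphD0 piD.
have piE q r : pi q = pi r <-> H (i (q - r)).
  rewrite -piP piB; split=> [->|/eqP]; first exact: subrr.
  by rewrite subr_eq0 => /eqP.
have Hs x : H (vdf_sG x) <-> H x.
  by split=> [/(psV hH)|/(pss hH) //]; rewrite vdf_sGK.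
have sQB := morphDB sQD.
have /boolp.choice[rep repP] := piS.
pose sC c := pi (sQ (rep c)); pose sC' c := pi (sQ' (rep c)).
have sCpi q : sC (pi q) = pi (sQ q).
  by apply/piE; rewrite -sQB sQE Hs; apply/piE; rewrite repP.
have sQ'B : {morph sQ' : x y / x - y}.
  by move=> q r; apply: (can_inj sQK); rewrite sQB !sQ'K.
have sC'pi q : sC' (pi q) = pi (sQ' q).
  apply/piE; rewrite -sQ'B; apply/Hs; rewrite sQ'E vdf_sGVK.
  by apply/piE; rewrite repP.
have sCK : cancel sC sC' by move=> c; rewrite -(repP c) sCpi sC'pi sQK.
have sC'K : cancel sC' sC by move=> c; rewrite -(repP c) sC'pi sCpi sQ'K.
have [t [t' [tE tK t'K]]] := skV_rmorphism N1.
have [r rE] := vh_res h.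
have jB q q' : j (i (q - q')) = j (i q) - j (i q').
  by apply: (addIr (j (i q'))); rewrite subrK -jD // -iD subrK.
have jE q q' : pi q = pi q' -> j (i q) = j (i q').
  by move/piE/jH => /(_ (H2i _)); rewrite jB => /eqP; rewrite subr_eq0 => /eqP.
have plC : has_place t sC.
  apply: (@has_place_sub _ C V t sC sV (fun c => j (i (rep c)))).
  - by move=> c d; rewrite -jD // -iD; apply: jE; rewrite piD !repP.
  - move=> c d /eqP; rewrite -subr_eq0 -jB => /eqP/jH => /(_ (H2i _))/piE.
    by rewrite !repP.
  - by move=> c; rewrite -js // -sQE; apply: jE; rewrite repP.
  - exact: place r tK t'K.
have zf0 q : f (z (i q)) != 0 by rewrite fmorph_eq0.
have [|||||||N2 [f2 [g2 [s2 [[h2 s2P s2D s2s s2z] pure2]]]]] :=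
  @composite_extension N1 Q C (fun q => H (i q)) sQ sQ' (fun q => s1 (i q))
  (fun q => f (z (i q))) pi sC sC' t tE plC _ _ sQD sQK sQ'K piD piS piP sCpi sCK sC'K
  _ _ zf0 _ _ _.
- by move=> q q'; rewrite iD; apply: psD.
- by move=> q; rewrite sQE => /Hs.
- by move=> q q'; rewrite iD; apply: (loD lo).
- by move=> q; rewrite sQE; apply: (lo_s lo).
- by move=> q q'; rewrite iD -!rmorphM -fmorphV -rmorphM; apply/(vh_ou h)/zD.
- by move=> q; rewrite sQE -(vh_s h) -fmorphV -rmorphM; apply/(vh_ou h)/zs.
- by move=> q; apply: (lo_ou lo).
have /boolp.choice[q qE] : forall x, exists q, H2 x -> i q = x.
  by move=> x; have [/iP[q qx]|n] := pselect (H2 x); [exists q | exists 0].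
exists N2, (f2 \o f), (g2 \o g), (fun x => s2 (q x)); split=> /=.
- exact: vdf_hom_comp h h2.
- by move=> x Hx; rewrite -{2}(qE x Hx); apply: s2z.
- move=> x y Hx Hy; rewrite -s2D; congr (s2 _); apply: ii.
  by rewrite iD !qE //; apply: psD.
- move=> x Hx; rewrite -s2s; congr (s2 _); apply: ii.
  by rewrite sQE !qE //; apply: pss.
- move=> c n [d cd].
  have [|c' c'E] := pure2 c n; first by exists (g d).
  have [|d' d'E] := lo_pure lo (c := c') (n := n); last by exists d'; rewrite c'E d'E.
  exists d; apply: (mono_oag_inj (vh_le h2)); rewrite -cd c'E.
  exact: morphDMn (vhD h2) _ _.
- move=> x Hx; have Hx1 := H0H x Hx; have Hx2 := HH2 x Hx1.
  by rewrite s2P ?qE // (lo_base lo).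
Qed.

(** The action of the integral Laurent polynomials on the value group. *)
Definition sgz (i : int) x : G :=
  match i with Posz n => iter n (@vdf_sG N) x | Negz n => iter n.+1 (@vdf_sGV N) x end.

Lemma sgz1D i x : sgz (1 + i) x = vdf_sG (sgz i x).
Proof.
case: i => [n|[|n]]; [by rewrite -intS | by rewrite NegzE addrN /= vdf_sGVK | ].
have -> : 1 + Negz n.+1 = Negz n by lia.
by rewrite /= vdf_sGVK.
Qed.

Lemma sgzV1D i x : sgz (-1 + i) x = vdf_sGV (sgz i x).
Proof.
by apply: (can_inj (@vdf_sGK N)); rewrite vdf_sGVK -sgz1D addrA subrr add0r.
Qed.

Lemma sgzD i j x : sgz (i + j) x = sgz i (sgz j x).
Proof.
elim: i => [|n IH|n IH]; first by rewrite add0r.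
  by rewrite intS -addrA !sgz1D IH.
by rewrite intS opprD -addrA !sgzV1D IH.
Qed.

Lemma sgz_add i : {morph sgz i : x y / x + y}.
Proof.
have VD : {morph @vdf_sGV N : x y / x + y}.
  by move=> x y; apply: (can_inj (@vdf_sGK N)); rewrite vdf_sGD !vdf_sGVK.
move=> x y; elim: i => [|n IH|n IH] //; first by rewrite intS !sgz1D IH vdf_sGD.
by rewrite intS opprD !sgzV1D IH VD.
Qed.

Definition act (b : gring int int) x : G := glift (fun i c => sgz i x *~ c) b.

Let act_a x i : {morph (fun c : int => sgz i x *~ c) : c d / c + d}.
Proof. by move=> c d; rewrite mulrzDr. Qed.

Lemma actD x : {morph act^~ x : b c / b + c}.
Proof. exact: (gliftD (act_a x)). Qed.

Lemma actU i c x : act (gU i c) x = sgz i x *~ c.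
Proof. exact: (gliftU (act_a x)). Qed.

Lemma act_add b : {morph act b : x y / x + y}.
Proof.
move=> x y; rewrite /act /glift -big_split; apply: eq_bigr => i _ /=.
by rewrite sgz_add mulrzDl.
Qed.

Lemma actM b c x : act (b * c) x = act b (act c x).
Proof.
apply: (gring_ext (F := fun b => act (b * c) x) (F' := fun b => act b (act c x))) b
  => [b b'|b b'|i m].
- by rewrite mulrDl actD.
- exact: actD.
apply: (gring_ext (F := fun c => act (gU i m * c) x) (F' := fun c => act (gU i m) (act c x))) c
  => [c c'|c c'|i' m'].
- by rewrite mulrDr actD.
- by rewrite actD act_add.
rewrite gUM !actU sgzD [m * m']mulrC mulrzA; congr (_ *~ _).
case: m' => m'; first exact/esym/(morphDMn (sgz_add i)).
by rewrite NegzE !mulrNz -!pmulrn (morphDN (sgz_add i)) (morphDMn (sgz_add i)).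
Qed.

Lemma act_H H b x : pure_stable H -> H x -> H (act b x).
Proof.
move=> hH Hx; have HD := psD hH.
have HN y : H y -> H (- y) by move=> Hy; rewrite -sub0r; apply: (psB hH) (ps0 hH) Hy.
have Hi i : H (sgz i x).
  elim: i => [|n IH|n IH] //; first by rewrite intS sgz1D; apply: pss.
  by rewrite intS opprD sgzV1D; apply: psV.
have Hn y n : H y -> H (y *+ n).
  by move=> Hy; elim: n => [|n IH]; rewrite ?mulr0n ?mulrS; [apply: ps0 hH | apply: HD].
elim/gring_ind: b => [|i m b IH]; first by rewrite (morphD0 (actD x)); apply: ps0 hH.
rewrite actD; apply: HD => //; rewrite actU; case: m => m; first exact: Hn.
by rewrite NegzE mulrNz; apply/HN/Hn.
Qed.

Definition iota_map : gring int int -> gring rat int :=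
  gmap (intr : {rmorphism int -> rat}) id.

Lemma iotaD : {morph iota_map : b c / b + c}. Proof. exact: gmapD. Qed.

Lemma iotaM : {morph iota_map : b c / b * c}. Proof. exact: gmapM. Qed.

Lemma iota_inj : injective iota_map.
Proof.
apply: (morphD_inj iotaD) => b b0; apply: gringP => i; apply: (@intr_inj rat).
have := congr1 (gcf i) b0; rewrite !gcf0 /iota_map => h.
have := @gcf_gmap _ _ _ _ (intr : {rmorphism int -> rat}) id (fun _ _ e => e) i b.
by rewrite h => <-.
Qed.

Lemma iota_clear a : exists n b, a *+ n.+1 = iota_map b.
Proof.
elim/gring_ind: a => [|i x a [n [b E]]].
  by exists 0%N, 0; rewrite mul0rn (morphD0 iotaD).
have d0 : (0 < `|denq x|)%N by rewrite absz_gt0 denq_neq0.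
exists (n.+1 * `|denq x|).-1, (gU i (numq x) *+ n.+1 + b *+ `|denq x|).
rewrite prednK ?muln_gt0 // mulrnDl iotaD !(morphDMn iotaD) -E -mulrnA; congr (_ + _).
rewrite mulnC mulrnA; congr (_ *+ _); rewrite /iota_map gmapU -(morphDMn (gUD i)).
congr (gU _ _); rewrite /= numqE -mulr_natr; congr (_ * _).
by rewrite -[in RHS](gez0_abs (denq_ge0 x)) pmulrn.
Qed.

Section Module.
Variables (H : G -> Prop) (x : G).
Hypothesis hH : pure_stable H.
Implicit Types (c : G) (a : gring rat int).

(** c is the image of x under the rational Laurent polynomial a, modulo H. *)
Definition rel c a := exists n b, a *+ n.+1 = iota_map b /\ H (act b x - c *+ n.+1).

Let Hn c n : H c -> H (c *+ n).
Proof.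
by move=> Hy; elim: n => [|n IH]; rewrite ?mulr0n ?mulrS; [apply: ps0 hH | apply: (psD hH)].
Qed.

Lemma relB c a c' a' : rel c a -> rel c' a' -> rel (c - c') (a - a').
Proof.
move=> [n [b [ab Hb]]] [n' [b' [ab' Hb']]].
exists (n.+1 * n'.+1).-1, (b *+ n'.+1 - b' *+ n.+1); rewrite prednK //; split.
  rewrite (morphDB iotaD) !(morphDMn iotaD) -ab -ab' mulrnBl -!mulrnA.
  by rewrite [(n'.+1 * _)%N]mulnC.
rewrite (morphDB (actD x)) !(morphDMn (actD x)).
have -> : (act b x *+ n'.+1 - act b' x *+ n.+1) - (c - c') *+ (n.+1 * n'.+1) =
   (act b x - c *+ n.+1) *+ n'.+1 - (act b' x - c' *+ n'.+1) *+ n.+1.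
  rewrite !mulrnBl -!mulrnA [(n'.+1 * _)%N]mulnC !opprB.
  by rewrite addrACA [RHS]addrACA; congr (_ + _); rewrite addrC.
by apply: (psB hH); apply: Hn.
Qed.

Lemma rel_H c : rel c 0 <-> H c.
Proof.
split=> [[n [b [b0 Hb]]]|Hc].
  have {b0} b0 : b = 0 by apply: iota_inj; rewrite -b0 mul0rn (morphD0 iotaD).
  move: Hb; rewrite b0 (morphD0 (actD x)) sub0r => /(psB hH (ps0 hH)).
  by rewrite sub0r opprK; apply: psp.
exists 0%N, 0; rewrite mul0rn (morphD0 iotaD) (morphD0 (actD x)) sub0r; split=> //.
by rewrite -sub0r; apply: (psB hH) (ps0 hH) Hc.
Qed.

Lemma rel_x : rel x 1.
Proof.
exists 0%N, 1; rewrite mulr1n /iota_map gmap1; split=> //.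
by rewrite g1E actU /= subrr; apply: ps0 hH.
Qed.

Lemma relM i c a : rel c a -> rel (sgz i c) (gU i 1 * a).
Proof.
move=> [n [b [ab Hb]]]; exists n, (gU i 1 * b).
rewrite iotaM -ab mulrnAr /iota_map gmapU rmorph1; split=> //.
rewrite actM -(morphDMn (sgz_add i)).
have <- y : act (gU i 1) y = sgz i y by rewrite actU.
by rewrite -(morphDB (act_add _)); apply: act_H.
Qed.

Lemma rel_div c a n : rel (c *+ n.+1) (a *+ n.+1) -> rel c a.
Proof.
move=> [m [b [ab Hb]]]; exists (n.+1 * m.+1).-1, b; rewrite prednK //.
by rewrite !mulrnA.
Qed.

Lemma rel0M a b : rel 0 b -> rel 0 (a * b).
Proof.
have r0 : rel 0 0 by apply/rel_H; apply: ps0 hH.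
have relD (c d : gring rat int) : rel 0 c -> rel 0 d -> rel 0 (c + d).
  move=> h1 h2; have h3 := relB r0 h2; have := relB h1 h3.
  by rewrite !subr0 !sub0r opprK.
have relN (c : gring rat int) : rel 0 c -> rel 0 (- c) by move=> /(relB r0); rewrite !subr0 sub0r.
have relMn (c : gring rat int) n : rel 0 c -> rel 0 (c *+ n).
  by move=> h; elim: n => [|n IH]; rewrite ?mulr0n ?mulrS //; apply: relD.
move=> rb; elim/gring_ind: a => [|i u a IH]; first by rewrite mul0r.
rewrite mulrDl; apply: (relD) IH.
have sz0 : sgz i 0 = 0 by apply: morphD0 (sgz_add i).
have h : rel 0 (gU i 1 * b) by rewrite -sz0; apply: relM.
have d0 : (0 < `|denq u|)%N by rewrite absz_gt0 denq_neq0.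
apply: (@rel_div 0 _ `|denq u|.-1); rewrite mul0rn prednK ?absz_gt0 ?denq_neq0 //.
have -> : (gU i u * b) *+ `|denq u| = (gU i 1 * b) *~ numq u.
  rewrite -mulrnAl -(morphDMn (gUD i)) -mulrzAl; congr (_ * _).
  have -> : u *+ `|denq u| = (numq u)%:~R.
    rewrite numqE -mulr_natr; congr (_ * _).
    by rewrite -[in RHS](gez0_abs (denq_ge0 u)) pmulrn.
  case: (numq u) => n; first exact: (morphDMn (gUD i)).
  by rewrite NegzE !mulrNz gUN -!pmulrn (morphDMn (gUD i)).
by case: (numq u) => n; rewrite ?NegzE ?mulrNz; [apply: relMn | apply/relN/relMn].
Qed.
End Module.
End Lifting.

Section Adjoin.
Variables (N : valuedDiffField) (z : vf_G N -> N) (H0 : vf_G N -> Prop) (s0 : vf_G N -> N).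
Hypotheses (z0 : forall x, z x != 0) (zD : forall x y, one_unit (z (x + y) / (z x * z y)))
  (zs : forall x, one_unit (z (vdf_sG x) / vdf_s N (z x))).
Local Notation G := (vf_G N).
Local Notation liftable := (liftable z H0 s0).
Local Notation A := (gring rat int).
Implicit Types (H : G -> Prop) (x y : G) (a : A).

Definition extends_to H x := exists H2, [/\ pure_stable H2, forall y, H y -> H2 y, H2 x &
  liftable H2].

Lemma hull_step p H x : prime p -> p%:R = 0 :> vf_k N -> pure_stable H ->
  (forall y, H0 y -> H y) -> liftable H ->
  (exists e s, (0 < e)%N /\ forall a, ~ rel H x 0 a -> exists j, forall h, rel H x 0 h ->
    ~ ole (Some j) (gauss p e s (a + h))) ->
  extends_to H x.
Proof.
move=> p_pr pk hH H0H lH [e [s [e0 sep]]].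
have r00 : rel H x 0 0 by apply/(rel_H _ hH); apply: ps0 hH.
have IB a b : rel H x 0 a -> rel H x 0 b -> rel H x 0 (a - b).
  by move=> h1 h2; have := relB hH h1 h2; rewrite subr0.
have [V [pr [sV [prD prI prs place]]]] :=
  quotient_place p_pr e0 r00 IB (fun a b => @rel0M N H x hH a b) sep.
have prB := morphDB prD.
pose H2 y := exists a, rel H x y a.
have H2H y : H y -> H2 y by move=> Hy; exists 0; apply/(rel_H _ hH).
have sg1 y : sgz 1 y = vdf_sG y by [].
have sgV y : sgz (-1) y = vdf_sGV y by [].
have hH2 : pure_stable H2.
  split.
  - by exists 0.
  - by move=> y y' [a h] [a' h']; exists (a - a'); apply: relB.
  - by move=> y [a h]; exists (gU 1 1 * a); rewrite -sg1; apply: relM.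
  - by move=> y [a h]; exists (gU (-1) 1 * a); rewrite -sgV; apply: relM.
  - move=> y n [a h]; exists (gU 0 (n.+1%:R)^-1 * a); apply: (rel_div (n := n)).
    have -> // : (gU 0 (n.+1%:R)^-1 * a) *+ n.+1 = a.
    rewrite -mulrnAl -(morphDMn (gUD 0)) -[X in gU 0 X]mulr_natr mulVf ?pnatr_eq0 //.
    by rewrite -g1E mul1r.
have /boolp.choice[al alP] : forall y, exists a, H2 y -> rel H x y a.
  move=> y; have [[a h]|no] := pselect (H2 y); first by exists a.
  by exists 0 => h; case: no.
have alE y a : rel H x y a -> pr (al y) = pr a.
  move=> h; have h' : rel H x y (al y) by apply: alP; exists a.
  apply/eqP; rewrite -subr_eq0 -prB; apply/eqP/prI.
  by have := relB hH h' h; rewrite subrr.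
exists H2; split=> //; first by exists 1; apply: rel_x.
apply: (@lift_step N z H0 s0 z0 zD zs H H2 V (fun y => pr (al y)) sV) => //.
- move=> y y' hy hy'; rewrite -prD; apply: alE.
  have h0 : rel H x (0 - y') (0 - al y') by apply: relB => //; apply: alP.
  by have := relB hH (alP _ hy) h0; rewrite !sub0r !opprK.
- move=> y hy; rewrite prI; split=> [h|Hy].
    by apply/(rel_H x hH); have := relB hH (alP _ hy) h; rewrite subr0 subrr.
  have := relB hH (alP _ hy) ((rel_H x hH y).2 Hy); by rewrite subrr subr0.
- move=> y hy; rewrite prs; apply: alE; rewrite -sg1; apply: relM => //; exact: alP.
- move=> k t t' r tK t'K; apply: (place k t t' tK t'K).
  by rewrite -(rmorph_nat r) pk rmorph0.
Qed.

Section PositiveChar.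
Variable p : nat.
Hypotheses (p_pr : prime p) (pk : p%:R = 0 :> vf_k N).

Variable L : {rmorphism {poly rat} -> A}.
Hypotheses (Lcf : forall q (i : nat), gcf i%:Z (L q) = q`_i)
  (Lneg : forall q (i : int), i < 0 -> gcf i (L q) = 0)
  (LC : forall c, L c%:P = gU 0 c) (LX : L 'X = gU 1 1).

(** Induction on the degree of an annihilating polynomial; a factorization
    g h of the polynomial reduces x first to its image under g, which is
    annihilated by h. *)
Lemma adjoin_algebraic d H x (q : {poly rat}) : pure_stable H -> (forall y, H0 y -> H y) ->
  liftable H -> q != 0 -> (size q <= d)%N -> rel H x 0 (L q) -> extends_to H x.
Proof.
elim: d H x q => [|d IH] H x q hH H0H lH q0 sq rq.
  by move: sq; rewrite leqn0 size_poly_eq0 (negbTE q0).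
have [Hx|nHx] := pselect (H x); first by exists H.
have IB a b : rel H x 0 a -> rel H x 0 b -> rel H x 0 (a - b).
  by move=> h1 h2; have := relB hH h1 h2; rewrite subr0.
have IM a b : rel H x 0 b -> rel H x 0 (a * b) by apply: rel0M.
have I1 : ~ rel H x 0 1.
  move=> h; apply: nHx; apply/(rel_H x hH).
  by have := relB hH (rel_x x hH) h; rewrite subr0 subrr.
have sq1 : (1 < size q)%N.
  rewrite ltnNge; apply/negP => /size1_polyC qC; apply: I1.
  have c0 : q`_0 != 0 by apply: contra q0 => /eqP c0; rewrite qC c0.
  have := IM (gU 0 (q`_0)^-1) _ rq.
  by rewrite {2}qC LC gUM addr0 mulVf.
have [f0|f0] := eqVneq q`_0 0.
  have [q' qE] : exists q', q = q' * 'X.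
    by have /factor_theorem[q' ->] : root q 0; [rewrite /root horner_coef0 f0|exists q'; rewrite subr0].
  have q'0 : q' != 0 by apply: contra q0 => /eqP q'0; rewrite qE q'0 mul0r.
  apply: (IH H x q') => //; first by move: sq; rewrite qE size_mulX.
  have U : gU (-1) 1 * gU 1 1 = 1 :> A by rewrite gUM mulr1 addNr g1E.
  by have := IM (gU (-1) 1) _ rq; rewrite qE rmorphM LX mulrCA U mulr1.
have [irr|nirr] := pselect (irreducible_poly q).
  apply: (hull_step p_pr pk hH H0H lH).
  exact: (irreducible_separated Lcf Lneg LC LX p_pr f0 irr IB IM rq I1).
have [g [h [qE sg sh]]] : exists g h, [/\ q = g * h, (size g < size q)%N &
    (size h < size q)%N].
  apply: contrapT => no; apply: nirr; split=> // h h1 /dvdpP[g qE].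
  have gh0 : g != 0 /\ h != 0 by apply/andP; rewrite -negb_or -mulf_eq0 -qE.
  have [g0 h0] := gh0; have sgh : (size q = (size g + size h).-1)%N by rewrite qE size_mul.
  have sg0 : (0 < size g)%N by rewrite size_poly_gt0.
  have sh0 : (0 < size h)%N by rewrite size_poly_gt0.
  have [sg1|sg1] := eqVneq (size g) 1%N.
    have /eqP/size_poly1P[c c0 gE] := sg1; rewrite qE gE mul_polyC eqp_sym.
    exact: eqp_scale.
  case: no; exists g, h; rewrite sgh; split=> //.
    by move: sg0 sh0 h1; case: (size g) (size h) => [|i] [|[|j]] // _ _ _; lia.
  by move: sg0 sh0 sg1; case: (size g) (size h) => [|[|i]] [|j] // _ _ _; lia.
have [gn0 hn0] : g != 0 /\ h != 0 by apply/andP; rewrite -negb_or -mulf_eq0 -qE.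
have [n [b ab]] := iota_clear (L g).
have [m [c ac]] := iota_clear (L h).
have [l [b1 [lb Hb1]]] := rq.
pose y := act b x.
have ry : rel H y 0 (L h).
  exists m, c; rewrite mul0rn subr0; split=> //; rewrite /y -actM.
  apply: (psp hH (n := l)); rewrite -(morphDMn (actD x)).
  have -> : (c * b) *+ l.+1 = b1 *+ (m.+1 * n.+1).
    apply: iota_inj; rewrite !(morphDMn iotaD) iotaM -ac -ab -lb qE rmorphM.
    rewrite mulrnAl mulrnAr -!mulrnA [L h * _]mulrC; congr (_ *+ _).
    nia.
  rewrite (morphDMn (actD x)) mulnC mulrnA.
  have HMn w i : H w -> H (w *+ i).
    by move=> Hw; elim: i => [|i IHi]; rewrite ?mulr0n ?mulrS; [apply: ps0 hH | apply: (psD hH)].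
  by apply/HMn/HMn; rewrite mul0rn subr0 in Hb1.
have [|H2 [hH2 HH2 H2y lH2]] := IH H y h hH H0H lH hn0 _ ry; first by lia.
have [||H3 [hH3 HH3 H3x lH3]] := IH H2 x g hH2 (fun w h => HH2 w (H0H w h)) lH2 gn0.
- by lia.
- by exists n, b; rewrite mul0rn subr0.
by exists H3; split=> // w /HH2/HH3.
Qed.

End PositiveChar.

Lemma adjoin H x : pure_stable H -> (forall y, H0 y -> H y) -> liftable H -> extends_to H x.
Proof.
move=> hH H0H lH.
have [[n n0]|char0] := pselect (exists n, (n.+1)%:R = 0 :> vf_k N).
  have [|p /andP[p_pr /eqP pk]] := @natf0_pchar (vf_k N) n.+1 (ltn0Sn n); first exact/eqP.
  have [L [Lcf Lneg LC LX]] := laurent_exists.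
  have [[a [a0 ra]]|no] := pselect (exists a, a != 0 /\ rel H x 0 a).
    have [m [q E]] := laurent_clear LC LX a.
    have aE : a = gU (- m%:Z) 1 * L q by rewrite -E mulrA gUM addNr mulr1 -g1E mul1r.
    apply: (adjoin_algebraic p_pr pk Lcf Lneg LC LX hH H0H lH _ (leqnn (size q))).
      by apply: contra a0 => /eqP q0; rewrite aE q0 rmorph0 mulr0.
    by rewrite -E; apply: rel0M.
  apply: (hull_step p_pr pk hH H0H lH).
  exists 1%N, 0; split=> // a ra.
  have a0 : a != 0.
    by apply/eqP => a0; apply: ra; rewrite a0; apply/(rel_H _ hH); apply: ps0 hH.
  have sv := gauss_semival 0 p_pr (ltn0Sn 0).
  exists (odflt 0 (gauss p 1 0 a) + 1) => h rh.
  have -> : h = 0 by apply/eqP/negPn/negP => h0; apply: no; exists h.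
  rewrite addr0; case E: (gauss p 1 0 a) => [j|] /=.
    by apply/negP; rewrite -ltNge; lia.
  have [i ai] : exists i, gcf i a != 0.
    by apply: contrapT => /forallNP h'; case/eqP: a0; apply: gringP => i; rewrite gcf0;
      apply/eqP/negPn/negP/h'.
  have := wmin_le (exp_weight 0) (coef_val_semival p_pr (ltn0Sn 0)) a i.
  rewrite -/(gauss p 1 0 a) E /wterm /coef_val /padic (negbTE ai) //.
have [C [pi [piD piS piP]]] := quotient_group_exists (psB hH) (ps0 hH).
have piB := morphDB piD.
have /boolp.choice[rep repP] := piS.
have piE y y' : pi y = pi y' <-> H (y - y').
  rewrite -piP piB; split=> [->|/eqP]; first exact: subrr.
  by rewrite subr_eq0 => /eqP.
have sVD : {morph @vdf_sGV N : u v / u + v}.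
  by move=> u v; apply: (can_inj (@vdf_sGK N)); rewrite vdf_sGD !vdf_sGVK.
pose sC c := pi (vdf_sG (rep c)); pose sC' c := pi (vdf_sGV (rep c)).
have sCpi y : sC (pi y) = pi (vdf_sG y).
  by apply/piE; rewrite -(morphDB (@vdf_sGD N)); apply/(pss hH)/piE; rewrite repP.
have sC'pi y : sC' (pi y) = pi (vdf_sGV y).
  by apply/piE; rewrite -(morphDB sVD); apply/(psV hH)/piE; rewrite repP.
exists (fun=> True); split=> //.
apply: (@lift_step N z H0 s0 z0 zD zs H (fun=> True) C pi sC) => //.
move=> k t t' r tK t'K.
refine (@char0_place_exists k C _ _ t t' sC sC' t'K _ _ _).
- by move=> n; rewrite -(rmorph_nat r) fmorph_eq0; apply/eqP => h; apply: char0; exists n.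
- move=> c n; rewrite -(repP c) -(morphDMn piD) !piP; exact: psp.
- by move=> c d; rewrite -(repP c) -(repP d) -piD !sCpi vdf_sGD piD.
- by move=> c; rewrite -(repP c) sCpi sC'pi vdf_sGK.
- by move=> c; rewrite -(repP c) sC'pi sCpi vdf_sGVK.
Qed.

Lemma adjoin_seq H (l : seq G) : pure_stable H -> (forall y, H0 y -> H y) -> liftable H ->
  exists H2, [/\ pure_stable H2, forall y, H y -> H2 y, forall y, y \in l -> H2 y &
    liftable H2].
Proof.
move=> hH H0H lH; elim: l => [|x l [H2 [hH2 HH2 lH2 liH2]]]; first by exists H.
have [|H3 [hH3 HH3 H3x lH3]] := adjoin x hH2 _ liH2; first by move=> y /H0H/HH2.
exists H3; split=> // y; first by move=> /HH2/HH3.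
by rewrite inE => /orP[/eqP ->|/lH2/HH3].
Qed.
End Adjoin.

(** * Terms and formulas *)

Scheme term_mut := Induction for term Sort Prop
with terms_mut := Induction for terms Sort Prop.
Combined Scheme term_terms_ind from term_mut, terms_mut.

Section EmbeddedFormulas.
Variables (S : Type) (L : signature S) (M N : structure L) (F : embedding M N).
Variables (X : S -> Type) (e : forall t, X t -> car M t) (e' : forall t, X t -> car N t).
Hypothesis ee' : forall t (x : X t), F t (e x) = e' x.

Lemma embedding_eval :
  (forall t (u : term L X t), F t (teval e u) = teval e' u) /\
  (forall w (us : terms L X w), hmap F (tseval e us) = tseval e' us).
Proof.
apply: term_terms_ind => [t x|w t f us IH||t w u IHu us IHus] //=.
- by rewrite emap_fun IH.
- by rewrite IHu IHus.
Qed.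

Lemma embedding_holds (phi : qfformula L X) : holds e phi <-> holds e' phi.
Proof.
have [hT hS] := embedding_eval.
elim: phi => [//|t u u'|w r us|q IH|q IHq r IHr|q IHq r IHr] /=.
- rewrite -!hT; split=> [-> //|]; exact: emap_inj.
- by rewrite -hS; apply: emap_rel.
- by rewrite IH.
- by rewrite IHq IHr.
- by rewrite IHq IHr.
Qed.
End EmbeddedFormulas.

(** Translations into the language with a cross-section, given by the
    translation app of the application of a function symbol. *)
Section Translation.
Variables (X : vsort -> Type) (Sym : seq vsort -> vsort -> Type).
Let L := Signature Sym vdf_rsym.
Variable app : forall w t, Sym w t -> terms L_svdf X w -> term L_svdf X t.

Fixpoint tr_term t (u : term L X t) : term L_svdf X t :=
  match u with
  | Var t x => Var L_svdf x
  | App w t f us => app f (tr_terms us)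
  end
with tr_terms w (us : terms L X w) : terms L_svdf X w :=
  match us with
  | Tnil => Tnil L_svdf X
  | Tcons t w u us => Tcons (tr_term u) (tr_terms us)
  end.

Fixpoint tr_form (phi : qfformula L X) : qfformula L_svdf X :=
  match phi with
  | QFalse => QFalse L_svdf X
  | QEq t u u' => QEq (tr_term u) (tr_term u')
  | QRel w r us => @QRel _ L_svdf X w r (tr_terms us)
  | QNot q => QNot (tr_form q)
  | QAnd q r => QAnd (tr_form q) (tr_form r)
  | QOr q r => QOr (tr_form q) (tr_form r)
  end.

Variables (M : sValuedDiffField) (e : forall t, X t -> vdf_car M t).
Variable If : forall w t, Sym w t -> hprod (vdf_car M) w -> vdf_car M t.
Hypothesis appE : forall w t (f : Sym w t) us,
  teval (M := svdf_str M) e (app f us) = If f (tseval (M := svdf_str M) e us).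

Lemma tr_holds phi : holds (M := svdf_str M) e (tr_form phi) <->
  holds (M := @Structure _ L (vdf_car M) If (@vdf_irel M)) e phi.
Proof.
set M' := Structure _ _.
have [hT hS] : (forall t (u : term L X t),
    teval (M := svdf_str M) e (tr_term u) = teval (M := M') e u) /\
  (forall w (us : terms L X w),
    tseval (M := svdf_str M) e (tr_terms us) = tseval (M := M') e us).
  apply: term_terms_ind => [t x|w t f us IH||t w u IHu us IHus] //=.
  - by rewrite appE IH.
  - by rewrite IHu IHus.
elim: phi => [//|t u u'|w r us|q IH|q IHq r IHr|q IHq r IHr] /=.
- by rewrite !hT.
- by rewrite hS.
- by rewrite IH.
- by rewrite IHq IHr.
- by rewrite IHq IHr.
Qed.
End Translation.

Section Languages.
Variable X : vsort -> Type.

Definition base_app w t (f : vdf_fsym w t) (us : terms L_svdf X w) : term L_svdf X t :=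
  @App _ L_svdf X w t (SBase f) us.

Lemma base_holds (M : sValuedDiffField) (e : forall t, X t -> vdf_car M t)
    (phi : qfformula L_vdf X) :
  holds (M := svdf_str M) e (tr_form base_app phi) <-> holds (M := vdf_str M) e phi.
Proof. exact: tr_holds. Qed.

Definition thead t w (us : terms L_svdf X (t :: w)) : term L_svdf X t :=
  match us with Tcons _ _ u _ => u end.

Definition un (t t' : vsort) (f : svdf_fsym [:: t] t') (u : term L_svdf X t) :
  term L_svdf X t' := @App _ L_svdf X [:: t] t' f (Tcons u (Tnil L_svdf X)).

Definition ac_term (u : term L_svdf X VF) : term L_svdf X RF :=
  un (SBase Res) (@App _ L_svdf X [:: VF; VF] VF (SBase VFmul)
    (Tcons u (Tcons (un (SBase VFinv) (un CrossSection (un (SBase Val) u))) (Tnil L_svdf X)))).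

Definition ac_app w t (f : acvdf_fsym w t) : terms L_svdf X w -> term L_svdf X t :=
  match f in acvdf_fsym w t return terms L_svdf X w -> term L_svdf X t with
  | AcBase w t f => fun us => @App _ L_svdf X w t (SBase f) us
  | AngularComponent => fun us => ac_term (thead us)
  end.

Lemma ac_holds (M : sValuedDiffField) (e : forall t, X t -> vdf_car M t)
    (phi : qfformula L_acvdf X) :
  holds (M := svdf_str M) e (tr_form ac_app phi) <->
  holds (M := acvdf_str (acvdf_of_svdf M)) e phi.
Proof.
have hH t w (us : terms L_svdf X (t :: w)) :
    teval (M := svdf_str M) e (thead us) = (tseval (M := svdf_str M) e us).1.
  refine (match us in terms _ _ w0 return
    match w0 return terms L_svdf X w0 -> Prop with
    | [::] => fun _ => True
    | t :: w => fun us => teval (M := svdf_str M) e (thead us) =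
        (tseval (M := svdf_str M) e us).1 end us with Tnil => I | Tcons _ _ _ _ => erefl end).
apply: tr_holds => w t f us; case: w t / f us => [w t f us|us] //=.
by rewrite hH.
Qed.
End Languages.

(** The formula x + ... + x = y, with n+1 summands. *)
Section Divisibility.
Definition onlyVG (t : vsort) : nat := if t is VG then 1%N else 0%N.

Definition divX := xyvar onlyVG onlyVG.

Fixpoint mult_term (n : nat) (x : term L_svdf divX VG) : term L_svdf divX VG :=
  if n is n'.+1 then @App _ L_svdf divX [:: VG; VG] VG (SBase VGadd)
    (Tcons x (Tcons (mult_term n' x) (Tnil L_svdf divX))) else x.

Definition div_form n : qfformula L_svdf divX :=
  QEq (mult_term n (Var L_svdf (inl ord0 : divX VG))) (Var L_svdf (inr ord0 : divX VG)).

Lemma div_holds (M : sValuedDiffField) (e : forall t, divX t -> vdf_car M t) n :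
  (forall b : vf_G M, e VG (inr ord0) = Some b -> 
   holds (M := svdf_str M) e (div_form n) <->
   exists a : vf_G M, e VG (inl ord0) = Some a /\ a *+ n.+1 = b).
Proof.
move=> b eb; rewrite /div_form /= eb.
have E a m : e VG (inl ord0) = Some a ->
    teval (M := svdf_str M) e (mult_term m (Var L_svdf (inl ord0 : divX VG))) = Some (a *+ m.+1).
  move=> ea; elim: m => [|m IH] /=; first by rewrite ea mulr1n.
  by rewrite IH ea /= -mulrS.
have E0 m : e VG (inl ord0) = None ->
    teval (M := svdf_str M) e (mult_term m (Var L_svdf (inl ord0 : divX VG))) = None.
  by move=> ea; elim: m => [|m IH] /=; rewrite ea.
case ea: (e VG (inl ord0)) => [a|]; last by rewrite E0 //; split=> // -[a []].
by rewrite (E a) //; split=> [[<-]|[a' [[<-] <-]]]; first exists a.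
Qed.
End Divisibility.

(** * Existential closedness *)

Section CrossSectionExtension.
Variables (N : valuedDiffField) (H : vf_G N -> Prop) (s0 : vf_G N -> N).
Hypotheses (hH : pure_stable H) (s0D : forall x y, H x -> H y -> s0 (x + y) = s0 x * s0 y)
  (s0_s : forall x, H x -> s0 (vdf_sG x) = vdf_s N (s0 x))
  (v_s0 : forall x, H x -> vf_v (s0 x) = Some x).

Lemma cross_section_extension : exists (N' : sValuedDiffField) (f : {rmorphism N -> N'})
    (g : vf_G N -> vf_G N'), vdf_hom f g /\ forall x, H x -> svdf_cs (g x) = f (s0 x).
Proof.
have [|||||||N' [f [g [gD gle h hs]]]] :=
  @section_extension N (vf_G N) id H s0 (@vdf_sG N) (@vdf_sGV N) _ _ (ps0 hH) (psD hH) _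
  s0D _ (@vdf_sGD N) (@vdf_sG_le N) (@vdf_sGK N) (@vdf_sGVK N) _ _ s0_s _ => //.
- by move=> x Hx; rewrite -sub0r; apply: (psB hH) (ps0 hH) Hx.
- by move=> x Hx; rewrite v_s0.
- by move=> x; split=> [/(psV hH)|/(pss hH) //]; rewrite vdf_sGK.
- by move=> x n; apply: psp.
exists N', f, g; split=> //; split=> //; exact: (vh_s h).
Qed.
End CrossSectionExtension.

Lemma svdf_embedding (M N : sValuedDiffField) (f : {rmorphism M -> N}) g :
  vdf_hom f g -> (forall x, svdf_cs (g x) = f (svdf_cs x)) ->
  exists F : embedding (svdf_str M) (svdf_str N),
    [/\ forall x : M, F VF x = f x, forall a : option (vf_G M), F VG a = omap g a &
      forall x : M, F RF (vf_res x) = vf_res (f x)].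
Proof.
move=> h cs; have [F [F1 F2 F3]] := vh_embedding h.
have F_fun w t (p : svdf_fsym w t) (u : hprod (vdf_car M) w) :
    F t (svdf_ifun p u) = svdf_ifun p (hmap F u).
  case: w t / p u => [w t p u|[a []]] /=; first exact: (emap_fun F p u).
  rewrite F1 F2; case: a => [a|] /=; last exact: rmorph0.
  by rewrite cs.
by exists (@Embedding _ L_svdf (svdf_str M) (svdf_str N) F (@emap_inj _ _ _ _ F) F_fun
  (@emap_rel _ _ _ _ F)).
Qed.

(** Two homomorphisms with equal components agree on all sorts. *)
Lemma hom_agree (N N' : valuedDiffField) (F F' : forall t, vdf_car N t -> vdf_car N' t) :
  (forall x : N, F VF x = F' VF x) -> (forall a : option (vf_G N), F VG a = F' VG a) ->
  (forall x : N, F RF (vf_res x) = F' RF (vf_res x)) -> forall t x, F t x = F' t x.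
Proof.
by move=> h1 h2 h3 [] x //; have [y _ <-] := vf_res_surj x.
Qed.

(** The angular components of the elements with value in the list l are
    preserved by F. *)
Definition ac_on (N : acValuedDiffField) (l : seq (vf_G N)) (N' : sValuedDiffField)
    (F : embedding (vdf_str N) (vdf_str N')) :=
  forall (b : N) x, vf_v b = Some x -> x \in l -> ac_of_cs (F VF b) = F RF (acvdf_ac b).

Section AcFormulas.
Variables (N : acValuedDiffField) (X : vsort -> Type) (e : forall t, X t -> vdf_car N t).

Let ac0 (N' : sValuedDiffField) (F : embedding (vdf_str N) (vdf_str N')) :
  ac_of_cs (F VF (0 : N)) = F RF (acvdf_ac (0 : N)).
Proof.
have F0 : F VF (0 : N) = (0 : N') := emap_fun F VFzero tt.
have R0 : F RF (0 : vf_k N) = (0 : vf_k N') := emap_fun F RFzero tt.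
by rewrite acvdf_ac0 F0 R0 ac_of_cs0.
Qed.

Lemma ac_eval :
  (forall t (u : term L_acvdf X t), exists l : seq (vf_G N),
    forall (N' : sValuedDiffField) (F : embedding (vdf_str N) (vdf_str N')), ac_on l F ->
    F t (teval (M := acvdf_str N) e u) =
      teval (M := acvdf_str (acvdf_of_svdf N')) (fun t x => F t (e x)) u) /\
  (forall w (us : terms L_acvdf X w), exists l : seq (vf_G N),
    forall (N' : sValuedDiffField) (F : embedding (vdf_str N) (vdf_str N')), ac_on l F ->
    hmap F (tseval (M := acvdf_str N) e us) =
      tseval (M := acvdf_str (acvdf_of_svdf N')) (fun t x => F t (e x)) us).
Proof.
apply: term_terms_ind => [t x|w t f us [l IH]||t w u [l IHu] us [l' IHus]] /=.
- by exists [::].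
- case: w t / f us IH => [w t f us IH|us IH].
    exists l => N' F Fl /=; rewrite -(IH N' F Fl); exact: (emap_fun F f).
  pose b : N := (tseval (M := acvdf_str N) e us).1.
  exists (odflt 0 (vf_v b) :: l) => N' F Fl /=.
  have Fl' : ac_on l F by move=> c x cx xl; apply: Fl cx _; rewrite inE xl orbT.
  rewrite -(IH N' F Fl'); case: (tseval _ us) @b Fl => [b []] /= Fl.
  have [->|b0] := eqVneq b 0; first exact/esym/ac0.
  have [x bx] := vf_neq0P b0; apply/esym/(Fl _ x) => //.
  by rewrite bx mem_head.
- by exists [::].
- exists (l ++ l') => N' F Fl.
  rewrite -(IHu N' F); last by move=> c x cx xl; apply: Fl cx _; rewrite mem_cat xl.
  by rewrite -(IHus N' F) // => c x cx xl; apply: Fl cx _; rewrite mem_cat xl orbT.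
Qed.

Lemma ac_form (phi : qfformula L_acvdf X) : exists l : seq (vf_G N),
  forall (N' : sValuedDiffField) (F : embedding (vdf_str N) (vdf_str N')), ac_on l F ->
  holds (M := acvdf_str N) e phi <->
  holds (M := acvdf_str (acvdf_of_svdf N')) (fun t x => F t (e x)) phi.
Proof.
have [hT hS] := ac_eval.
have sub l l' (N' : sValuedDiffField) (F : embedding (vdf_str N) (vdf_str N')) :
    ac_on (l ++ l') F -> ac_on l F /\ ac_on l' F.
  by move=> Fl; split=> c x cx xl; apply: Fl cx _; rewrite mem_cat xl ?orbT.
elim: phi => [|t u u'|w r us|q [l IH]|q [l IHq] r [l' IHr]|q [l IHq] r [l' IHr]] /=.
- by exists [::].
- have [l hl] := hT t u; have [l' hl'] := hT t u'.
  exists (l ++ l') => N' F /sub[Fl Fl'].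
  by rewrite -(hl N' F Fl) -(hl' N' F Fl'); split=> [-> //|]; apply: (@emap_inj _ _ _ _ F t).
- have [l hl] := hS w us; exists l => N' F Fl.
  by rewrite -(hl N' F Fl); apply: (emap_rel F r).
- by exists l => N' F Fl; rewrite (IH N' F Fl).
- by exists (l ++ l') => N' F /sub[Fl Fl']; rewrite (IHq N' F Fl) (IHr N' F Fl').
- by exists (l ++ l') => N' F /sub[Fl Fl']; rewrite (IHq N' F Fl) (IHr N' F Fl').
Qed.
End AcFormulas.

Section AngularElements.
Variable N : acValuedDiffField.

Lemma ac_res_div (b c : N) x : vf_v b = Some x -> vf_v c = Some x -> acvdf_ac c = 1 ->
  vf_res (b / c) = acvdf_ac b.
Proof.
move=> bx cx c1.
have nz (u : N) y : vf_v u = Some y -> u != 0.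
  by move=> uy; apply/eqP => u0; rewrite u0 vf_v0 in uy.
have bc : vf_v (b / c) = Some 0 by rewrite vf_vM bx (vf_vV cx) /= subrr.
rewrite -(acvdf_ac_res bc) -[in RHS](divfK (nz _ _ cx) b) [RHS]acvdf_acM ?(nz _ _ cx) ?(nz _ _ bc) //.
by rewrite c1 mulr1.
Qed.

Lemma ac_lift : exists z : vf_G N -> N, forall x, vf_v (z x) = Some x /\ acvdf_ac (z x) = 1.
Proof.
suff /boolp.choice[z zP] : forall x, exists u : N, vf_v u = Some x /\ acvdf_ac u = 1.
  by exists z.
move=> x.
have [b bx] := vf_v_surj (Some x).
have b0 : b != 0 by apply/eqP => b0; rewrite b0 vf_v0 in bx.
have [u Ou ub] := vf_res_surj (acvdf_ac b).
have uv : vf_v u = Some 0.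
  have ub0 : vf_res u != 0 by rewrite ub acvdf_ac_neq0.
  move: Ou (vf_res_ker Ou); rewrite /vf_in_O; case E: (vf_v u) => [y|] /= y0 k.
    congr Some; apply/eqP; rewrite eq_le y0 andbT oag_leNgt; apply/negP => h.
    by move/eqP: ub0; apply; apply/k.
  by case/eqP: ub0; apply/k.
have u0 : u != 0 by apply/eqP => u0; rewrite u0 vf_v0 in uv.
have xu : vf_v (b / u) = Some x by rewrite vf_vM bx (vf_vV uv) /= oppr0 addr0.
exists (b / u); split=> //.
have bu0 : b / u != 0 by rewrite mulf_neq0 ?invr_eq0.
have := acvdf_acM bu0 u0; rewrite divfK // (acvdf_ac_res uv) ub => h.
by apply: (mulIf (acvdf_ac_neq0 b0)); rewrite -h mul1r.
Qed.
End AngularElements.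

Section Closed.
Variable M : sValuedDiffField.
Hypothesis hM : existentially_closed svdf_str M.

Lemma divisible (x : vf_G M) n : exists y, y *+ n.+1 = x.
Proof.
pose i (x : vf_G M) := x *+ n.+1.
have iD : {morph i : x y / x + y} by move=> a b; apply: mulrnDl.
have ile : {mono i : x y / x <= y} by move=> a b; apply: oag_mulrn_le.
have iinj := mono_oag_inj ile.
have is_ g : i (vdf_sG g) = vdf_sG (i g).
  exact/esym/(morphDMn (@vdf_sGD M)).
pose P x := exists y, i y = x.
have /boolp.choice[s0 s0E] : forall x, exists u : M, forall y, i y = x -> u = svdf_cs y.
  move=> a; have [[y <-]|no] := pselect (P a); last by exists 0 => y ya; case: no; exists y.
  by exists (svdf_cs y) => y' /iinj ->.
have s0i y : s0 (i y) = svdf_cs y by apply: s0E.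
have [||||||||N [f [p [pD ple h hs]]]] :=
  @section_extension M (vf_G M) i P s0 (@vdf_sG M) (@vdf_sGV M) iD ile _ _ _ _ _
    (@vdf_sGD M) (@vdf_sG_le M) (@vdf_sGK M) (@vdf_sGVK M) is_ _ _ _ => //.
- by exists 0; apply: morphD0 iD.
- by move=> _ _ [a <-] [b <-]; exists (a + b); apply: iD.
- by move=> _ [a <-]; exists (- a); rewrite /i mulNrn.
- by move=> _ _ [a <-] [b <-]; rewrite -iD !s0i svdf_csD.
- by move=> _ [a <-]; rewrite s0i svdf_v_cs.
- move=> a; split=> [[b E]|[b <-]]; last by exists (vdf_sG b); apply: is_.
  exists (vdf_sGV b); apply: (can_inj (@vdf_sGK M)).
  by rewrite -is_ vdf_sGVK.
- by move=> _ [a <-]; rewrite -is_ !s0i svdf_cs_s.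
- by move=> g m _; exists g.
have cs y : svdf_cs ((p \o i) y) = f (svdf_cs y) by rewrite /= hs ?s0i //; exists y.
have [F [_ FG _]] := svdf_embedding h cs.
pose y0 : mtuple (svdf_str M) onlyVG := fun t =>
  match t return 'I_(onlyVG t) -> vdf_car M t with
  | VF => fun _ => 0 : M | VG => fun _ => Some x | RF => fun _ => 0 : vf_k M end.
pose x0 : mtuple (svdf_str N) onlyVG := fun t =>
  match t return 'I_(onlyVG t) -> vdf_car N t with
  | VF => fun _ => 0 : N | VG => fun _ => Some (p x) | RF => fun _ => 0 : vf_k N end.
have [|x1] := hM (f := F) (phi := div_form n) (a := y0).
  exists x0; apply/(@div_holds N _ n (p (i x))); first by rewrite /= FG.
  by exists (p x); split=> //=; rewrite -(morphDMn pD).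
by move/(@div_holds M _ n x erefl) => [y [_ <-]]; exists y.
Qed.

(** The values of the cross-section of M, in an extension of its valued
    difference field. *)
Lemma image_section (N : valuedDiffField) (f : {rmorphism M -> N}) g : vdf_hom f g ->
  let H0 := fun x => exists y, x = g y in
  pure_stable H0 /\ exists s0 : vf_G N -> N, [/\ forall y, s0 (g y) = f (svdf_cs y),
    forall x y, H0 x -> H0 y -> s0 (x + y) = s0 x * s0 y,
    forall x, H0 x -> s0 (vdf_sG x) = vdf_s N (s0 x) &
    forall x, H0 x -> vf_v (s0 x) = Some x].
Proof.
move=> h H0; have gD := vhD h; have ginj := mono_oag_inj (vh_le h).
split.
  split.
  - by exists 0; rewrite (vh0 h).
  - by move=> _ _ [a ->] [b ->]; exists (a - b); rewrite (morphDB gD).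
  - by move=> _ [a ->]; exists (vdf_sG a); rewrite (vh_sG h).
  - by move=> _ [a ->]; exists (vdf_sGV a); rewrite (vh_sGV h).
  - move=> x n [a E]; have [b ba] := divisible a n; exists b.
    apply/eqP; rewrite -subr_eq0; apply/eqP; apply: (@oag_mulrn_eq0 _ _ n).
    by rewrite mulrnBl E -ba (morphDMn gD) subrr.
have /boolp.choice[s0 s0E] : forall x, exists u : N, forall y, g y = x -> u = f (svdf_cs y).
  move=> a; have [[y ->]|no] := pselect (H0 a); last by exists 0 => y ya; case: no; exists y.
  by exists (f (svdf_cs y)) => y' /ginj ->.
have s0g y : s0 (g y) = f (svdf_cs y) by apply: s0E.
exists s0; split=> //.
- by move=> _ _ [a ->] [b ->]; rewrite -gD !s0g svdf_csD rmorphM.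
- by move=> _ [a ->]; rewrite -(vh_sG h) !s0g svdf_cs_s (vh_s h).
- by move=> _ [a ->]; rewrite s0g (vh_v h) svdf_v_cs.
Qed.

Lemma closed_vdf : existentially_closed vdf_str (svdf_vdf M).
Proof.
move=> N F m n phi a [x xphi].
have [f [g [h FF FG FR]]] := embedding_hom F.
have [hH0 [s0 [s0g s0D s0_s v_s0]]] := image_section h.
have [N' [f' [g' [h' cs]]]] := cross_section_extension hH0 s0D s0_s v_s0.
have [F' [F'F F'G F'R]] := vh_embedding h'.
have [E [EF EG ER]] : exists E : embedding (svdf_str M) (svdf_str N'),
    [/\ forall x : M, E VF x = (f' \o f) x,
        forall a : option (vf_G M), E VG a = omap (g' \o g) a &
        forall x : M, E RF (vf_res x) = vf_res ((f' \o f) x)].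
  apply: (svdf_embedding (vdf_hom_comp h h')) => y /=.
  by rewrite cs ?s0g //; exists y.
have EE t (y : vdf_car M t) : E t y = F' t (F t y).
  apply: (@hom_agree M N' E (fun t y => F' t (F t y))) t y => [y|b|y].
  - by rewrite EF F'F FF.
  - by rewrite EG F'G FG; case: b.
  - by rewrite ER FR F'R.
have [|x1] := hM (f := E) (phi := tr_form (@base_app _) phi) (a := a); last first.
  by move/base_holds => h1; exists x1.
exists (fun t i => F' t (x t i)); apply/base_holds.
apply/(embedding_holds (F := F') (e := xyval x (fun t j => F t (a t j)))) => //.
by move=> t [i|j] //=; rewrite EE.
Qed.

Lemma closed_ac : existentially_closed acvdf_str (acvdf_of_svdf M).
Proof.
move=> N F m n phi a [x xphi].
have [F1 F1E] := ac_reduct F.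
have [f [g [h FF FG FR]]] := embedding_hom F1.
have [hH0 [s0 [s0g s0D s0_s v_s0]]] := image_section h.
pose H0 x := exists y, x = g y.
have [z zP] := ac_lift N.
have zv w := (zP w).1; have zac w := (zP w).2.
have z0 w : z w != 0 by apply/eqP => zw; have := zv w; rewrite zw vf_v0.
have ac_unit (b c : N) y : vf_v b = Some y -> vf_v c = Some y -> acvdf_ac b = 1 ->
    acvdf_ac c = 1 -> one_unit (b / c).
  move=> by_ cy b1 c1; apply: res_ou; last by rewrite (ac_res_div by_ cy c1).
  by rewrite vf_vM by_ (vf_vV cy) /= subrr.
have zD y y' : one_unit (z (y + y') / (z y * z y')).
  apply: (ac_unit _ _ (y + y')) => //; first by rewrite vf_vM !zv.
  by rewrite acvdf_acM ?z0 // !zac mulr1.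
have zs y : one_unit (z (vdf_sG y) / vdf_s N (z y)).
  apply: (ac_unit _ _ (vdf_sG y)) => //; first by rewrite vdf_v_s zv.
  by rewrite acvdf_ac_s zac vdf_sk1.
have ac_cs (y : vf_G M) : acvdf_ac (f (svdf_cs y)) = 1.
  have -> : acvdf_ac (f (svdf_cs y)) = F RF (ac_of_cs (svdf_cs y)).
    have := emap_fun F AngularComponent (svdf_cs y, tt) => /= ->.
    by rewrite -FF F1E.
  have -> : ac_of_cs (svdf_cs y) = 1.
    rewrite /ac_of_cs svdf_v_cs /= divff ?vf_res1 //.
    by apply/eqP => c0; have := svdf_v_cs y; rewrite c0 vf_v0.
  exact: (emap_fun F (AcBase RFone) tt).
have lift0 : liftable z H0 s0 H0.
  exists N, idfun, id, s0; split=> //=.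
  - exact: vdf_hom_id.
  - move=> _ [y ->]; apply: (ac_unit _ _ (g y)) => //.
      by apply: v_s0; exists y.
    by rewrite s0g ac_cs.
  - by move=> c k [d cd]; exists c.
have [l hl] := ac_form (xyval x (fun t j => F t (a t j))) phi.
have [H [hH H0H lH [N1 [f1 [g1 [s1 lo]]]]]] := adjoin_seq z0 zD zs l hH0 (fun _ h => h) lift0.
have h1 := lo_hom lo; have g1inj := mono_oag_inj (vh_le h1).
pose H1 c := exists2 d, H d & c = g1 d.
have s1v d : H d -> vf_v (s1 d) = Some (g1 d).
  move=> Hd; have := ou_v (lo_ou lo Hd); rewrite vf_vM.
  have fz : vf_v (f1 (z d)) = Some (g1 d) by rewrite (vh_v h1) zv.
  rewrite (vf_vV fz); case: (vf_v (s1 d)) => //= v [/eqP].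
  by rewrite subr_eq0 => /eqP ->.
have hH1 : pure_stable H1.
  split.
  - by exists 0; [apply: ps0 hH | rewrite (vh0 h1)].
  - move=> _ _ [d Hd ->] [d' Hd' ->]; exists (d - d'); first exact: (psB hH).
    by rewrite (morphDB (vhD h1)).
  - by move=> _ [d Hd ->]; exists (vdf_sG d); [apply: (pss hH) | rewrite (vh_sG h1)].
  - by move=> _ [d Hd ->]; exists (vdf_sGV d); [apply: (psV hH) | rewrite (vh_sGV h1)].
  - move=> c k [d Hd cd]; have [|d' d'E] := lo_pure lo (c := c) (n := k); first by exists d.
    exists d' => //; apply: (psp hH (n := k)).
    suff -> : d' *+ k.+1 = d by [].
    by apply: g1inj; rewrite -cd d'E (morphDMn (vhD h1)).
have /boolp.choice[s2 s2E] : forall c, exists u : N1, forall d, g1 d = c -> u = s1 d.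
  move=> c; have [[d ->]|no] := pselect (exists d, c = g1 d).
    by exists (s1 d) => d' /g1inj ->.
  by exists 0 => d dc; case: no; exists d.
have s2g d : s2 (g1 d) = s1 d by apply: s2E.
have [||| N' [f' [g' [h' cs]]]] := @cross_section_extension N1 H1 s2 hH1.
- by move=> _ _ [d Hd ->] [d' Hd' ->]; rewrite -(vhD h1) !s2g (loD lo).
- by move=> _ [d Hd ->]; rewrite -(vh_sG h1) !s2g (lo_s lo).
- by move=> _ [d Hd ->]; rewrite s2g s1v.
have h2 := vdf_hom_comp h1 h'.
have [F' [F'F F'G F'R]] := vh_embedding h2.
have F'ac : ac_on l F'.
  move=> b y by_ yl; have Hy := lH y yl.
  rewrite -(ac_res_div by_ (zv y) (zac y)) F'R F'F /=.
  have v' : vf_v (f' (f1 b)) = Some (g' (g1 y)).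
    by rewrite (vh_v h') (vh_v h1) by_.
  rewrite /ac_of_cs v' /= cs; last by exists y.
  rewrite s2g.
  have ou : one_unit (f' (s1 y / f1 (z y))) by apply/(vh_ou h'); apply: (lo_ou lo).
  have nz : f' (f1 (z y)) != 0 by rewrite !fmorph_eq0.
  have ns : f' (s1 y) != 0.
    by rewrite fmorph_eq0; apply/eqP => s10; have := s1v y Hy; rewrite s10 vf_v0.
  have -> : f' (f1 b) / f' (s1 y) = f' (f1 (b / z y)) * (f' (s1 y / f1 (z y)))^-1.
    rewrite !fmorph_div invf_div mulrA mulfVK //.
  rewrite vf_resM.
  - by rewrite (ou_res (ouV ou)) mulr1.
  - apply: vf_O_unit; rewrite (vh_v h') (vh_v h1) vf_vM by_ (vf_vV (zv y)) /= subrr.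
    by rewrite (vh0 h1) (vh0 h').
  - exact/vf_O_unit/ou_v/ouV.
have [E [EF EG ER]] : exists E : embedding (svdf_str M) (svdf_str N'),
    [/\ forall x : M, E VF x = ((f' \o f1) \o f) x,
        forall a : option (vf_G M), E VG a = omap ((g' \o g1) \o g) a &
        forall x : M, E RF (vf_res x) = vf_res (((f' \o f1) \o f) x)].
  apply: (svdf_embedding (vdf_hom_comp h h2)) => y /=.
  have Hy : H (g y) by apply: H0H; exists y.
  rewrite cs; last by exists (g y).
  by rewrite s2g (lo_base lo) ?s0g //; exists y.
have EE t (y : vdf_car M t) : E t y = F' t (F t y).
  rewrite -F1E.
  apply: (@hom_agree M N' E (fun t y => F' t (F1 t y))) t y => [y|b|y].
  - by rewrite EF F'F FF.
  - by rewrite EG F'G FG; case: b.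
  - by rewrite ER FR F'R.
have [|x1] := hM (f := E) (phi := tr_form (@ac_app _) phi) (a := a); last first.
  by move/ac_holds => h3; exists x1.
exists (fun t i => F' t (x t i)); apply/ac_holds.
move/(hl N' F' F'ac): xphi; congr (holds _ _).
by apply/functional_extensionality_dep => t; apply/funext => -[i|j] //=; rewrite EE.
Qed.

End Closed.

Theorem proposition2p21 (M : sValuedDiffField)
    (hM : existentially_closed svdf_str M) :
  existentially_closed acvdf_str (acvdf_of_svdf M) /\
  existentially_closed vdf_str (svdf_vdf M).
Proof. by split; [apply: closed_ac | apply: closed_vdf]. Qed.
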